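(* Let $\Sigma$ be the Bergman fan, of dimension $n$, of a (loopless) matroid or polymatroid, and let $\mathfrak{L}=(L_1,\dots,L_{n-2})$ be a collection of big and nef classes in $D(\Sigma)$. Then $$\ker\mathfrak{L}=V_{\mathfrak{L},\mathrm{eff}},\qquad V_{\mathfrak{L},\mathrm{eff}}=\mathrm{span}_{\mathbb{R}}\{D_\rho:\rho\in\Sigma(1),\ \mathfrak{L}\cdot D_\rho=0\}.$$
   Context: **Bergman fan of a matroid.** Let $M$ be a loopless matroid on a finite ground set $E$ with rank function $r$. In $U=\mathbb{R}^E/\mathbb{R}e_E$ ($e_S=\sum_{i\in S}e_i$), let $u_S$ be the image of $e_S$. The Bergman fan $\Sigma_M$ consists of the cones $\mathrm{cone}(u_{F_1},\dots,u_{F_k})$ for all flags $\emptyset\subsetneq F_1\subsetneq\dots\subsetneq F_k\subsetneq E$ of proper flats; it is simplicial, pure of dimension $r(E)-1$, and balanced with weight $\omega\equiv1$ (ray vectors $u_F$). **Bergman fan of a polymatroid.** Let $P$ be a polymatroid on $E$ with integer-valued rank function $\mathrm{rk}_P$ (normalized, monotone, submodular) and $\mathrm{rk}_P(\{e\})\ge1$ for all $e$. Let $\pi:\widetilde E\to E$ be a map of finite sets with $|\pi^{-1}(e)|\ge\mathrm{rk}_P(\{e\})$ for all $e$ (a cage). The multisymmetric lift is the matroid $M$ on $\widetilde E$ with rank $\mathrm{rk}_M(A)=\min_{B\subset E}(\mathrm{rk}_P(B)+|A\setminus\pi^{-1}(B)|)$. The polypermutohedral fan in $U=\mathbb{R}^{\widetilde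 E}/\mathbb{R}e_{\widetilde E}$ consists of the cones generated by the images of $e_i$ ($i\in S$) and $e_{\pi^{-1}(F_j)}$ ($1\le j\le k$), for all $S\subset\widetilde E$ containing no fibre $\pi^{-1}(e)$ and all chains $\emptyset\subsetneq F_1\subsetneq\dots\subsetneq F_k\subsetneq E$ of subsets. The Bergman fan $\Sigma_P$ is the subfan of those cones contained in the support of $\Sigma_M$, with these ray vectors and weight $1$; its support is that of $\Sigma_M$. **Fan notions.** For a simplicial fan $\Sigma$ pure of dimension $n$ in $U$ with ray vectors $u_\rho$ ($\rho\in\Sigma(1)$) and balanced weight $\omega$: $A^\bullet(\Sigma)=\mathbb{R}[x_\rho]/(\mathcal{I}+\mathcal{J})$ with $\mathcal{I}=\langle x_{\rho_1}\cdots x_{\rho_k}:\mathrm{cone}(\rho_1,\dots,\rho_k)\notin\Sigma\rangle$, $\mathcal{J}=\langle\sum_\rho(v,u_\rho)x_\rho:v\in U^*\rangle$; $\deg_\Sigma:A^n(\Sigma)\to\mathbb{R}$ is the linear map with $\deg_\Sigma(\prod_{\rho\in\sigma(1)}x_\rho)=\omega(\sigma)$ for $n$-dimensional $\sigma$. $D(\Sigma)$ is the space of conewise linear functions on $|\Sigma|$ modulo restrictions of linear functions; $D_\rho$ is the class of the function with value $1$ at $u_\rho$ and $0$ at all other $u_{\rho'}$; $D_\rho\mapsto x_\rho$ identifies $D(\Sigma)\cong A^1(\Sigma)$. $\mathfrak{L}$ also denotes the product $L_1\cdots L_{n-2}$, and $\ker\mathfrak{L}=\{\eta\in D(\Sigma):\deg_\Sigma(\mathfrak{L}\cdot\eta\cdot\xi)=0\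 \forall\xi\in D(\Sigma)\}$; similarly $\mathfrak{L}\cdot D_\rho=0$ means $D_\rho\in\ker\mathfrak{L}$. (For Bergman fans Poincaré duality holds, so this is the same as vanishing in $A^{n-1}(\Sigma)$.) A class is nef if for every $\tau\in\Sigma$ it has a representative $\phi$ with $\phi|_\tau=0$ and $\phi\ge0$ on every cone of $\Sigma$ that contains $\tau$ as a face. A class is big if it lies in the interior of $\mathrm{cone}\{D_\rho:\rho\in\Sigma(1)\}$. *)

(* Defs.v *)
From HB Require Import structures.
From mathcomp Require Import all_boot all_order all_algebra.
From mathcomp Require Import all_classical all_reals topology normedtype.
From mathcomp Require mpoly.
Import (canonicals, coercions) mpoly.

Set Implicit Arguments.
Unset Strict Implicit.
Unset Printing Implicit Defensive.

Import Order.TTheory GRing.Theory Num.Theory.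
Import numFieldNormedType.Exports.

Local Open Scope classical_set_scope.
Local Open Scope ring_scope.
Local Open Scope quotient_scope.

Section QuotientModule.
Variables (R : pzRingType) (V : lmodType R) (W : submodClosed V).

(* [submodClosed] does not inherit from [zmodClosed], on which the library's
   quotient construction is based; [quot_by] is [W] with that structure. *)
Definition quot_by : {pred V} := fun v => v \in W.

Lemma quot_by_zmod_closed : zmod_closed quot_by.
Proof.
split=> [|u v hu hv]; first exact: (rpred0 W).
by rewrite /quot_by unfold_in /= -scaleN1r; apply: rpredD => //; exact: rpredZ.
Qed.

HB.instance Definition _ := GRing.isZmodClosed.Build V quot_by
  quot_by_zmod_closed.

Definition quot_module : Type := Quotient.quot quot_by.

Local Notation Q := quot_module.

HB.instance Definition _ := EqQuotient.on Q.
HB.instance Definition _ := GRing.Zmodule.on Q.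

Definition quot_scale (a : R) (x : Q) : Q := \pi_Q (a *: repr x).

Lemma pi_quot_scale (a : R) (v : V) : quot_scale a (\pi_Q v) = \pi_Q (a *: v).
Proof.
apply/eqP; rewrite /quot_scale -Quotient.idealrBE -scalerBr.
apply: (rpredZ (s := W)).
rewrite -[_ \in _]/(_ \in quot_by).
by rewrite Quotient.idealrBE reprK.
Qed.

Let pi_quotD (u v : V) : \pi_Q (u + v) = \pi_Q u + \pi_Q v.
Proof. exact: pi_addr. Qed.

Lemma quot_scaleA a b (x : Q) :
  quot_scale a (quot_scale b x) = quot_scale (a * b) x.
Proof.
elim/quotW: x => v; rewrite (pi_quot_scale b) (pi_quot_scale a (b *: v)).
rewrite pi_quot_scale scalerA; reflexivity.
Qed.

Lemma quot_scale1 : left_id 1 quot_scale.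
Proof. by elim/quotW => v; rewrite pi_quot_scale scale1r. Qed.

Lemma quot_scaleDr : right_distributive quot_scale +%R.
Proof.
move=> a; elim/quotW => v; elim/quotW => w.
by rewrite -pi_quotD !pi_quot_scale scalerDr pi_quotD.
Qed.

Lemma quot_scaleDl (x : Q) : {morph quot_scale^~ x : a b / a + b}.
Proof.
by move=> a b /=; elim/quotW: x => v; rewrite !pi_quot_scale scalerDl pi_quotD.
Qed.

HB.instance Definition _ := GRing.Zmodule_isLmodule.Build R Q
  quot_scaleA quot_scale1 quot_scaleDr quot_scaleDl.

End QuotientModule.

(* A simplicial fan is recorded by its rays, their chosen generators, and the
   sets of rays that span a cone; the faces of a cone are the subsets of its set
   of rays.  The axioms of a balanced simplicial fan are not part of the record;
   the fans considered below satisfy them. *)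
Record fan (R : realType) (U : vectType R) := Fan {
  ray : finType;
  ray_vec : ray -> U;
  fan_cones : {set {set ray}};
  weight : {set ray} -> R }.

Section Cones.
Variables (R : realType) (U : vectType R).

Definition cone (T : finType) (u : T -> U) (s : {set T}) : set U :=
  [set x | exists2 c : T -> R, (forall i, 0 <= c i) &
           x = \sum_(i in s) c i *: u i].

Definition support (Sigma : fan U) : set U :=
  [set x | exists2 s, s \in fan_cones Sigma & cone (@ray_vec _ _ Sigma) s x].

Definition cone_dim (Sigma : fan U) (s : {set ray Sigma}) : nat :=
  \dim (\sum_(i in s) <[ray_vec i]>)%VS.

Definition fan_dim (Sigma : fan U) : nat :=
  (\max_(s in fan_cones Sigma) cone_dim s)%N.

End Cones.

Section ConewiseLinear.
Variables (R : realType) (U : vectType R) (Sigma : fan U).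

Local Notation u := (@ray_vec _ _ Sigma).

(* Functions on the support are represented by functions on U; their values
   outside the support are irrelevant, see [linear_on_support]. *)
Definition conewise_linear : {pred U -> R^o} :=
  [pred phi : U -> R^o | `[< forall s, s \in fan_cones Sigma ->
     exists v : 'Hom(U, R^o), forall x, cone u s x -> phi x = v x >] ].

Lemma conewise_linear_submod : subsemimod_closed conewise_linear.
Proof.
split; [split|].
- by apply/asboolP => s _; exists 0 => x _; rewrite lfunE.
- move=> f g /asboolP Hf /asboolP Hg; apply/asboolP => s hs.
  have [v hv] := Hf s hs; have [w hw] := Hg s hs.
  by exists (v + w) => x hx; rewrite lfunE/= -hv// -hw.
- move=> a f /asboolP Hf; apply/asboolP => s hs.
  have [v hv] := Hf s hs.
  by exists (a *: v) => x hx; rewrite lfunE/= -hv.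
Qed.

HB.instance Definition _ := GRing.isSubmodClosed.Build R (U -> R^o)
  conewise_linear conewise_linear_submod.

Record PL := MkPL { PL_fun :> U -> R^o ; _ : PL_fun \in conewise_linear }.

HB.instance Definition _ := [isSub for PL_fun].
HB.instance Definition _ := [Choice of PL by <:].
HB.instance Definition _ := [SubChoice_isSubLmodule of PL by <:].

Definition linear_on_support : {pred PL} :=
  [pred phi : PL | `[< exists v : 'Hom(U, R^o),
     forall x, support Sigma x -> phi x = v x >] ].

Lemma linear_on_support_submod : subsemimod_closed linear_on_support.
Proof.
split; [split|].
- by apply/asboolP; exists 0 => x _; rewrite lfunE.
- move=> f g /asboolP[v hv] /asboolP[w hw]; apply/asboolP.
  by exists (v + w) => x hx; rewrite lfunE/= -hv// -hw.
- move=> a f /asboolP[v hv]; apply/asboolP.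
  by exists (a *: v) => x hx; rewrite lfunE/= -hv.
Qed.

HB.instance Definition _ := GRing.isSubmodClosed.Build R PL
  linear_on_support linear_on_support_submod.

Definition D : Type := quot_module linear_on_support.

HB.instance Definition _ := EqQuotient.on D.
HB.instance Definition _ := GRing.Lmodule.on D.

End ConewiseLinear.

Definition ring_ideal (A : comPzRingType) (I : set A) : Prop :=
  [/\ I 0, forall p q, I p -> I q -> I (p + q) & forall p q, I q -> I (p * q)].

Section ChowRing.
Variables (R : realType) (U : vectType R) (Sigma : fan U).

Definition poly_ring : comAlgType R := mpoly.mpoly #|ray Sigma| R.

Definition X (i : ray Sigma) : poly_ring :=
  mpoly.mpolyX R (mpoly.mnm1 (enum_rank i)).

Definition nonface_relations : set poly_ring :=
  [set p | exists2 s : {set ray Sigma},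
     s \notin fan_cones Sigma & p = \prod_(i in s) X i].

Definition linear_relations : set poly_ring :=
  [set p | exists v : 'Hom(U, R^o), p = \sum_i (v (ray_vec i) : R) *: X i].

Definition chow_ideal : {pred poly_ring} :=
  [pred p | `[< smallest (@ring_ideal poly_ring)
                  (nonface_relations `|` linear_relations) p >] ].

Lemma chow_idealM p q : q \in chow_ideal -> p * q \in chow_ideal.
Proof.
move=> /asboolP hq; apply/asboolP => I hI.
by have [[_ _ IM] _] := hI; apply/IM/(hq I hI).
Qed.

Lemma chow_ideal_submod : subsemimod_closed chow_ideal.
Proof.
split; [split|].
- by apply/asboolP => I [[]].
- move=> p q /asboolP hp /asboolP hq; apply/asboolP => I hI.
  by have [[_ ID _] _] := hI; apply: ID; [exact: hp|exact: hq].
- by move=> a p hp; rewrite -mulr_algl chow_idealM.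
Qed.

HB.instance Definition _ := GRing.isSubmodClosed.Build R poly_ring
  chow_ideal chow_ideal_submod.

Definition A : Type := quot_module chow_ideal.

HB.instance Definition _ := EqQuotient.on A.
HB.instance Definition _ := GRing.Lmodule.on A.

Definition A_mul (x y : A) : A := \pi_A (repr x * repr y).

Lemma pi_A_mul p q : A_mul (\pi_A p) (\pi_A q) = \pi_A (p * q).
Proof.
have h p' : repr (\pi_A p') - p' \in chow_ideal.
  rewrite -[_ \in _]/(_ \in quot_by chow_ideal).
  by rewrite Quotient.idealrBE reprK.
apply/eqP; rewrite /A_mul -Quotient.idealrBE -[_ \in _]/(_ \in chow_ideal).
set p' := repr _; set q' := repr _.
have -> : p' * q' - p * q = q' * (p' - p) + p * (q' - q).
  by rewrite !mulrBr (mulrC q' p') (mulrC q' p) addrA subrK.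
by apply: rpredD; apply: chow_idealM; exact: h.
Qed.

Let pi_AD p q : \pi_A (p + q) = \pi_A p + \pi_A q.
Proof. exact: pi_addr. Qed.

Lemma A_mulA : associative A_mul.
Proof.
elim/quotW => p; elim/quotW => q; elim/quotW => r.
rewrite (pi_A_mul q r) (pi_A_mul p (q * r)) (pi_A_mul p q) (pi_A_mul (p * q) r).
rewrite mulrA; reflexivity.
Qed.

Lemma A_mulC : commutative A_mul.
Proof.
elim/quotW => p; elim/quotW => q; rewrite (pi_A_mul p q) (pi_A_mul q p).
rewrite mulrC; reflexivity.
Qed.

Lemma A_mul1 : left_id (\pi_A 1) A_mul.
Proof. elim/quotW => p; rewrite pi_A_mul mul1r; reflexivity. Qed.

Lemma A_mulDl : left_distributive A_mul +%R.
Proof.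
elim/quotW => p; elim/quotW => q; elim/quotW => r.
rewrite -(pi_AD p q) (pi_A_mul (p + q) r) (pi_A_mul p r) (pi_A_mul q r).
rewrite mulrDl pi_AD; reflexivity.
Qed.

HB.instance Definition _ := GRing.Zmodule_isComPzRing.Build A
  A_mulA A_mulC A_mul1 A_mulDl.

Definition x_ (i : ray Sigma) : A := \pi_A (X i).

(* The degree map, extended by zero to the graded pieces other than the one of
   degree [fan_dim Sigma]. *)
Definition is_degree_map (f : A -> R^o) : Prop :=
  [/\ linear f,
      forall s, s \in fan_cones Sigma -> cone_dim s = fan_dim Sigma ->
        f (\prod_(i in s) x_ i) = weight s &
      forall (k : nat) (p : poly_ring), k <> fan_dim Sigma ->
        p \is mpoly.ishomog1 k mpoly.mdeg -> f (\pi_A p) = 0].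

Definition deg : A -> R^o := xget (fun=> 0) is_degree_map.

End ChowRing.

Section DivisorClasses.
Variables (R : realType) (U : vectType R) (Sigma : fan U).

Local Notation D := (D Sigma).

Definition D_ (i : ray Sigma) : D :=
  \pi_D (xget 0 [set phi : PL Sigma |
                  forall j, phi (ray_vec j) = (j == i)%:R]).

(* This is the linear map D(Sigma) -> A^1(Sigma) sending [D_ i] to [x_ i]: a
   conewise linear function is determined by its values on the rays, and the
   restriction of a linear function is sent to a linear relation. *)
Definition D_to_A (d : D) : A Sigma :=
  \sum_i ((repr d : PL Sigma) (ray_vec i) : R) *: x_ i.

Definition D_cone : set D :=
  [set d | exists2 c : ray Sigma -> R, (forall i, 0 <= c i) &
           d = \sum_i c i *: D_ i].

(* The topology of the finite-dimensional real vector space D(Sigma), obtained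
   as a quotient of the Euclidean one along R^(Sigma(1)) -> D(Sigma), which
   sends the standard basis to the spanning family [D_]. *)
Definition D_of_coord (a : 'rV[R]_#|ray Sigma|) : D :=
  \sum_i a ord0 (enum_rank i) *: D_ i.

Definition D_open (O : set D) : Prop := open (D_of_coord @^-1` O).

Lemma D_openT : D_open setT.
Proof. by rewrite /D_open preimage_setT; exact: openT. Qed.

Lemma D_openI (O P : set D) : D_open O -> D_open P -> D_open (O `&` P).
Proof. exact: openI. Qed.

Lemma D_open_bigU (I : Type) (O : I -> set D) :
  (forall i, D_open (O i)) -> D_open (\bigcup_i O i).
Proof. by move=> h; apply: bigcup_open => i _; exact: h. Qed.

HB.instance Definition _ := isOpenTopological.Build D
  D_openT D_openI D_open_bigU.

Definition big (d : D) : Prop := (D_cone^° : set D) d.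

Definition nef (d : D) : Prop :=
  forall t, t \in fan_cones Sigma ->
  exists phi : PL Sigma, [/\ \pi_D phi = d,
    forall x, cone (@ray_vec _ _ Sigma) t x -> phi x = 0 &
    forall s, s \in fan_cones Sigma -> t \subset s ->
      forall x, cone (@ray_vec _ _ Sigma) s x -> 0 <= (phi x : R)].

Definition ker_mixed (m : nat) (L : 'I_m -> D) : set D :=
  [set eta | forall xi : D,
     deg ((\prod_(k < m) D_to_A (L k)) * D_to_A eta * D_to_A xi) = 0].

Definition V_eff (m : nat) (L : 'I_m -> D) : set D :=
  [set eta | exists c : ray Sigma -> R,
     eta = \sum_(i | `[< ker_mixed L (D_ i) >]) c i *: D_ i].

End DivisorClasses.

(* Fan with cones [cone u C] for [C] in the family [CC], which is to be closed
   under taking subsets; the weights are 1. *)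
Definition fan_of (R : realType) (U : vectType R) (T : finType) (u : T -> U)
    (CC : {set {set T}}) : fan U :=
  @Fan R U {t : T | [set t]%SET \in CC} (fun t => u (val t))
    [set s : {set {t : T | [set t]%SET \in CC}} | [set val t | t in s] \in CC]%SET
    (fun=> 1).

Section BergmanFans.
Variable R : realType.

Definition e_ (E : finType) (S : {set E}) : {ffun E -> R^o} :=
  [ffun i => (i \in S)%:R].

(* [q] presents [U] as the quotient R^E / R e_E *)
Definition quotient_by_eE (E : finType) (U : vectType R)
    (q : 'Hom({ffun E -> R^o}, U)) : Prop :=
  limg q = fullv /\ lker q = <[e_ [set: E]]>%VS.

Definition polymatroid (E : finType) (rk : {set E} -> nat) : Prop :=
  [/\ rk (finset.set0) = 0%N,
      forall B C : {set E}, B \subset C -> (rk B <= rk C)%N &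
      forall B C : {set E}, (rk (B :|: C) + rk (B :&: C) <= rk B + rk C)%N].

Definition matroid (E : finType) (r : {set E} -> nat) : Prop :=
  polymatroid r /\ forall B : {set E}, (r B <= #|B|)%N.

Definition loopless (E : finType) (r : {set E} -> nat) : Prop :=
  forall e : E, (0 < r [set e]%SET)%N.

Definition flat (E : finType) (r : {set E} -> nat) (F : {set E}) : bool :=
  [forall e, (e \notin F) ==> (r F < r (e |: F))%N].

Definition chain (E : finType) (C : {set {set E}}) : bool :=
  [forall F in C, forall G in C, (F \subset G) || (G \subset F)].

Definition flags (E : finType) (r : {set E} -> nat) : {set {set {set E}}} :=
  [set C : {set {set E}} | chain C &&
     [forall F in C, [&& flat r F, F != finset.set0 & F != finset.setT]] ]%SET.

Definition matroid_fan (E : finType) (r : {set E} -> nat) (U : vectType R)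
    (q : 'Hom({ffun E -> R^o}, U)) : fan U :=
  fan_of (fun F : {set E} => q (e_ F)) (flags r).

Section Polymatroid.
Variables (E Et : finType) (rk : {set E} -> nat) (pi : Et -> E).

(* the term [B = set0] of the minimum is [#|A|] *)
Definition lift_rank (A : {set Et}) : nat :=
  (\big[minn/#|A|]_(B : {set E}) (rk B + #|A :\: pi @^-1: B|))%N.

Definition cage : Prop := forall e, (rk [set e]%SET <= #|pi @^-1: [set e]%SET|)%N.

Variables (U : vectType R) (q : 'Hom({ffun Et -> R^o}, U)).

(* generators of the possible rays of the polypermutohedral fan *)
Definition poly_vec (t : Et + {set E}) : U :=
  match t with
  | inl i => q (e_ [set i]%SET)
  | inr F => q (e_ (pi @^-1: F))
  end.

Definition polypermutohedral_cones : {set {set Et + {set E}}} :=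
  [set C : {set Et + {set E}} |
    [&& [forall e, ~~ (pi @^-1: [set e] \subset [set i | inl i \in C])],
        chain [set F | inr F \in C] &
        [forall F, (inr F \in C) ==> (F != finset.set0) && (F != finset.setT)] ] ]%SET.

Definition polymatroid_fan : fan U :=
  fan_of poly_vec [set C in polypermutohedral_cones |
    `[< cone poly_vec C `<=` support (matroid_fan lift_rank q) >] ]%SET.

End Polymatroid.

Inductive bergman_fan (U : vectType R) : fan U -> Prop :=
| Bergman_matroid (E : finType) (r : {set E} -> nat)
    (q : 'Hom({ffun E -> R^o}, U)) :
    matroid r -> loopless r -> quotient_by_eE q ->
    bergman_fan (matroid_fan r q)
| Bergman_polymatroid (E Et : finType) (rk : {set E} -> nat) (pi : Et -> E)
    (q : 'Hom({ffun Et -> R^o}, U)) :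
    polymatroid rk -> (forall e, (1 <= rk [set e]%SET)%N) -> cage rk pi ->
    quotient_by_eE q ->
    bergman_fan (polymatroid_fan rk pi q).

End BergmanFans.

(* Main.v *)
(* A local-to-global argument on the links of cones (in the style of Bochner
   formulas, after Shenfeld and van Handel) gives the Hodge-Riemann relations in
   degree one, hence the Alexandrov-Fenchel inequality, for products of nef
   classes.  A class killed by a product of ample classes is linear near every
   ray, and these linear functions glue, so it is zero.

   To pass from ample classes to a big and nef [L] times a product [M], let [f]
   be killed by [L M] and let [H] be ample.  Among the classes differing from [f]
   by a combination of the [D_rho] killed by [L M], take a critical point [g] of
   the form of [H M].  The form of [M D_rho] is nonpositive on [g] for every
   [rho], while [L] is a combination of the [D_rho] with positive coefficients
   and kills [g] against itself; so all these numbers vanish and [g] is killed by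
   [H M].  Replacing the classes one at a time by ample ones, one reaches a
   product of ample classes, where the kernel is zero.

   Both kinds of Bergman fans are fans of nested sets of flats: a cone cuts the
   ground set into classes and every ray of its link refines exactly one of them,
   which reduces the geometry of links to combinatorics.  Sums of the conewise
   linear functions "minimum of the coordinates in a set" give an ample class. *)
From HB Require Import structures.
Require Import Defs.
From mathcomp Require Import all_boot all_order all_algebra ring lra zify.

Set Implicit Arguments.
Unset Strict Implicit.
Unset Printing Implicit Defensive.
Import Order.TTheory GRing.Theory Num.Theory.

(** The form of [H M] can be degenerate on the span of the killed rays, so the critical point is not
    automatic. An equality case rescues it: a vector in the radical of the restricted form is null
    and orthogonal to [L], hence orthogonal to every class, and this is the solvability condition of
    the critical equations. The other obstacle is that products of merely nef classes may vanish on
    a link, where no class of positive square need exist. Negativity on an orthogonal hyperplane is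
    then deduced from a single nonzero pairing. Exchanging [L] for [H] creates no new killed rays,
    because an ample class detects whether a product of nef classes is zero. The induction rests on
    the signature of the form on two-dimensional links. If their rays split two classes, the link is
    a complete bipartite graph and the form is a hyperbolic plane up to its radical. If they split
    one class, the link resembles the points and lines of a plane, and the class alpha is the
    positive direction. *)

Section RealLemmas.
Local Open Scope ring_scope.
Variable R : realFieldType.

(** Replaces a limit [e -> 0]: inequalities perturbed by [e] times an ample class are polynomials of
    degree two in [e]. *)
Lemma quadratic_ge0_lim (a b c : R) :
  (forall e, 0 < e -> 0 <= a + e * b + e ^+ 2 * c) -> 0 <= a.
Proof.
move=> h; rewrite leNgt; apply/negP => a0.
(* The bound 1 gives [e ^ 2 <= e]; the other bound keeps both correction terms together below
   [- a / 2]. *)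
pose e := Num.min 1 (- a / (2 * (`|b| + `|c| + 1))).
have den : 0 < `|b| + `|c| + 1 by rewrite ltr_wpDl ?addr_ge0.
have e0 : 0 < e by rewrite lt_min ltr01/= divr_gt0 ?mulr_gt0 ?oppr_gt0 ?ltr0n.
have e1 : e <= 1 by rewrite ge_min lexx.
have ea : e * (`|b| + `|c| + 1) <= - a / 2.
  rewrite -ler_pdivlMr// -mulrA -invfM.
  by rewrite ge_min lexx orbT.
have := h e e0.
have hb : e * b <= e * `|b| by rewrite ler_pM2l// ler_norm.
have hc : e ^+ 2 * c <= e * `|c|.
  apply: le_trans (_ : e ^+ 2 * `|c| <= _); first by rewrite ler_wpM2l ?ler_norm// exprn_ge0// ltW.
  by rewrite ler_wpM2r// expr2 ler_piMl// ltW.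
nra.
Qed.

Lemma linear_term_eq0 (a b : R) :
  (forall t, a + t * b <= 0) -> b = 0.
Proof.
move=> h; apply/eqP/negPn/negP => b0.
have := h ((1 - a) / b); rewrite divfK//; lra.
Qed.

(** [Q] is required below each threshold, not only at it, so that the minimum of finitely many
    thresholds serves all [t]. *)
Lemma common_eps (T : finType) (Q : T -> R -> Prop) :
  (forall t, exists2 e, 0 < e & forall d, 0 < d -> d <= e -> Q t d) ->
  exists2 e, 0 < e & forall t, Q t e.
Proof.
move=> h; suff: exists2 e, 0 < e &
    forall t, t \in enum T -> forall d, 0 < d -> d <= e -> Q t d.
  by case=> e e0 he; exists e => // t; apply: he; rewrite ?mem_enum.
elim: (enum T) => [|t s [e e0 he]]; first by exists 1.
have [f f0 hf] := h t; exists (Num.min e f) => [|u].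
  by rewrite lt_min e0.
rewrite inE => /orP[/eqP->|us] d d0; rewrite le_min => /andP[de df].
  exact: hf.
exact: he.
Qed.

End RealLemmas.

(** * Linear systems *)

Section LinearSystems.
Local Open Scope ring_scope.

(** Fredholm alternative: by symmetry the range of [G] is the annihilator of its kernel. *)
Lemma symmetric_solve (R : fieldType) (T : finType) (G : T -> T -> R)
    (y : T -> R) : (forall i j, G i j = G j i) ->
  (forall k : T -> R, (forall i, \sum_j G i j * k j = 0) ->
     \sum_i y i * k i = 0) ->
  exists z : T -> R, forall i, \sum_j G i j * z j = y i.
Proof.
move=> Gs hy; set m := #|T|.
pose M : 'M[R]_m := \matrix_(i, j) G (enum_val i) (enum_val j).
pose Y : 'rV[R]_m := \row_i y (enum_val i).
have reind (h : T -> R) : \sum_i h i = \sum_(i < m) h (enum_val i).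
  by rewrite (reindex_onto enum_val enum_rank)//= => [|i _];
    [apply: eq_bigl => i; rewrite enum_valK eqxx|rewrite enum_rankK].
have : (Y <= M)%MS.
  rewrite submxE; apply/eqP/rowP => c; rewrite !mxE.
  transitivity (\sum_i y i * cokermx M (enum_rank i) c).
    by rewrite [RHS]reind; apply: eq_bigr => i _; rewrite mxE enum_valK.
  apply: hy => i; have := mulmx_coker M.
  move=> /matrixP/(_ (enum_rank i) c); rewrite !mxE; apply: etrans.
  rewrite reind; apply: eq_bigr => j _.
  by rewrite [M _ _]mxE enum_rankK enum_valK.
case/submxP => Z YZ; exists (fun i => Z ord0 (enum_rank i)) => i.
have := congr1 (fun A : 'rV[R]_m => A ord0 (enum_rank i)) YZ.
rewrite !mxE enum_rankK => ->; rewrite reind; apply: eq_bigr => j _.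
by rewrite mxE enum_rankK enum_valK mulrC Gs.
Qed.

Lemma symmetric_solve_on (R : fieldType) (T : finType) (K : {set T})
    (G : T -> T -> R) (y : T -> R) : (forall i j, G i j = G j i) ->
  (forall k : T -> R, (forall i, i \in K -> \sum_(j in K) G i j * k j = 0) ->
     \sum_(i in K) y i * k i = 0) ->
  exists z : T -> R, forall i, i \in K -> \sum_(j in K) G i j * z j = y i.
Proof.
move=> Gs hy; pose c i : R := (i \in K)%:R.
have sumK (f : T -> R) : \sum_(i in K) f i = \sum_i c i * f i.
  rewrite big_mkcond; apply: eq_bigr => i _; rewrite /c.
  by case: ifP => _; rewrite ?mul1r ?mul0r.
have [||z hz] := @symmetric_solve R T (fun i j => c i * c j * G i j)
  (fun i => c i * y i).
- by move=> i j; rewrite Gs (mulrC (c i)).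
- move=> k hk; rewrite -[RHS](hy k) => [|i iK].
    by rewrite sumK; apply: eq_bigr => i _; rewrite mulrA.
  rewrite -[RHS](hk i) sumK; apply: eq_bigr => j _.
  by rewrite /c iK mul1r mulrA.
exists z => i iK; have ci : c i = 1 by rewrite /c iK.
have := hz i; rewrite ci mul1r => <-.
by rewrite sumK; apply: eq_bigr => j _; rewrite mul1r mulrA.
Qed.

(* The eigenvalues [e] of the random walk [D^-1 G] on a connected graph with
   vertex weights [D] are at most 1, with 1 simple; the last hypothesis says
   [e <= e ^ 2], so all the other ones are nonpositive.  The proof avoids
   eigenvalues by solving [(D - G) w = D x]. *)
Lemma bochner_negative (R : realFieldType) (T : finType) (K : {set T})
    (G : T -> T -> R) (m : T -> R) :
  (forall i j, G i j = G j i) ->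
  (forall i j, i \in K -> j \in K -> i != j -> 0 <= G i j) ->
  (forall i, i \in K -> \sum_(j in K) G i j = m i) ->
  (forall i, i \in K -> 0 < m i) ->
  (forall f : T -> R,
    (forall i j, i \in K -> j \in K -> i != j -> 0 < G i j -> f i = f j) ->
    forall i j, i \in K -> j \in K -> f i = f j) ->
  (forall x : T -> R, \sum_(i in K) \sum_(j in K) G i j * x i * x j <=
     \sum_(i in K) (m i)^-1 * (\sum_(j in K) G i j * x j) ^+ 2) ->
  forall x : T -> R, \sum_(i in K) m i * x i = 0 ->
    \sum_(i in K) \sum_(j in K) G i j * x i * x j <= 0.
Proof.
move=> Gs G0 Gm m0 conn boch x mx0.
pose g (u v : T -> R) := \sum_(i in K) \sum_(j in K) G i j * u i * v j.
pose d (u v : T -> R) := \sum_(i in K) m i * u i * v i.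
(* The Dirichlet energy of [u]: nonnegative edge weights make [D - G] positive semidefinite. *)
have gsum u : \sum_(i in K) \sum_(j in K) G i j * (u i - u j) ^+ 2 =
    2 * (d u u - g u u).
  have d1 : d u u = \sum_(i in K) \sum_(j in K) G i j * u i ^+ 2.
    by apply: eq_bigr => i iK; rewrite -(Gm i iK) !mulr_suml;
      apply: eq_bigr => j _; ring.
  have d2 : d u u = \sum_(i in K) \sum_(j in K) G i j * u j ^+ 2.
    rewrite d1 exchange_big; apply: eq_bigr => i _; apply: eq_bigr => j _.
    by rewrite Gs.
  have -> : 2 * (d u u - g u u) = d u u + d u u - 2 * g u u by ring.
  rewrite {1}d1 d2 /g -big_split/= mulr_sumr -sumrB; apply: eq_bigr => i _.
  rewrite -big_split/= mulr_sumr -sumrB; apply: eq_bigr => j _; ring.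
have term0 u i j : i \in K -> j \in K -> 0 <= G i j * (u i - u j) ^+ 2.
  move=> iK jK; have [->|ij] := eqVneq i j; first by rewrite subrr expr0n mulr0.
  by rewrite mulr_ge0 ?sqr_ge0 ?G0.
have psd u : g u u <= d u u.
  have : 0 <= 2 * (d u u - g u u).
    by rewrite -gsum; do 2!(apply: sumr_ge0 => ? ?); apply: term0.
  lra.
pose M i j := (i == j)%:R * m i - G i j.
have Mx i u : i \in K -> \sum_(j in K) M i j * u j =
    m i * u i - \sum_(j in K) G i j * u j.
  move=> iK; under eq_bigr do rewrite /M mulrBl.
  rewrite sumrB (bigD1 i)//= eqxx mul1r big1 ?addr0// => j /andP[_ /negPf ji].
  by rewrite eq_sym ji !mul0r.
have [||w hw] := @symmetric_solve_on R T K M (fun i => m i * x i).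
- by move=> i j; rewrite /M Gs eq_sym; case: eqVneq => [->|_]//; rewrite !mul0r.
(* A vector killed by [D - G] has energy zero, so it is constant along edges and hence on [K]; it
   pairs to zero with [D x] since [x] has weighted mean zero. *)
- move=> k hk; have : forall i j, i \in K -> j \in K -> k i = k j.
    apply: conn => i j iK jK ij Gij.
    have dg0 : d k k - g k k = 0.
      rewrite -sumrB big1// => l lK; have := hk l lK; rewrite Mx// => /eqP.
      rewrite subr_eq0 => /eqP e; rewrite e mulr_suml -sumrB big1// => r _.
      by rewrite mulrAC subrr.
    have : G i j * (k i - k j) ^+ 2 = 0.
      have := gsum k; rewrite dg0 mulr0 => /eqP.
      rewrite psumr_eq0 => [/allP/(_ i)|l lK]; last first.
        by apply: sumr_ge0 => r rK; apply: term0.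
      rewrite mem_index_enum iK => /(_ isT)/=.
      rewrite psumr_eq0 => [/allP/(_ j)|r rK]; last exact: term0.
      by rewrite mem_index_enum jK => /(_ isT)/eqP.
    by move/eqP; rewrite mulf_eq0 gt_eqF//= sqrf_eq0 subr_eq0 => /eqP.
  move=> kc; have [->|[i0 i0K]] := set_0Vmem K; first by rewrite big_set0.
  transitivity (\sum_(i in K) m i * x i * k i0).
    by apply: eq_bigr => i iK; rewrite (kc i i0).
  by rewrite -mulr_suml mx0 mul0r.
have Gw i : i \in K -> \sum_(j in K) G i j * w j = m i * (w i - x i).
  by move=> iK; have := hw i iK; rewrite Mx//; set S := \sum_(j in K) _; lra.
have gv v : g w v = d w v - d x v.
  rewrite /g exchange_big -sumrB; apply: eq_bigr => i iK.
  rewrite -mulr_suml; under eq_bigr do rewrite Gs; rewrite Gw//; ring.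
have gC u v : g u v = g v u.
  rewrite /g exchange_big; apply: eq_bigr => i _; apply: eq_bigr => j _.
  by rewrite Gs mulrAC.
have dC u v : d u v = d v u by apply: eq_bigr => i _; rewrite mulrAC.
(* As [G w = D (w - x)], the hypothesis at [w] compares [d w w - d x w] with [d (w - x) (w - x)].
   Together with semidefiniteness at [w - x] this gives [g x x <= d x w - d x x <= 0]. *)
have h1 : d x w <= d x x.
  have := boch w; rewrite -/(g w w) gv.
  have -> : \sum_(i in K) (m i)^-1 * (\sum_(j in K) G i j * w j) ^+ 2
      = d w w - 2 * d x w + d x x.
    rewrite /d mulr_sumr -sumrB -big_split; apply: eq_bigr => i iK /=.
    by rewrite Gw//; have := m0 i iK; move=> mi; field; rewrite gt_eqF.
  lra.
have h2 := psd (fun i => w i - x i).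
have gB : g (fun i => w i - x i) (fun i => w i - x i) = g w w - 2 * g w x + g x x.
  rewrite -[2 * _]/(2 * _) mulr2n mulrDl mul1r {2}(gC w x) /g opprD addrA.
  rewrite -!sumrB -big_split/=; apply: eq_bigr => i _.
  by rewrite -!sumrB -big_split/=; apply: eq_bigr => j _; ring.
have dB : d (fun i => w i - x i) (fun i => w i - x i) = d w w - 2 * d w x + d x x.
  rewrite /d mulr_sumr -sumrB -big_split/=; apply: eq_bigr => i _; ring.
move: h2; rewrite gB dB !gv (dC w x) -/(g x x); lra.
Qed.

(** Forward substitution along the levels of [h]: a correction made at level [k] changes nothing at
    lower levels and, within the level, only its own entry. *)
Lemma unitriangular_solve (R : pzRingType) (V : finType) (s : {set V})
    (h : V -> nat) (M : V -> V -> R) (x : V -> R) :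
  (forall i, i \in s -> M i i = 1) ->
  (forall i j, i \in s -> j \in s -> (h j <= h i)%N -> j != i -> M i j = 0) ->
  exists c : V -> R, forall j, j \in s -> \sum_(i in s) c i * M i j = x j.
Proof.
move=> M1 M0; suff: forall k, exists c : V -> R, forall j, j \in s ->
    (h j < k)%N -> \sum_(i in s) c i * M i j = x j.
  move=> /(_ (\max_(i in s) h i)%N.+1)[c hc]; exists c => j js.
  by rewrite hc// ltnS; apply: (leq_bigmax_cond (F := h)).
elim=> [|k [c hc]]; first by exists (fun=> 0).
pose e j := x j - \sum_(i in s) c i * M i j.
exists (fun i => c i + (if h i == k then e i else 0)) => j js.
rewrite ltnS leq_eqVlt; under eq_bigr do rewrite mulrDl.
rewrite big_split/=; have [jk _|jk /= jk'] := eqVneq (h j) k.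
  rewrite [X in _ + X](bigD1 j)//= jk eqxx M1// mulr1 [X in _ + (_ + X)]big1 ?addr0.
    by rewrite /e addrC subrK.
  move=> i /andP[ks ij]; case: eqVneq => [ik|_]; last by rewrite mul0r.
  by rewrite M0 ?mulr0// ?ik ?jk// eq_sym.
rewrite hc// [X in _ + X]big1 ?addr0// => i ks; case: eqVneq => [ik|_]; last by rewrite mul0r.
rewrite M0 ?mulr0//; first by rewrite ik ltnW.
by apply: contraNneq jk => ->; rewrite ik.
Qed.

End LinearSystems.

(** * Symmetric bilinear forms with one positive direction *)

Section Forms.
Local Open Scope ring_scope.
Variables (R : realFieldType) (W : lmodType R).

Record symbilinear (q : W -> W -> R) : Prop := SymBilinear {
  sbC : forall x y, q x y = q y x;
  sbDl : forall x y z, q (x + y) z = q x z + q y z;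
  sbZl : forall a x z, q (a *: x) z = a * q x z }.

(** Lorentzian signature, with a possible radical. *)
Definition hyperbolic (q : W -> W -> R) (h : W) :=
  0 < q h h /\ forall x, q x h = 0 -> q x x <= 0.

Definition reverse_cauchy (q : W -> W -> R) (l : W) :=
  forall x, q x x * q l l <= q x l ^+ 2.

Variables (q : W -> W -> R) (qb : symbilinear q).

Lemma sbDr x y z : q x (y + z) = q x y + q x z.
Proof. by rewrite sbC// sbDl// !(sbC qb x). Qed.

Lemma sbZr a x z : q x (a *: z) = a * q x z.
Proof. by rewrite sbC// sbZl// (sbC qb x). Qed.

Lemma sb0l z : q 0 z = 0.
Proof. by rewrite -(scale0r (0 : W)) sbZl// mul0r. Qed.

Lemma sb_suml (I : Type) (r : seq I) (Q : pred I) (f : I -> W) z :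
  q (\sum_(i <- r | Q i) f i) z = \sum_(i <- r | Q i) q (f i) z.
Proof.
apply: (big_morph (fun x => q x z)); last exact: sb0l.
by move=> x y; rewrite sbDl.
Qed.

(** If the inequality failed with both squares positive, the form would be positive definite on the
    plane of [x] and [l], which meets the hyperplane orthogonal to [h]. *)
Lemma hyperbolic_reverse_cauchy h l :
  hyperbolic q h -> 0 <= q l l -> reverse_cauchy q l.
Proof.
move=> [h0 hh] l0 x; have [xx|xx] := lerP (q x x) 0.
  by apply: le_trans (sqr_ge0 _); rewrite mulr_le0_ge0.
move: l0; rewrite le_eqVlt => /predU1P[<-|l0]; first by rewrite mulr0 sqr_ge0.
rewrite leNgt; apply/negP => hlt.
set a := q l h; set b := q x h.
have a0 : a != 0.
  by apply/negP => /eqP /hh; rewrite leNgt l0.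
(* This combination is orthogonal to [h]. By completing the square, its square times [q l l] is
   [a ^ 2] times the failure of the inequality plus a square. *)
have := hh (a *: x + (- b) *: l).
rewrite !(sbDl qb, sbDr, sbZl qb, sbZr) (sbC qb l x) -/a -/b.
move=> /(_ (ltac:(ring))).
have : 0 < a ^+ 2 by rewrite exprn_even_gt0.
set X := q x x; set Y := q x l; set Z := q l l => a2 hle.
have key : 0 < a ^+ 2 * (X * Z - Y ^+ 2).
  by rewrite mulr_gt0// subr_gt0.
have : (a * (a * X) + a * (- b * Y) + (- b * (a * Y) + - b * (- b * Z))) * Z
  = a ^+ 2 * (X * Z - Y ^+ 2) + (b * Z - a * Y) ^+ 2 by ring.
have : 0 <= (b * Z - a * Y) ^+ 2 by exact: sqr_ge0.
move: hle; rewrite -/X -/Y -/Z.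
set E := (_ + _ : R) => hle sq e.
have : E * Z <= 0 by rewrite mulr_le0_ge0// ltW.
rewrite e; lra.
Qed.

Lemma reverse_cauchy_le0 l x : reverse_cauchy q l ->
  0 < q l l -> q x l = 0 -> q x x <= 0.
Proof.
by move=> /(_ x) h l0 xl; move: h; rewrite xl expr0n/= pmulr_lle0.
Qed.

(** The equality case: on the hyperplane orthogonal to [l] the form is negative semidefinite, and a
    null vector of a semidefinite form lies in its radical. The component of [z] along [l] is
    removed beforehand. *)
Lemma null_orthogonal l g : reverse_cauchy q l -> 0 < q l l ->
  q g l = 0 -> q g g = 0 -> forall z, q g z = 0.
Proof.
move=> h l0 gl gg z; pose z' := z + (- (q z l / q l l)) *: l.
have z'l : q z' l = 0 by rewrite /z' sbDl// sbZl// mulNr divfK ?subrr// gt_eqF.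
have z'E : q g z' = q g z by rewrite /z' sbDr sbZr gl mulr0 addr0.
clearbody z'; have : 2 * q g z' = 0.
  apply: (@linear_term_eq0 _ (q z' z')) => t.
  have := @reverse_cauchy_le0 l (z' + t *: g) h l0.
  rewrite !(sbDl qb, sbDr, sbZl qb, sbZr). rewrite z'l gl mulr0 addr0 => /(_ erefl).
  by rewrite gg (sbC qb g z'); lra.
move=> /eqP; rewrite mulf_eq0 pnatr_eq0/= => /eqP.
by rewrite z'E.
Qed.

End Forms.

(** * Lorentzian complexes *)

Section Complex.
Local Open Scope ring_scope.
Variables (R : realFieldType) (V : finType).
Local Notation vec := {ffun V -> R^o}.
Variables (Delta : {set {set V}}) (Lin : vec -> Prop).
Implicit Types (s t : {set V}) (x y z v : vec).

Definition link s : {set V} := [set r | (r \notin s) && (r |: s \in Delta)].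

Definition delta (r : V) : vec := [ffun i => (i == r)%:R].

Definition linear_at x s :=
  exists2 v, Lin v & forall r, r \in s :|: link s -> x r = v r.

Definition nef_at x s := exists v,
  [/\ Lin v, forall r, r \in s -> x r + v r = 0 &
             forall r, r \in link s -> 0 <= x r + v r].

Definition ample_at x s := exists v,
  [/\ Lin v, forall r, r \in s -> x r + v r = 0 &
             forall r, r \in link s -> 0 < x r + v r].

Definition nef_vec x := forall s, s \in Delta -> nef_at x s.
Definition ample_vec x := forall s, s \in Delta -> ample_at x s.
Definition big_vec x := exists2 v, Lin v & forall r, 0 < x r + v r.

(* The combinatorial properties of a balanced fan (all weights 1) on which the
   argument rests; [Lin] is the space of restrictions of linear functions to
   the rays. *)
Record lorentzian_complex (n : nat) : Prop := LorentzianComplex {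
  lin_add : forall v w, Lin v -> Lin w -> Lin (v + w);
  lin_scale : forall (a : R) v, Lin v -> Lin (a *: v);
  cx_empty : finset.set0 \in Delta;
  cx_sub : forall s t, t \subset s -> s \in Delta -> t \in Delta;
  cx_vertex : forall r, [set r] \in Delta;
  cx_extend : forall s x, s \in Delta ->
    exists2 v, Lin v & forall r, r \in s -> x r = v r;
  cx_dim : forall s, s \in Delta -> (#|s| <= n)%N;
  cx_pure : forall s, s \in Delta -> (#|s| < n)%N -> exists r, r \in link s;
  cx_connected : forall s (f : V -> R), s \in Delta -> (#|s| + 2 <= n)%N ->
    (forall r r', r \in link s -> r' \in link s -> r' |: (r |: s) \in Delta ->
      f r = f r') ->
    forall r r', r \in link s -> r' \in link s -> f r = f r';
  cx_surface : forall s (q : vec -> vec -> R), s \in Delta ->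
    (#|s| + 2)%N = n -> symbilinear q ->
    (forall v x, Lin v -> q v x = 0) ->
    (forall r x, r \notin s :|: link s -> q (delta r) x = 0) ->
    (forall r r', r \in link s -> r' \in link s -> r != r' ->
      q (delta r) (delta r') = (r' |: (r |: s) \in Delta)%:R) ->
    exists h, hyperbolic q h;
  cx_balanced : forall s x, s \in Delta -> (#|s| + 1)%N = n ->
    (forall r, r \in s -> x r = 0) -> \sum_(r in link s) x r = 0 ->
    linear_at x s;
  cx_glue : forall s x, s \in Delta -> (#|s| + 2 <= n)%N ->
    (forall r, r \in link s -> linear_at x (r |: s)) -> linear_at x s;
  cx_ample : exists x, ample_vec x }.

End Complex.

(** * Mixed degrees on links and the Alexandrov-Fenchel inequality *)

Section Degree.
Local Open Scope ring_scope.
Variables (R : realFieldType) (V : finType).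
Local Notation vec := {ffun V -> R^o}.
Variables (Delta : {set {set V}}) (Lin : vec -> Prop) (n : nat).
Hypothesis cx : lorentzian_complex Delta Lin n.
Variables (P : comAlgType R) (X : V -> P) (F : P -> R).
Implicit Types (s t : {set V}) (x y z v l : vec) (ls ms : seq vec) (p : P).

Local Notation link := (link Delta).
Local Notation nef_at := (nef_at Delta Lin).
Local Notation nef := (nef_vec Delta Lin).
Local Notation ample := (ample_vec Delta Lin).
Local Notation big := (big_vec Lin).

Definition cl x : P := \sum_r x r *: X r.
Definition xs s : P := \prod_(r in s) X r.
Definition pr ls : P := \prod_(l <- ls) cl l.

Hypotheses (FD : forall p p', F (p + p') = F p + F p')
  (FZ : forall a p, F (a *: p) = a * F p)
  (F_nonface : forall s p, s \notin Delta -> F (xs s * p) = 0)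
  (F_lin : forall v p, Lin v -> F (p * cl v) = 0)
  (F_facet : forall s, s \in Delta -> #|s| = n -> F (xs s) = 1).

(** The factor [xs s] restricts to the star of [s], so this is the intersection form of the product
    [pr ls] on the link of [s]. *)
Definition form s ls x y := F (xs s * pr ls * cl x * cl y).

Lemma clD x y : cl (x + y) = cl x + cl y.
Proof.
by rewrite /cl -big_split; apply: eq_bigr => r _; rewrite ffunE scalerDl.
Qed.

Lemma clZ (a : R) x : cl (a *: x) = a *: cl x.
Proof.
by rewrite /cl scaler_sumr; apply: eq_bigr => r _; rewrite ffunE scalerA.
Qed.

Lemma cl_delta r : cl (delta R r) = X r.
Proof.
rewrite /cl (bigD1 r)//= ffunE eqxx scale1r big1 ?addr0// => i /negPf ir.
by rewrite ffunE ir scale0r.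
Qed.

Lemma vec_sum x : x = \sum_r x r *: delta R r.
Proof.
apply/ffunP => i; rewrite sum_ffunE (bigD1 i)//= !ffunE eqxx.
rewrite big1 ?addr0 => [|j ji]; first by rewrite -[LHS]mulr1.
by rewrite !ffunE eq_sym (negPf ji) scaler0.
Qed.

Lemma F0 : F 0 = 0.
Proof. by rewrite -(scale0r 0) FZ mul0r. Qed.

Lemma F_sum (I : Type) (r : seq I) (Q : pred I) (f : I -> P) :
  F (\sum_(i <- r | Q i) f i) = \sum_(i <- r | Q i) F (f i).
Proof. by apply: (big_morph F FD F0). Qed.

Lemma form_bilinear s ls : symbilinear (form s ls).
Proof.
split=> [x y|x y z|a x z]; rewrite /form.
- by rewrite -!mulrA (mulrC (cl x)).
- by rewrite clD mulrDr mulrDl FD.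
- by rewrite clZ -scalerAr -scalerAl FZ.
Qed.

Lemma form_lin s ls v x : Lin v -> form s ls v x = 0.
Proof. by move=> lv; rewrite (sbC (form_bilinear s ls)) /form F_lin. Qed.

Lemma xsU1 r s : r \notin s -> xs (r |: s) = X r * xs s.
Proof. by move=> rs; rewrite /xs big_setU1. Qed.

Lemma linkP r s : r \in link s -> r \notin s /\ r |: s \in Delta.
Proof. by rewrite inE => /andP. Qed.

Lemma form_delta s ls r x : r \in link s ->
  form s ls (delta R r) x = F (xs (r |: s) * pr ls * cl x).
Proof.
move=> /linkP[rs _]; rewrite /form cl_delta xsU1//.
by congr F; ring.
Qed.

Lemma expand_at s x p : s \in Delta -> (forall r, r \in s -> x r = 0) ->
  F (xs s * cl x * p) = \sum_(r in link s) x r * F (xs (r |: s) * p).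
Proof.
move=> sD xs0; rewrite /cl mulr_sumr mulr_suml F_sum (bigID (mem (link s)))/=.
rewrite [X in _ + X]big1 ?addr0 => [|r].
  apply: eq_bigr => r /linkP[rs _].
  by rewrite -scalerAr -scalerAl FZ xsU1// (mulrC (X r)).
rewrite inE negb_and negbK -scalerAr -scalerAl FZ.
have [rs _|rs /= rsD] := boolP (r \in s); first by rewrite xs0// mul0r.
by rewrite (mulrC (xs s)) -xsU1// F_nonface// mulr0.
Qed.

Lemma F_addlin x v p : Lin v -> F (p * cl (x + v)) = F (p * cl x).
Proof. by move=> lv; rewrite clD mulrDr FD (F_lin _ lv) addr0. Qed.

(** A linear function makes any class vanish on [s] without changing degrees; rays outside the star
    give nonfaces, so only the link contributes. All degrees are computed along this recursion. *)
Lemma expand_norm s x v p : s \in Delta -> Lin v ->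
  (forall r, r \in s -> x r + v r = 0) ->
  F (xs s * cl x * p) = \sum_(r in link s) (x r + v r) * F (xs (r |: s) * p).
Proof.
move=> sD lv v0; transitivity (F (xs s * cl (x + v) * p)).
  by rewrite -!(mulrAC _ p) F_addlin.
rewrite expand_at// => [|r rs]; last by rewrite ffunE v0.
by apply: eq_bigr => r _; rewrite ffunE.
Qed.

Lemma card_link r s : r \in link s -> #|r |: s| = #|s|.+1.
Proof. by move=> /linkP[rs _]; rewrite cardsU1 rs. Qed.

Lemma pr_cons l ls : pr (l :: ls) = cl l * pr ls.
Proof. by rewrite /pr big_cons. Qed.

(** Each expansion trades one factor for one ray, with nonnegative coefficients by nefness at the
    current cone, until a facet of degree 1 is left. *)
Lemma degree_ge0 s ls : s \in Delta -> (#|s| + size ls)%N = n ->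
  {in ls, forall l, nef l} -> 0 <= F (xs s * pr ls).
Proof.
elim: ls s => [|l ls IH] s sD /= sn hl.
  by rewrite /pr big_nil mulr1 F_facet// -[LHS]addn0.
have [v [lv v0 vp]] := hl l (mem_head _ _) s sD.
rewrite pr_cons mulrA (expand_norm _ sD lv v0).
apply: sumr_ge0 => r rl; rewrite mulr_ge0 ?vp// IH//.
- by case/linkP: rl.
- by rewrite card_link// addSnnS.
- by move=> k kl; apply: hl; rewrite inE kl orbT.
Qed.

Lemma degree_gt0 s ls : s \in Delta -> (#|s| + size ls)%N = n ->
  {in ls, forall l, ample l} -> 0 < F (xs s * pr ls).
Proof.
elim: ls s => [|l ls IH] s sD /= sn hl.
  by rewrite /pr big_nil mulr1 F_facet// -[LHS]addn0.
have [v [lv v0 vp]] := hl l (mem_head _ _) s sD.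
rewrite pr_cons mulrA (expand_norm _ sD lv v0).
(* Purity makes the sum nonempty, as strict positivity requires. *)
have [r0 r0l] : exists r, r \in link s by apply: (cx_pure cx) => //; lia.
have pos r : r \in link s -> 0 < (l r + v r) * F (xs (r |: s) * pr ls).
  move=> rl; rewrite mulr_gt0 ?vp// IH//.
  - by case/linkP: rl.
  - by rewrite card_link// addSnnS.
  - by move=> k kl; apply: hl; rewrite inE kl orbT.
rewrite (bigD1 r0)//= ltr_pwDl ?pos// sumr_ge0// => r /andP[rl _].
by rewrite ltW// pos.
Qed.

Lemma ample_nef l : ample l -> nef l.
Proof.
move=> hl s sD; have [v [lv v0 vp]] := hl s sD.
by exists v; split=> // r /vp/ltW.
Qed.

Lemma lin0 : Lin 0.
Proof.
have [H _] := cx_ample cx; have [v lv _] := cx_extend cx H (cx_empty cx).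
by rewrite -(scale0r v); apply: (lin_scale cx).
Qed.

Lemma linN v : Lin v -> Lin (- v).
Proof. by move=> lv; rewrite -scaleN1r; apply: (lin_scale cx). Qed.

Lemma ampleDnef l m (e : R) : 0 < e -> nef l -> ample m -> ample (l + e *: m).
Proof.
move=> e0 hl hm s sD; have [v [lv v0 vp]] := hl s sD.
have [w [lw w0 wp]] := hm s sD; exists (v + e *: w); split.
- by apply: (lin_add cx) => //; apply: (lin_scale cx).
- by move=> r rs; rewrite !ffunE addrACA -scalerDr v0// w0// scaler0 addr0.
- move=> r rs; rewrite !ffunE addrACA -scalerDr ltr_wpDl ?vp//.
  by rewrite mulr_gt0 ?wp.
Qed.

(** At each cone [y] too can be made to vanish by a linear function, and a small multiple of it is
    then dominated on the link by the positive values of [l]. Having both signs turns inequalities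
    into equalities later. *)
Lemma ample_open l y : ample l -> exists2 e, 0 < e &
  nef (l + e *: y) /\ nef (l + (- e) *: y).
Proof.
move=> hl.
have [e e0 he] : exists2 e, 0 < e & forall s, s \in Delta ->
    nef_at (l + e *: y) s /\ nef_at (l + (- e) *: y) s.
  apply: common_eps => s; have [sD|sD] := boolP (s \in Delta); last by exists 1.
  have [v [lv v0 vp]] := hl s sD; have [w lw w0] := cx_extend cx y sD.
  have lw' := linN lw.
  have : exists2 e, 0 < e & forall r, r \in link s ->
      e * `|y r - w r| <= l r + v r.
    apply: (@common_eps _ _ (fun r e => r \in link s -> e * `|y r - w r| <= l r + v r)).
    move=> r; have [rl|rl] := boolP (r \in link s); last by exists 1.
    exists ((l r + v r) / (`|y r - w r| + 1)).
      by rewrite divr_gt0 ?vp// ltr_wpDl.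
    move=> d d0; rewrite ler_pdivlMr ?ltr_wpDl// => dl _.
    by apply: le_trans dl; rewrite mulrDr mulr1 lerDl ltW.
  case=> e e0 he; exists e => // d d0 de _.
  have hd r : r \in link s -> `|d * (y r - w r)| <= l r + v r.
    move=> rl; apply: le_trans (he r rl); rewrite normrM gtr0_norm//.
    by rewrite ler_wpM2r.
  split; [exists (v + d *: - w)|exists (v + (- d) *: - w)]; split.
  - by apply: (lin_add cx) => //; apply: (lin_scale cx).
  - by move=> r rs; rewrite !ffunE addrACA -scalerDr v0// w0// subrr scaler0 addr0.
  - move=> r rs; rewrite !ffunE addrACA -scalerDr.
    by have := hd r rs; rewrite ler_norml => /andP[h _]; rewrite -lerBlDl sub0r.
  - by apply: (lin_add cx) => //; apply: (lin_scale cx).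
  - by move=> r rs; rewrite !ffunE addrACA -scalerDr v0// w0// subrr scaler0 addr0.
  - move=> r rs; rewrite !ffunE addrACA -scalerDr.
    have := hd r rs; rewrite ler_norml => /andP[_ h].
    by rewrite scaleNr subr_ge0.
by exists e => //; split=> s /he[].
Qed.

(** A functional that is nonnegative on nef classes and zero at the interior point [l] of their cone
    is zero: evaluate it at [l + e y] and [l - e y]. *)
Lemma ample_dominates s ls l y : s \in Delta -> (#|s| + (size ls).+1)%N = n ->
  {in ls, forall k, nef k} -> ample l ->
  F (xs s * pr ls * cl l) = 0 -> F (xs s * pr ls * cl y) = 0.
Proof.
move=> sD sn hls hl h0; have [e e0 [h1 h2]] := ample_open y hl.
have deg m : nef m -> 0 <= F (xs s * pr ls * cl m).
  move=> hm; rewrite -mulrA [pr ls * _]mulrC -pr_cons.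
  apply: degree_ge0 => // k; rewrite inE => /predU1P[->//|]; exact: hls.
have := deg _ h1; have := deg _ h2.
rewrite !clD !clZ !mulrDr -!scalerAr !FD !FZ h0 !add0r mulNr oppr_ge0.
move=> a b; have : e * F (xs s * pr ls * cl y) = 0 by apply/le_anti; rewrite a.
by move/eqP; rewrite mulf_eq0 gt_eqF//= => /eqP.
Qed.

Lemma form_delta2 s ls r r' : r \in link s -> r' \in link s -> r != r' ->
  form s ls (delta R r) (delta R r') = F (xs (r' |: (r |: s)) * pr ls).
Proof.
move=> rl /linkP[r's _] rr'; rewrite form_delta// cl_delta [xs (r' |: _)]xsU1.
  by congr F; ring.
by rewrite !inE negb_or eq_sym rr'.
Qed.

Lemma form_expand s ls x y : s \in Delta -> (forall r, r \in s -> x r = 0) ->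
  form s ls x y = \sum_(r in link s) x r * form s ls (delta R r) y.
Proof.
move=> sD xs0; transitivity (F (xs s * cl x * (pr ls * cl y))).
  by rewrite /form; congr F; ring.
rewrite expand_at//; apply: eq_bigr => r rl.
by rewrite form_delta// !mulrA.
Qed.

(** Using a ray as one argument passes to its link, where the factor [l] takes the vacant place.
    This carries information between a form and the forms of the links. *)
Lemma form_cons s l ls r x : r \in link s ->
  form s (l :: ls) (delta R r) x = form (r |: s) ls l x.
Proof.
by move=> rl; rewrite form_delta// pr_cons /form; congr F; ring.
Qed.

Lemma form_cons_expand s l ls v x : s \in Delta -> Lin v ->
  (forall r, r \in s -> l r + v r = 0) ->
  form s (l :: ls) x x =
  \sum_(r in link s) (l r + v r) * form (r |: s) ls x x.
Proof.
move=> sD lv lv0; transitivity (F (xs s * cl l * (pr ls * cl x * cl x))).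
  by rewrite /form pr_cons; congr F; ring.
by rewrite (expand_norm _ sD lv lv0); apply: eq_bigr => r _; rewrite /form !mulrA.
Qed.

Lemma form_normalize s ls x y w : Lin w ->
  form s ls (x - w) y = form s ls x y.
Proof.
move=> lw; rewrite (sbDl (form_bilinear s ls)) -scaleN1r.
by rewrite (sbZl (form_bilinear s ls)) (form_lin _ _ _ lw) mulr0 addr0.
Qed.

Lemma form_normalize2 s ls x w : Lin w ->
  form s ls (x - w) (x - w) = form s ls x x.
Proof.
move=> lw; rewrite form_normalize// (sbC (form_bilinear s ls)).
by rewrite form_normalize.
Qed.

Lemma form_ample_gt0 s ls l m : s \in Delta ->
  (#|s| + (size ls + 2))%N = n -> {in ls, forall k, ample k} ->
  ample l -> ample m -> 0 < form s ls l m.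
Proof.
move=> sD sn hls hl hm.
have -> : form s ls l m = F (xs s * pr (l :: m :: ls)).
  by rewrite /form !pr_cons; congr F; ring.
apply: degree_gt0 => //=; first by lia.
by move=> k; rewrite !inE => /or3P[/eqP->|/eqP->|/hls].
Qed.

Lemma form_nef_ge0 s ls l m : s \in Delta ->
  (#|s| + (size ls + 2))%N = n -> {in ls, forall k, nef k} ->
  nef l -> nef m -> 0 <= form s ls l m.
Proof.
move=> sD sn hls hl hm.
have -> : form s ls l m = F (xs s * pr (l :: m :: ls)).
  by rewrite /form !pr_cons; congr F; ring.
apply: degree_ge0 => //=; first by lia.
by move=> k; rewrite !inE => /or3P[/eqP->|/eqP->|/hls].
Qed.

(** Bochner argument on the graph of the link. In coordinates scaled by the positive values [a] of
    [l], the class [l] is the constant vector 1, so orthogonality to [l] becomes weighted mean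
    zero. *)
Lemma hodge_step s l ms : s \in Delta -> (#|s| + (size ms + 3))%N = n ->
  {in l :: ms, forall k, ample k} ->
  (forall r, r \in link s -> reverse_cauchy (form (r |: s) ms) l) ->
  hyperbolic (form s (l :: ms)) l.
Proof.
move=> sD sn hls IH; have hl := hls l (mem_head _ _).
have hms : {in ms, forall k, ample k} by move=> k km; apply: hls; rewrite inE km orbT.
set q := form s (l :: ms); have qb : symbilinear q := form_bilinear s _.
split; first by apply: form_ample_gt0 => //=; lia.
have [v [lv lv0 lvp]] := hl s sD; pose a r := l r + v r.
suff key x : (forall r, r \in s -> x r = 0) -> q x l = 0 -> q x x <= 0.
  move=> x xl; have [w lw xw] := cx_extend cx x sD.
  rewrite /q -(form_normalize2 _ _ _ lw); apply: key; rewrite /q ?form_normalize//.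
  by move=> r rs; rewrite !ffunE xw ?subrr.
move=> xs0 xl.
pose G0 r r' := q (delta R r) (delta R r').
have qx y z : (forall r, r \in s -> y r = 0) ->
    q y z = \sum_(r in link s) y r * q (delta R r) z.
  by move=> y0; apply: form_expand.
have qx2 r y : (forall r, r \in s -> y r = 0) ->
    q (delta R r) y = \sum_(r' in link s) y r' * G0 r r'.
  move=> y0; rewrite (sbC qb) qx//; apply: eq_bigr => r' _.
  by rewrite /G0 (sbC qb).
pose w r := form (r |: s) ms l l.
have w0 r : r \in link s -> 0 < w r.
  move=> rl; apply: form_ample_gt0 => //; first by case/linkP: rl.
  by rewrite card_link//; lia.
have a0 r : r \in link s -> 0 < a r by move=> /lvp.
have qdl r : r \in link s -> q (delta R r) l = w r by move=> rl; apply: form_cons.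
pose G r r' := a r * a r' * G0 r r'.
have := @bochner_negative R V (link s) G (fun r => a r * w r).
(* Expanding the factor [l] writes [q y y] as a positive combination of forms of links, and the
   reverse Cauchy inequality with [l] bounds each of them. *)
have qle y : (forall r, r \in s -> y r = 0) ->
    q y y <= \sum_(r in link s) a r / w r * (q (delta R r) y) ^+ 2.
  move=> y0; rewrite /q (form_cons_expand _ _ sD lv lv0); apply: ler_sum => r rl.
  rewrite -/(a r) -mulrA ler_pM2l ?a0// ler_pdivlMl ?w0// mulrC.
  by rewrite form_cons// (sbC (form_bilinear _ _) l); apply: IH.
have ua y r : r \in link s -> y r = a r * (y r / a r) :> R.
  by move=> rl; rewrite mulrC divfK// gt_eqF// a0.
move=> /(_ _ _ _ _ _ _ (fun r => x r / a r)) H.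
have -> : q x x =
    \sum_(i in link s) \sum_(j in link s) G i j * (x i / a i) * (x j / a j).
  rewrite qx//; apply: eq_bigr => i il; rewrite qx2// mulr_sumr.
  apply: eq_bigr => j jl; rewrite {1}(ua x i)// {1}(ua x j)// /G; ring.
apply: H.
- by move=> i j; rewrite /G /G0 (sbC qb) (mulrC (a i)).
- move=> i j il jl ij; rewrite /G !mulr_ge0 ?(ltW (a0 _ _))// /G0 /q form_delta2//.
  have [ijD|ijD] := boolP (j |: (i |: s) \in Delta); last by rewrite F_nonface.
  apply: degree_ge0 => //; last by move=> k /hls/ample_nef.
  rewrite /= cardsU1 !inE negb_or eq_sym ij card_link//.
  by case/linkP: jl => -> _; lia.
- move=> i il; pose av : vec := l + v.
  have av0 r : r \in s -> av r = 0 by move=> rs; rewrite ffunE lv0.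
  transitivity (a i * q (delta R i) av).
    by rewrite qx2// mulr_sumr; apply: eq_bigr => j _; rewrite ffunE /G /a; ring.
  by rewrite /av (sbDr qb) qdl// (sbC qb _ v) /q form_lin// addr0.
- by move=> i il; rewrite mulr_gt0 ?a0 ?w0.
- move=> f hf; apply: (cx_connected cx sD); first by lia.
  move=> i j il jl ijD; have [->//|ij] := eqVneq i j.
  apply: hf => //; rewrite /G mulr_gt0 ?mulr_gt0 ?a0// /G0 /q form_delta2//.
  apply: degree_gt0 => //.
  rewrite /= cardsU1 !inE negb_or eq_sym ij card_link//.
  by case/linkP: jl => -> _; lia.
- move=> y; pose y' : vec := [ffun r => if r \in link s then a r * y r else 0].
  have y'0 r : r \in s -> y' r = 0.
    by move=> rs; rewrite ffunE; case: ifP => // /linkP[/negP].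
  have y'E r : r \in link s -> y' r = a r * y r by move=> rl; rewrite ffunE rl.
  have := qle y' y'0; rewrite [leLHS]qx//.
  congr (_ <= _); apply: eq_bigr => i il.
    rewrite qx2// mulr_sumr; apply: eq_bigr => j jl; rewrite !y'E// /G; ring.
  have -> : \sum_(j in link s) G i j * y j = a i * q (delta R i) y'.
    by rewrite qx2// mulr_sumr; apply: eq_bigr => j jl; rewrite y'E// /G; ring.
  have := a0 i il; have := w0 i il => wi ai.
  by field; rewrite !gt_eqF.
- transitivity (q x l); last exact: xl.
  rewrite qx//; apply: eq_bigr => i il; rewrite qdl//.
  have := a0 i il => ai; field; by rewrite gt_eqF.
Qed.

(** Induction on the number of factors, over all cones at once; with no factor left, the form is
    that of a two-dimensional link. Otherwise the first factor is the positive direction. *)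
Lemma hodge_ample s ls : s \in Delta -> (#|s| + (size ls + 2))%N = n ->
  {in ls, forall k, ample k} -> exists h, hyperbolic (form s ls) h.
Proof.
elim: ls s => [|l ms IH] s sD sn hls.
  apply: (cx_surface cx sD); first by rewrite -[RHS]sn.
  - exact: form_bilinear.
  - by move=> v x lv; apply: form_lin.
  - move=> r x; rewrite !inE negb_or => /andP[rs]; rewrite rs/= => rD.
    rewrite /form cl_delta.
    have -> : xs s * pr [::] * X r * cl x = xs (r |: s) * (pr [::] * cl x).
      by rewrite xsU1//; ring.
    by rewrite F_nonface.
  - move=> r r' rl r'l rr'; rewrite form_delta2// /pr big_nil.
    have [rD|rD] := boolP (_ \in Delta); last by rewrite F_nonface.
    rewrite mulr1 F_facet// cardsU1 !inE negb_or eq_sym rr' card_link//.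
    by case/linkP: r'l => -> _; rewrite -[RHS]sn/=; lia.
exists l; apply: hodge_step => //; first by rewrite -[RHS]sn/=; lia.
have hl := hls l (mem_head _ _).
have hms : {in ms, forall k, ample k} by move=> k km; apply: hls; rewrite inE km orbT.
move=> r rl.
have rD : r |: s \in Delta by case/linkP: rl.
have rn : (#|r |: s| + (size ms + 2))%N = n by rewrite card_link// -[RHS]sn/=; lia.
have [h hh] := IH _ rD rn hms.
apply: hyperbolic_reverse_cauchy hh _; first exact: form_bilinear.
by apply: form_nef_ge0 => // [k /hms|//|//]; apply: ample_nef.
Qed.
Lemma pr_mid l ls1 ls2 : pr (ls1 ++ l :: ls2) = cl l * pr (ls1 ++ ls2).
Proof. by rewrite /pr !big_cat big_cons/= mulrCA. Qed.

Lemma form_swap s ls l x y : form s (l :: ls) x y = form s (x :: ls) l y.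
Proof. by rewrite /form !pr_cons; congr F; ring. Qed.

Lemma form_mid s ls1 ls2 l x y :
  form s (ls1 ++ l :: ls2) x y = form s (l :: ls1 ++ ls2) x y.
Proof. by rewrite /form pr_mid pr_cons. Qed.

(** The nef factors are made ample one by one, as [k + e H], and moved to [ls2]. The difference of
    the two sides is a quadratic polynomial in [e], so its sign survives [e -> 0]. *)
Lemma alexandrov_fenchel s ls l : s \in Delta ->
  (#|s| + (size ls + 2))%N = n -> {in ls, forall k, nef k} -> nef l ->
  reverse_cauchy (form s ls) l.
Proof.
move=> sD + + hl; rewrite -(cats0 ls).
have : {in [::], forall k, ample k} by [].
elim: ls [::] => [|k ls1 IH] ls2 hls2 sn hls.
  have [h hh] := hodge_ample sD sn hls2.
  apply: hyperbolic_reverse_cauchy hh _; first exact: form_bilinear.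
  by apply: form_nef_ge0 => // j /hls2/ample_nef.
have [H hH] := cx_ample cx.
have hk : nef k by apply: hls; rewrite inE eqxx.
have AFe e x : 0 < e ->
    let q := form s (ls1 ++ (k + e *: H) :: ls2) in q x x * q l l <= q x l ^+ 2.
  move=> e0; apply: IH => //=.
  - by move=> j; rewrite inE => /predU1P[->|/hls2//]; apply: ampleDnef.
  - by rewrite -sn !size_cat/=; lia.
  - move=> j; rewrite mem_cat inE => /or3P[j1|/eqP->|/hls2/ample_nef//].
      by apply: hls; rewrite inE mem_cat j1 orbT.
    by apply: ample_nef; apply: ampleDnef.
move=> x; rewrite -subr_ge0.
set q := form s _; pose p := form s (H :: ls1 ++ ls2).
have qe e y z : form s (ls1 ++ (k + e *: H) :: ls2) y z = q y z + e * p y z.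
  rewrite form_mid 3!form_swap; rewrite (sbDl (form_bilinear s _)).
  by rewrite (sbZl (form_bilinear s _)) !(form_swap _ _ y).
apply: (@quadratic_ge0_lim _ _
  (2 * q x l * p x l - q x x * p l l - p x x * q l l)
  (p x l ^+ 2 - p x x * p l l)) => e e0.
have := AFe e x e0; rewrite /= !qe -subr_ge0; congr (0 <= _); ring.
Qed.

(* A class that is not identically zero defines a hyperplane on which the form
   is negative semidefinite, even if its self-intersection vanishes. *)
Lemma hyperplane_le0 s ls l y x : s \in Delta ->
  (#|s| + (size ls + 2))%N = n -> {in ls, forall k, nef k} -> nef l ->
  form s ls l y != 0 -> form s ls x l = 0 -> form s ls x x <= 0.
Proof.
move=> sD sn hls hl ly xl; have [H hH] := cx_ample cx.
set q := form s ls in ly xl *; have qb : symbilinear q := form_bilinear s ls.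
(* As [H] is ample, a zero pairing with [l] would make [l] pair to zero with everything, including
   [y]. *)
have lH : 0 < q l H.
  rewrite lt_neqAle form_nef_ge0// ?andbT; last exact: ample_nef.
  apply: contra_neq ly => /esym h.
  have E z : q l z = F (xs s * pr (l :: ls) * cl z).
    by rewrite /q /form pr_cons; congr F; ring.
  rewrite -/q E; apply: (ample_dominates (l := H)) => //=; last by rewrite -E.
    by rewrite -sn; lia.
  by move=> k; rewrite inE => /predU1P[->|/hls].
have ll : 0 <= q l l by apply: form_nef_ge0.
have HH : 0 <= q H H by apply: form_nef_ge0 => //; apply: ample_nef.
rewrite leNgt; apply/negP => xx.
have : 0 <= - (2 * (q x x * q l H)).
  apply: (@quadratic_ge0_lim _ _ (q x H ^+ 2 - q x x * q H H) 0) => t t0.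
  have := @alexandrov_fenchel s ls (l + t *: H) sD sn hls.
  move=> /(_ (ample_nef (ampleDnef t0 hl hH)) x).
  rewrite -/q !(sbDl qb, sbDr qb, sbZl qb, sbZr qb) xl (sbC qb H l) add0r.
  move=> h; have : 0 <= t * (- (2 * (q x x * q l H)) +
      t * (q x H ^+ 2 - q x x * q H H)).
    have := mulr_ge0 (ltW xx) ll; nra.
  by rewrite pmulr_rge0// mulr0 addr0.
by rewrite oppr_ge0 leNgt mulr_gt0// mulr_gt0.
Qed.

(** * Big classes and the exchange of one factor *)

Lemma xs0 : xs finset.set0 = 1.
Proof. by rewrite /xs big_set0. Qed.

Lemma link0 r : r \in link finset.set0.
Proof. by rewrite inE finset.in_set0/= finset.setU0 (cx_vertex cx). Qed.

Lemma expand_empty x v p : Lin v ->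
  F (cl x * p) = \sum_r (x r + v r) * F (xs [set r] * p).
Proof.
move=> lv; have := @expand_norm finset.set0 x v p (cx_empty cx) lv.
rewrite xs0 mul1r => -> => [|r]; last by rewrite finset.in_set0.
apply: eq_big => [r|r _]; first exact: link0.
by rewrite finset.setU0.
Qed.

Lemma ample_big l : ample l -> big l.
Proof.
move=> /(_ _ (cx_empty cx))[v [lv _ vp]]; exists v => // r; apply: vp.
exact: link0.
Qed.

Definition good l := nef l /\ big l.

(** After adding a linear function a big class dominates a small multiple of [H] on every ray. The
    remaining factors have nonnegative degree on each ray, so [k] may be exchanged for [e H]. *)
Lemma good_degree_gt0 ls : size ls = n -> {in ls, forall l, good l} ->
  0 < F (pr ls).
Proof.
rewrite -(cats0 ls); have : {in [::], forall k, ample k} by [].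
elim: ls [::] => [|k ls1 IH] ls2 hls2 sn hls.
  have := @degree_gt0 finset.set0 ls2 (cx_empty cx).
  by rewrite xs0 mul1r finset.cards0; apply.
have [H hH] := cx_ample cx.
have [v lv vp] : big k by have [] := hls k (mem_head _ _).
have hms : {in ls1 ++ ls2, forall l, nef l}.
  by move=> l lm; have [] := hls l; rewrite ?inE ?lm ?orbT.
have [e e0 he] : exists2 e, 0 < e & forall r, e * `|H r| <= k r + v r.
  apply: (@common_eps _ _ (fun r e => e * `|H r| <= k r + v r)) => r.
  exists ((k r + v r) / (`|H r| + 1)); first by rewrite divr_gt0 ?vp ?ltr_wpDl.
  move=> d d0; rewrite ler_pdivlMr ?ltr_wpDl// => dl.
  by apply: le_trans dl; rewrite mulrDr mulr1 lerDl ltW.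
have pos r : 0 <= F (xs [set r] * pr (ls1 ++ ls2)).
  by apply: degree_ge0 => //; rewrite ?(cx_vertex cx)// cards1 -sn.
have : 0 < e * F (pr (ls1 ++ H :: ls2)).
  rewrite mulr_gt0// IH//.
  - by move=> l; rewrite inE => /predU1P[->|/hls2].
  - by rewrite -sn !size_cat/= addnS.
  - move=> l; rewrite mem_cat inE => /or3P[l1|/eqP->|l2].
    + by apply: hls; rewrite inE mem_cat l1 orbT.
    + by split; [exact: ample_nef|exact: ample_big].
    + by split; [apply: ample_nef|apply: ample_big]; apply: hls2.
move=> /lt_le_trans; apply; rewrite /= pr_mid pr_cons.
rewrite (expand_empty _ _ lin0) (expand_empty _ _ lv) mulr_sumr.
apply: ler_sum => r _; rewrite ffunE addr0 mulrA ler_wpM2r//.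
by apply: le_trans (he r); rewrite ler_wpM2l ?ler_norm// ltW.
Qed.

Definition killed ls x := [forall r, form finset.set0 ls x (delta R r) == 0].

Lemma killedP ls x :
  reflect (forall y, form finset.set0 ls x y = 0) (killed ls x).
Proof.
apply: (iffP forallP) => [h y|h r]; last by rewrite h.
rewrite (vec_sum y) (sbC (form_bilinear _ _)) (sb_suml (form_bilinear _ _)).
apply: big1 => r _; rewrite (sbZl (form_bilinear _ _)).
by rewrite (sbC (form_bilinear _ _)) (eqP (h r)) mulr0.
Qed.

Lemma form_vertex l ls r x :
  form finset.set0 (l :: ls) (delta R r) x = form [set r] ls l x.
Proof. by rewrite form_cons ?link0// finset.setU0. Qed.

Lemma form_empty_expand l ls v x : Lin v ->
  form finset.set0 (l :: ls) x x = \sum_r (l r + v r) * form [set r] ls x x.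
Proof.
move=> lv; rewrite /form xs0 mul1r pr_cons -!mulrA (expand_empty _ _ lv).
by apply: eq_bigr => r _; rewrite !mulrA.
Qed.

Lemma kernel_step l ms H f : (size ms + 3)%N = n ->
  {in l :: ms, forall k, good k} -> ample H -> killed (l :: ms) f ->
  exists c : V -> R, killed (H :: ms)
    (f + \sum_(r | killed (l :: ms) (delta R r)) c r *: delta R r).
Proof.
move=> sn hls hH /killedP fk.
have [hl [v lv vp]] : good l by apply: hls; rewrite mem_head.
have hms : {in ms, forall k, nef k}.
  by move=> k km; have [] := hls k; rewrite ?inE ?km ?orbT.
have hHn := ample_nef hH.
set Q := form finset.set0 (H :: ms).
have Qb : symbilinear Q := form_bilinear _ _.
have Qll : 0 < Q l l.
  have := @good_degree_gt0 (l :: l :: H :: ms) _ _.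
  have -> : F (pr (l :: l :: H :: ms)) = Q l l.
    by rewrite /Q /form xs0 !pr_cons; congr F; ring.
  apply; first by rewrite /=; lia.
  move=> k; rewrite !inE => /or4P[/eqP->|/eqP->|/eqP->|km].
  - by apply: hls; rewrite mem_head.
  - by apply: hls; rewrite mem_head.
  - by split=> //; apply: ample_big.
  - by apply: hls; rewrite inE km orbT.
have QAF : reverse_cauchy Q l.
  apply: alexandrov_fenchel => //; first exact: (cx_empty cx).
    by rewrite finset.cards0 /=; lia.
  by move=> k; rewrite inE => /predU1P[->|/hms].
have orth x : (forall y, form finset.set0 (l :: ms) x y = 0) -> Q x l = 0.
  by move=> h; rewrite (sbC Qb) /Q form_swap (sbC (form_bilinear _ _)).
pose Z := [set r | killed (l :: ms) (delta R r)].
have lb : symbilinear (form finset.set0 (l :: ms)) := form_bilinear _ _.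
have Zk (c : V -> R) y :
    form finset.set0 (l :: ms) (\sum_(r in Z) c r *: delta R r) y = 0.
  rewrite (sb_suml lb) big1// => r; rewrite inE => /killedP h.
  by rewrite (sbZl lb) h mulr0.
(* The critical equations: [f] plus a combination of rays in [Z] is to be [Q]-orthogonal to [Z].
   Below, [K] is the class of a vector in the kernel of their Gram matrix. *)
have [||c hc] := @symmetric_solve_on R V Z
    (fun i j => Q (delta R i) (delta R j)) (fun i => - Q (delta R i) f).
- by move=> i j; rewrite (sbC Qb).
- move=> k hk; set K := \sum_(r in Z) k r *: delta R r.
  have QK i : i \in Z -> Q (delta R i) K = 0.
    move=> iZ; rewrite (sbC Qb) (sb_suml Qb) -[RHS](hk i iZ).
    by apply: eq_bigr => j _; rewrite (sbZl Qb) (sbC Qb) mulrC.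
  have KK : Q K K = 0.
    by rewrite {1}/K (sb_suml Qb) big1// => i iZ; rewrite (sbZl Qb) QK// mulr0.
  have : Q K f = 0.
    by apply: (null_orthogonal Qb QAF) => //; apply: orth => y; apply: Zk.
  rewrite /K (sb_suml Qb) => /(congr1 -%R); rewrite oppr0 -sumrN => h.
  by rewrite -[RHS]h; apply: eq_bigr => i _; rewrite (sbZl Qb) mulNr mulrC.
exists c; set g := f + _.
have gE : g = f + \sum_(r in Z) c r *: delta R r.
  by congr (_ + _); apply: eq_bigl => r; rewrite inE.
have gk y : form finset.set0 (l :: ms) g y = 0.
  by rewrite gE (sbDl lb) fk Zk addr0.
have Qg i : i \in Z -> Q (delta R i) g = 0.
  move=> iZ; rewrite gE (sbDr Qb).
  have -> : Q (delta R i) (\sum_(r in Z) c r *: delta R r) = - Q (delta R i) f.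
    rewrite -[RHS]hc// (sbC Qb) (sb_suml Qb); apply: eq_bigr => j _.
    by rewrite (sbZl Qb) (sbC Qb) mulrC.
  by rewrite subrr.
have vD (r : V) : [set r] \in Delta by apply: (cx_vertex cx).
have vn (r : V) : (#|[set r]| + (size ms + 2))%N = n by rewrite cards1; lia.
(* If [r] is not killed, [l] is nonzero on its link and [g] is orthogonal to [l] there. If it is
   killed, criticality makes [g] orthogonal to [H] on the link, and the question is whether [H] is
   nonzero there. *)
have le0 r : form [set r] ms g g <= 0.
  have [rZ|] := boolP (r \in Z); last first.
    rewrite inE /killed => /forallPn[r' hr'].
    apply: (@hyperplane_le0 _ _ l (delta R r')) => //.
      by rewrite -form_vertex.
    by rewrite (sbC (form_bilinear _ _)) -form_vertex (sbC lb).
  have Hg : form [set r] ms g H = 0.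
    by rewrite (sbC (form_bilinear _ _)) -form_vertex; apply: Qg.
  (* [m] is nef since [H] is ample. If [H m] vanishes on the link, then [m] pairs to zero with
     everything by domination, and [g g = 0] follows from [g H = 0]. *)
  have [e e0 [mn _]] := ample_open g hH; set m := H + e *: g in mn.
  have [h0|h0] := eqVneq (form [set r] ms H m) 0; last first.
    exact: (@hyperplane_le0 _ _ H m).
  have E z : form [set r] ms m z = F (xs [set r] * pr (m :: ms) * cl z).
    by rewrite /form pr_cons; congr F; ring.
  have mg : form [set r] ms m g = 0.
    rewrite E; apply: (@ample_dominates _ _ H) => //=; first by have := vn r; lia.
      by move=> k; rewrite inE => /predU1P[->|/hms].
    by rewrite -E (sbC (form_bilinear _ _)).
  move: mg; rewrite /m (sbDl (form_bilinear _ _)) (sbZl (form_bilinear _ _)).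
  rewrite (sbC (form_bilinear _ _)) Hg add0r => /eqP.
  by rewrite mulf_eq0 gt_eqF//= => /eqP->.
have eq0 r : form [set r] ms g g = 0.
  have := gk g; rewrite (form_empty_expand _ _ _ lv) => /eqP.
  rewrite -oppr_eq0 -sumrN psumr_eq0 => [|i _].
    move=> /allP/(_ r (mem_index_enum _)); rewrite oppr_eq0 mulf_eq0.
    by rewrite gt_eqF ?vp//= => /eqP.
  by rewrite oppr_ge0 mulr_ge0_le0// ltW.
(* Expanding the factor [H] of [Q g g] yields only the zero terms [eq0], so [g] is null; it is also
   orthogonal to [l]. *)
apply/killedP; apply: (null_orthogonal Qb QAF) => //; first exact: orth.
by rewrite /Q (form_empty_expand _ _ _ lin0) big1// => r _; rewrite eq0 mulr0.
Qed.

(** * Kernels of products of ample classes and of big and nef classes *)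

Lemma linear_at_sub x w s : Lin w ->
  linear_at Delta Lin (x - w) s -> linear_at Delta Lin x s.
Proof.
move=> lw [v lv vx]; exists (v + w); first exact: (lin_add cx).
by move=> r /vx; rewrite !ffunE => <-; rewrite subrK.
Qed.

(** Induction through links: on each of them [x] is null and orthogonal to [l], hence killed by one
    factor less. With no factor left, pairing with a ray [r] is the balancing condition at
    [r |: s]. *)
Lemma ample_kernel s ls x : s \in Delta -> (#|s| + (size ls + 2))%N = n ->
  {in ls, forall k, ample k} -> (forall y, form s ls x y = 0) ->
  linear_at Delta Lin x s.
Proof.
elim: ls s => [|l ms IH] s sD sn hls xk; apply: (cx_glue cx sD); try lia.
  move=> r rl; have rD : r |: s \in Delta by case/linkP: rl.
  have [w lw xw] := cx_extend cx x rD.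
  have rn : (#|r |: s| + 1)%N = n by rewrite card_link// -[RHS]sn/=; lia.
  apply: (linear_at_sub lw); apply: (cx_balanced cx) => //.
    by move=> i ir; rewrite !ffunE xw// subrr.
  have := xk (delta R r); rewrite (sbC (form_bilinear _ _)) form_delta//.
  rewrite /pr big_nil mulr1 -[_ * cl x]mulr1.
  rewrite (expand_norm _ rD (linN lw)) => [h|i ir]; last by rewrite !ffunE xw// subrr.
  rewrite -[RHS]h; apply: eq_bigr => i il; rewrite mulr1 F_facet ?mulr1 ?ffunE//.
    by case/linkP: il.
  by rewrite card_link// -[RHS]rn addn1.
have hl : ample l by apply: hls; rewrite mem_head.
have hms : {in ms, forall k, ample k} by move=> k km; apply: hls; rewrite inE km orbT.
have hms' : {in ms, forall k, nef k} by move=> k /hms/ample_nef.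
have [v [lv v0 vp]] := hl s sD.
have rn r : r \in link s -> (#|r |: s| + (size ms + 2))%N = n.
  by move=> rl; rewrite card_link// -[RHS]sn/=; lia.
have rD r : r \in link s -> r |: s \in Delta by case/linkP.
have AF r : r \in link s -> reverse_cauchy (form (r |: s) ms) l.
  by move=> rl; apply: alexandrov_fenchel => //; [exact: rD|exact: rn|exact: ample_nef].
have ll r : r \in link s -> 0 < form (r |: s) ms l l.
  by move=> rl; apply: form_ample_gt0 => //; [exact: rD|exact: rn].
have xl r : r \in link s -> form (r |: s) ms x l = 0.
  move=> rl; rewrite (sbC (form_bilinear _ _)) -form_cons//.
  by rewrite (sbC (form_bilinear _ _)).
(* These squares are nonpositive, and a combination of them with positive coefficients is
   [form s (l :: ms) x x], which is zero. *)
have xx r : r \in link s -> form (r |: s) ms x x = 0.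
  move=> rl; have := xk x; rewrite (form_cons_expand _ _ sD lv v0) => /eqP.
  rewrite -oppr_eq0 -sumrN psumr_eq0 => [|i il].
    move=> /allP/(_ r (mem_index_enum _)); rewrite rl oppr_eq0 mulf_eq0.
    by rewrite gt_eqF ?vp//= => /eqP.
  rewrite oppr_ge0 mulr_ge0_le0//; first by rewrite ltW// vp.
  exact: (reverse_cauchy_le0 (AF i il) (ll i il) (xl i il)).
move=> r rl; apply: IH => //; [exact: rD|exact: rn|].
exact: (null_orthogonal (form_bilinear _ _) (AF r rl) (ll r rl) (xl r rl) (xx r rl)).
Qed.

Lemma sum_delta_sub (A B : pred V) (c : V -> R) : subpred A B ->
  \sum_(r | A r) c r *: delta R r =
  \sum_(r | B r) (if A r then c r else 0) *: delta R r.
Proof.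
move=> AB; rewrite big_mkcond [RHS]big_mkcond; apply: eq_bigr => r _.
by case: ifPn => [/AB->//|_]; case: ifP => // _; rewrite scale0r.
Qed.

(** [ls1] holds the factors still to be exchanged, [ls2] the ample ones already in place. *)
Theorem good_kernel ls x : (size ls + 2)%N = n -> {in ls, forall k, good k} ->
  killed ls x -> exists v (c : V -> R), Lin v /\
    x = v + \sum_(r | killed ls (delta R r)) c r *: delta R r.
Proof.
rewrite -(cats0 ls); have : {in [::], forall k, ample k} by [].
elim: ls [::] x => [|l ls1 IH] ls2 x hls2 sn hls xk.
  have [|v lv vx] := @ample_kernel finset.set0 ls2 x (cx_empty cx) _ hls2 (killedP _ _ xk).
    by rewrite finset.cards0.
  exists v, (fun=> 0); split=> //; rewrite big1 ?addr0 => [|r _]; last by rewrite scale0r.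
  by apply/ffunP => r; apply: vx; rewrite inE link0 orbT.
have [H hH] := cx_ample cx; set ms := ls1 ++ ls2.
have hms : {in ms, forall k, good k} by move=> k km; apply: hls; rewrite inE km orbT.
have hl : good l by apply: hls; rewrite mem_head.
have hms' : {in ms, forall k, nef k} by move=> k /hms[].
have [|c] := @kernel_step l ms H x _ hls hH xk.
  by rewrite -[RHS]sn /ms/= !size_cat; lia.
set y := \sum_(r | _) _ => gk.
have midE z : killed (ls1 ++ H :: ls2) z = killed (H :: ms) z.
  by apply: eq_forallb => r; rewrite form_mid.
have [||||v [d [lv gE]]] := IH (H :: ls2) (x + y).
- by move=> k; rewrite inE => /predU1P[->|/hls2].
- by rewrite -[RHS]sn/= !size_cat/=; lia.
- move=> k; rewrite mem_cat inE => /or3P[k1|/eqP->|k2].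
  + by apply: hms; rewrite mem_cat k1.
  + by split; [exact: ample_nef|exact: ample_big].
  + by apply: hms; rewrite mem_cat k2 orbT.
- by rewrite midE.
(* A ray killed with [H] is killed with [l]: on its link the product of [l] and [ms] vanishes at the
   ample class [H], hence everywhere. So the span obtained after the exchange lies in the original
   one. *)
have sub r : killed (ls1 ++ H :: ls2) (delta R r) -> killed (l :: ms) (delta R r).
  rewrite midE => /killedP h; apply/killedP => z; rewrite form_vertex.
  have E u : form [set r] ms l u = F (xs [set r] * pr (l :: ms) * cl u).
    by rewrite /form pr_cons; congr F; ring.
  rewrite E; apply: (@ample_dominates _ _ H) => //.
  - exact: (cx_vertex cx).
  - by rewrite cards1 -[RHS]sn /ms/= !size_cat; lia.
  - by move=> k; rewrite inE => /predU1P[->|/hms'//]; case: hl.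
  - by rewrite -E (sbC (form_bilinear _ _)) -form_vertex h.
move: gE; rewrite (sum_delta_sub _ sub) => /(canRL (addrK _)) ->.
exists v, (fun r => (if killed (ls1 ++ H :: ls2) (delta R r) then d r else 0) - c r).
split=> //; rewrite -addrA; congr (_ + _); rewrite /y -sumrB.
by apply: eq_bigr => r _; rewrite scalerBl.
Qed.
End Degree.

(** * Complexes of nested sets *)

Section NestedDef.
Local Open Scope ring_scope.
Variables (T V : finType) (g : V -> {set T}) (Delta : {set {set V}}).
Implicit Types (s : {set V}) (r a : V) (C : {set T}).

Definition cls s i : {set T} :=
  [set j | [forall N in s, (i \in g N) == (j \in g N)]].

Definition splits r C := (C :&: g r != finset.set0) && ~~ (C \subset g r).

(** The last clause: a ray that splits [C] and meets the trace of [a] on [C] contains this trace and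
    is equal or adjacent to [a]. Once some ray splits [C], the traces of its atoms partition [C],
    like the atoms of a lattice of flats. *)
Definition atom s C a := [&& a \in link Delta s, splits a C &
  [forall r in link Delta s, splits r C ==> (C :&: g a :&: g r != finset.set0) ==>
    (C :&: g a \subset g r) && ((r == a) || (r |: (a |: s) \in Delta))]].

(* A complex of nested sets: a cone [s] cuts [T] into classes, and the rays of
   its link refine exactly one class each, independently for distinct ones. *)
Record nested_complex (n : nat) : Prop := NestedComplex {
  nc_empty : finset.set0 \in Delta;
  nc_sub : forall s t : {set V}, t \subset s -> s \in Delta -> t \in Delta;
  nc_vertex : forall r, [set r]%SET \in Delta;
  nc_inj : injective g;
  nc_point : forall s r, s \in Delta ->
    exists2 i, i \in g r & forall N, N \in s -> i \in g N -> g r \subset g N;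
  nc_free : forall s, s \in Delta -> exists i, forall N, N \in s -> i \notin g N;
  nc_laminar : forall s N N', s \in Delta -> N \in s -> N' \in s ->
    [|| g N \subset g N', g N' \subset g N | [disjoint g N & g N']];
  nc_atom : forall s i r, s \in Delta -> r \in link Delta s ->
    splits r (cls s i) -> exists2 a, atom s (cls s i) a & i \in g a;
  nc_indep : forall s i j r r', s \in Delta -> r \in link Delta s ->
    r' \in link Delta s -> splits r (cls s i) -> splits r' (cls s j) ->
    cls s i != cls s j -> r' |: (r |: s) \in Delta;
  nc_dim : forall s, s \in Delta -> (#|s| <= n)%N;
  nc_pure : forall s, s \in Delta -> (#|s| < n)%N ->
    exists r, r \in link Delta s }.

End NestedDef.

(** * Classes, splittings and atoms *)

Section Nested.
Local Open Scope ring_scope.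
Variables (R : realFieldType) (T V : finType) (g : V -> {set T}).
Variables (Delta : {set {set V}}) (n : nat).
Hypothesis nc : nested_complex g Delta n.
Local Notation vec := {ffun V -> R^o}.
Local Notation link := (link Delta).
Local Notation cls := (cls g).
Local Notation splits := (splits g).
Local Notation atom := (atom g Delta).
Implicit Types (s : {set V}) (r a b : V) (C : {set T}) (x v : vec) (i j : T).

(** Linear functionals on R^T modulo the all-one vector, evaluated at the indicator vectors of the
    sets [g r]. *)
Definition nested_linear x := exists2 y : T -> R, \sum_i y i = 0 &
  forall r, x r = \sum_(i in g r) y i.

Local Notation Lin := nested_linear.
Local Notation linear_at := (linear_at Delta Lin).

Lemma clsP s i j :
  reflect (forall N, N \in s -> (i \in g N) = (j \in g N)) (j \in cls s i).
Proof.
rewrite inE; apply: (iffP forall_inP) => h N Ns; apply/eqP; exact: h.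
Qed.

Lemma cls_refl s i : i \in cls s i. Proof. exact/clsP. Qed.

Lemma cls_eq s i j : (j \in cls s i) = (cls s i == cls s j).
Proof.
apply/idP/eqP => [/clsP h|->]; last exact: cls_refl.
by apply/setP => k; apply/clsP/clsP => hk N Ns; rewrite -hk// h.
Qed.

Lemma cls_in s i j : j \in cls s i -> cls s j = cls s i.
Proof. by rewrite cls_eq => /eqP. Qed.

Lemma clsU1 r s i : cls (r |: s) i =
  cls s i :&: (if i \in g r then g r else ~: g r).
Proof.
apply/setP => j; rewrite in_setI; apply/clsP/andP => [h|[/clsP h hr] N].
  split; first by apply/clsP => N Ns; apply: h; rewrite !inE Ns orbT.
  by have := h r (setU11 _ _); case: ifP => _ h'; rewrite ?inE -h'.
rewrite !inE => /predU1P[->|/h//]; move: hr; case: ifP => ir; rewrite ?inE.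
  by move->.
by move/negbTE->.
Qed.

Lemma cls_sub r s i : cls (r |: s) i \subset cls s i.
Proof. by rewrite clsU1 subsetIl. Qed.

Lemma linkE s r : (r \in link s) = (r \notin s) && (r |: s \in Delta).
Proof. by rewrite inE. Qed.

Lemma in_link s r : r \in link s -> r |: s \in Delta.
Proof. by rewrite linkE => /andP[]. Qed.

Lemma notin_link s r : r \in link s -> r \notin s.
Proof. by rewrite linkE => /andP[]. Qed.

Lemma link_sub s a r : s \in Delta -> r \in link (a |: s) -> r \in link s.
Proof.
move=> sD; rewrite !linkE !inE negb_or => /andP[/andP[_ ->] h]/=.
by apply: (nc_sub nc) h; rewrite setUS// subsetUr.
Qed.

Lemma adj_link s r r' : r \in link s -> r' \in link s -> r != r' ->
  r' |: (r |: s) \in Delta -> r' \in link (r |: s).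
Proof.
move=> rl rl' rr' h; rewrite linkE h andbT !inE negb_or eq_sym rr'.
exact: notin_link.
Qed.

Lemma link_neq s a r : r \in link (a |: s) -> r != a.
Proof. by move/notin_link; rewrite !inE negb_or => /andP[]. Qed.

Lemma adjC s r r' : r \in link s -> r' \in link (r |: s) -> r \in link (r' |: s).
Proof.
move=> rl h; rewrite linkE !inE negb_or eq_sym (link_neq h) notin_link//=.
by rewrite setUCA in_link.
Qed.

Lemma least_above s i N : s \in Delta -> N \in s -> i \in g N ->
  exists N0, [/\ N0 \in s, i \in g N0 &
    forall M, M \in s -> i \in g M -> g N0 \subset g M].
Proof.
move=> sD Ns iN.
case: (@arg_minnP _ N (fun M => (M \in s) && (i \in g M)) (fun M => #|g M|)).
  by rewrite Ns.
move=> N0 /andP[N0s iN0] hmin; exists N0; split=> // M Ms iM.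
case/or3P: (nc_laminar nc sD N0s Ms) => // [MN|].
  suff -> : g M = g N0 by [].
  by apply/eqP; rewrite eqEcard MN hmin// Ms.
by rewrite disjoint_subset => /subsetP/(_ i iN0); rewrite inE iM.
Qed.

Lemma splitsP r s i : reflect
  (exists2 j, j \in cls s i /\ j \in g r & exists2 k, k \in cls s i & k \notin g r)
  (splits r (cls s i)).
Proof.
apply: (iffP andP) => [[/set0Pn[j]]|[j [jC jr] [k kC kr]]].
  by rewrite inE => /andP[jC jr] /subsetPn[k kC kr]; exists j => //; exists k.
split; first by apply/set0Pn; exists j; rewrite in_setI jC.
by apply/subsetPn; exists k.
Qed.

(** Take [i] in [g r] lying only in members of [s] that contain [g r]. A point of its class outside
    [g r] is found in the least member above [i], or among the free points if there is none. *)
Lemma splits_ex s r : s \in Delta -> r \in link s ->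
  exists2 i, i \in g r & splits r (cls s i).
Proof.
move=> sD rl; have rsD := in_link rl.
have [i ir hi] := nc_point nc r sD; exists i => //; apply/splitsP.
exists i; first by split=> //; apply: cls_refl.
have [N /andP[Ns iN]|noN] := pickP (fun N => (N \in s) && (i \in g N)).
  have [N0 [N0s iN0 hN0]] := least_above sD Ns iN.
  have [j jN0 hj] := nc_point nc N0 rsD; exists j.
    apply/clsP => M Ms; apply/idP/idP => [iM|jM].
      by apply: (subsetP (hN0 M Ms iM)).
    by apply: (subsetP (hj M _ jM)) => //; rewrite inE Ms orbT.
  apply/negP => jr; have := hj r (setU11 _ _) jr => N0r.
  have : g r = g N0 by apply/eqP; rewrite eqEsubset hi.
  by move/(nc_inj nc) => rN0; have := notin_link rl; rewrite rN0 N0s.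
have [j hj] := nc_free nc rsD; exists j; last exact: (hj r (setU11 _ _)).
apply/clsP => M Ms; have := noN M; rewrite Ms/= => ->.
by apply/esym/negbTE/hj; rewrite inE Ms orbT.
Qed.

(** By laminarity a member of [s] is nested with [g r] or disjoint from it; in each case it contains
    both classes or neither. *)
Lemma splits_uniq s r i j : s \in Delta -> r \in link s ->
  splits r (cls s i) -> splits r (cls s j) -> cls s i = cls s j.
Proof.
move=> sD rl /splitsP[a [aC ar] [b bC br]] /splitsP[c [cC cr] [d dC dr]].
rewrite -(cls_in aC) -(cls_in cC); apply/eqP; rewrite -cls_eq.
apply/clsP => N Ns.
have Nrs : N \in r |: s by rewrite inE Ns orbT.
case/or3P: (nc_laminar nc (in_link rl) (setU11 r s) Nrs) => h.
- by rewrite !(subsetP h).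
- have abN : (a \in g N) = (b \in g N) by rewrite -(clsP _ _ _ aC)// -(clsP _ _ _ bC).
  have cdN : (c \in g N) = (d \in g N) by rewrite -(clsP _ _ _ cC)// -(clsP _ _ _ dC).
  rewrite abN cdN; have /negPf -> : b \notin g N by apply: contra br; apply/subsetP.
  by apply/esym/negbTE; apply: contra dr; apply/subsetP.
- move: h; rewrite disjoint_subset => /subsetP h.
  by have := h a ar; have := h c cr; rewrite !inE => /negPf-> /negPf->.
Qed.

Lemma saturated s r i j k : s \in Delta -> r \in link s -> splits r (cls s i) ->
  cls s i != cls s j -> k \in cls s j -> (k \in g r) = (j \in g r).
Proof.
move=> sD rl ri ij kC; have jC := cls_refl s j.
have nsplit : ~~ splits r (cls s j).
  by apply: contra ij => rj; apply/eqP; apply: splits_uniq rj.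
apply/idP/idP => h; apply: contraNT nsplit => h'; apply/splitsP.
  by exists k => //; exists j.
by exists j => //; exists k.
Qed.

Lemma splits_sub s a r i : s \in Delta -> a |: s \in Delta ->
  splits r (cls (a |: s) i) -> splits r (cls s i).
Proof.
move=> sD _ /splitsP[j [jC jr] [k kC kr]]; apply/splitsP.
exists j; first by split=> //; apply: (subsetP (cls_sub a s i)).
by exists k => //; apply: (subsetP (cls_sub a s i)).
Qed.

Lemma atom_link s C a : atom s C a -> a \in link s.
Proof. by case/and3P. Qed.

Lemma atom_splits s C a : atom s C a -> splits a C.
Proof. by case/and3P. Qed.

Lemma atom_min s C a r i : atom s C a -> r \in link s -> splits r C ->
  i \in C -> i \in g a -> i \in g r ->
  C :&: g a \subset g r /\ (r == a) || (r |: (a |: s) \in Delta).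
Proof.
case/and3P => _ _ /forall_inP h rl rC iC ia ir.
have := h r rl; rewrite rC/= => /implyP h'; apply/andP/h'.
by apply/set0Pn; exists i; rewrite !in_setI iC ia.
Qed.

(** Distinct atoms with a common point would be adjacent and have the same trace on the class, and
    then [b] could split no class of [a |: s]. *)
Lemma atom_uniq s i j a b : s \in Delta -> atom s (cls s i) a ->
  atom s (cls s i) b -> j \in cls s i -> j \in g a -> j \in g b -> a = b.
Proof.
move=> sD ha hb jC ja jb; apply/eqP/negPn/negP => ab.
have al := atom_link ha; have bl := atom_link hb.
have [sub1] := atom_min ha bl (atom_splits hb) jC ja jb.
have [sub2 _] := atom_min hb al (atom_splits ha) jC jb ja.
rewrite eq_sym (negPf ab)/= => abD.
have bl' : b \in link (a |: s) by apply: adj_link.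
have [x _ bx] := splits_ex (in_link al) bl'.
have xi : cls s x = cls s i.
  apply: (splits_uniq sD bl) (atom_splits hb).
  exact: splits_sub (in_link al) bx.
move: bx; rewrite clsU1 xi => /andP[/set0Pn[y]]; rewrite !in_setI => /andP[/andP[yC ya] yb].
have ya' : y \in g a by apply: (subsetP sub2); rewrite in_setI yC.
case: ifP ya => xa; last by rewrite inE ya'.
by move=> _; rewrite sub1.
Qed.

Lemma not_adj s r r' : (#|s| + 1)%N = n -> r \in link s -> r' \in link s ->
  r != r' -> r' |: (r |: s) \notin Delta.
Proof.
move=> sn rl rl' rr'; apply/negP => /(nc_dim nc).
rewrite !cardsU1 !inE negb_or eq_sym rr' !notin_link//; lia.
Qed.

(** In codimension one no two rays of the link are adjacent, so a ray that meets an atom is that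
    atom. *)
Lemma ridge_atom s r i : s \in Delta -> (#|s| + 1)%N = n -> r \in link s ->
  splits r (cls s i) -> atom s (cls s i) r.
Proof.
move=> sD sn rl ri; have [j [jC jr] _] := splitsP _ _ _ ri.
rewrite -(cls_in jC) in ri *.
have [a ha ja] := nc_atom nc sD rl ri.
have [_] := atom_min ha rl ri (cls_refl _ _) ja jr.
have [->//|ra /= arD] := eqVneq r a.
have ar : a != r by rewrite eq_sym.
by have := not_adj sn (atom_link ha) rl ar; rewrite arD.
Qed.

Lemma ridge_class s r r' i : s \in Delta -> (#|s| + 1)%N = n -> r \in link s ->
  r' \in link s -> splits r (cls s i) -> splits r' (cls s i).
Proof.
move=> sD sn rl rl' ri; have [j _ rj] := splits_ex sD rl'.
have [->//|ij] := eqVneq (cls s i) (cls s j).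
have rr' : r != r'.
  by apply: contra_neq ij => rE; apply: (splits_uniq sD rl) => //; rewrite rE.
by have := not_adj sn rl rl' rr'; rewrite (nc_indep nc sD rl rl' ri rj ij).
Qed.

(** The part of the class outside [g a] is again a class of [a |: s]. The rays of that link exist by
    purity, and they split this part because nothing inside [g a] can be split further. *)
Lemma residual_atom s i a j : s \in Delta -> (#|s| + 2 <= n)%N ->
  (forall r, r \in link s -> splits r (cls s i)) -> atom s (cls s i) a ->
  j \in cls s i -> j \notin g a ->
  exists2 b, atom (a |: s) (cls (a |: s) j) b & j \in g b.
Proof.
move=> sD sn all ha jC ja; have al := atom_link ha; have asD := in_link al.
have [|r rl] := nc_pure nc asD; first by rewrite cardsU1 notin_link//; lia.
have [x xr rx] := splits_ex asD rl.
have rls := link_sub sD rl.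
have xi : cls s x = cls s i.
  exact: (splits_uniq sD rls (splits_sub sD asD rx) (all r rls)).
have xa : x \notin g a.
  apply/negP => xa; have [|sub _] := atom_min ha rls (all r rls) _ xa xr.
    by rewrite -xi cls_refl.
  by move: rx; rewrite clsU1 xa xi => /andP[_]; rewrite sub.
apply: (nc_atom nc asD rl); suff -> : cls (a |: s) j = cls (a |: s) x by [].
by rewrite !clsU1 (negPf ja) (negPf xa) xi (cls_in jC).
Qed.

(** * Linear functions on a nested complex: extension, balancing, gluing *)

Lemma nested_linD v w : Lin v -> Lin w -> Lin (v + w).
Proof.
move=> [y y0 vy] [z z0 wz]; exists (fun i => y i + z i) => [|r].
  by rewrite big_split/= y0 z0 addr0.
by rewrite ffunE vy wz big_split.
Qed.

Lemma nested_linZ (c : R) v : Lin v -> Lin (c *: v).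
Proof.
move=> [y y0 vy]; exists (fun i => c * y i) => [|r].
  by rewrite -mulr_sumr y0 mulr0.
by rewrite ffunE vy -mulr_sumr.
Qed.

Lemma nested_lin_points (A : finType) (Q : pred A) (c : A -> R)
    (p p0 : A -> T) :
  Lin [ffun r => \sum_(a | Q a) c a * ((p a \in g r)%:R - (p0 a \in g r)%:R)].
Proof.
have ind (B : {set T}) i : \sum_(k in B) (k == i)%:R = (i \in B)%:R :> R.
  rewrite big_mkcond (bigD1 i)//= eqxx big1 ?addr0 => [|k /negPf->]; first by case: ifP.
  by case: ifP.
exists (fun k => \sum_(a | Q a) c a * ((k == p a)%:R - (k == p0 a)%:R)) => [|r].
  rewrite exchange_big big1// => a _; rewrite -mulr_sumr sumrB.
  have e i : \sum_k (k == i)%:R = 1 :> R.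
    by rewrite (bigD1 i)//= eqxx big1 ?addr0// => k /negPf->.
  by rewrite !e subrr mulr0.
rewrite ffunE exchange_big; apply: eq_bigr => a _.
by rewrite -mulr_sumr sumrB !ind.
Qed.

(** Evaluations at private points [p r], corrected at the free point [o] to have total zero, form a
    unitriangular system on [s]: [p a \in g r] forces [g a \subset g r]. *)
Lemma nested_extend s x : s \in Delta ->
  exists2 v, Lin v & forall r, r \in s -> x r = v r.
Proof.
move=> sD; have [o ho] := nc_free nc sD.
have /fin_all_exists[p hp] : forall r, exists i, i \in g r /\
    forall N, N \in s -> i \in g N -> g r \subset g N.
  by move=> r; have [i ir hi] := nc_point nc r sD; exists i.
have [|i j si sj ji ij|c hc] := @unitriangular_solve R V s (fun r => #|g r|)
  (fun a r => (p a \in g r)%:R - (o \in g r)%:R) x.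
- by move=> i si; have [-> _] := hp i; rewrite (negPf (ho i si)) subr0.
- have [_ hi] := hp i; rewrite (negPf (ho j sj)) subr0.
  case: (boolP (p i \in g j)) => // /(hi j sj) gij; case/negP: ij.
  by apply/eqP/(nc_inj nc)/esym/eqP; rewrite eqEcard gij.
exists [ffun r => \sum_(a in s) c a * ((p a \in g r)%:R - (o \in g r)%:R)].
  exact: nested_lin_points.
by move=> r rs; rewrite ffunE hc.
Qed.

Lemma sum_saturated s (B : {set T}) (y : T -> R) :
  (forall i, i \in B -> cls s i \subset B) ->
  (forall i, i \in B -> \sum_(j in cls s i) y j = 0) ->
  \sum_(j in B) y j = 0.
Proof.
move=> sat y0; rewrite (partition_big_imset (cls s)) big1// => C /imsetP[i iB ->].
rewrite -[RHS](y0 i iB); apply: eq_bigl => j; rewrite cls_eq eq_sym.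
by apply/andb_idl; rewrite -cls_eq => /(subsetP (sat i iB)).
Qed.

(** Induction from the innermost classes outwards: the least member of [s] above [i], or the whole
    set, consists of the class of [i] and of classes lying in more members. *)
Lemma sum_cls s (y : T -> R) : s \in Delta -> \sum_j y j = 0 ->
  (forall N, N \in s -> \sum_(j in g N) y j = 0) ->
  forall i, \sum_(j in cls s i) y j = 0.
Proof.
move=> sD yT ys; pose up i := [set N in s | i \in g N].
suff : forall k i, (#|s| - #|up i| < k)%N -> \sum_(j in cls s i) y j = 0.
  by move=> h i; apply: (h (#|s| - #|up i|).+1).
elim=> // k IH i; rewrite ltnS => upk.
have main (B : {set T}) : i \in B -> \sum_(j in B) y j = 0 ->
    (forall j, j \in B -> up i \subset up j) ->
    (forall j, j \in B -> cls s j \subset B) -> \sum_(j in cls s i) y j = 0.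
  move=> iB yB upB sat; have := yB.
  rewrite (bigID (mem (cls s i)))/= [X in _ + X](_ : _ = 0) ?addr0 => [h|].
    rewrite -[RHS]h; apply: eq_bigl => j.
    by apply/esym/andb_idl/(subsetP (sat i iB)).
  rewrite -[RHS](@sum_saturated s (B :\: cls s i) y).
  - by apply: eq_bigl => j; rewrite in_setD andbC.
  - move=> j; rewrite in_setD => /andP[ji jB]; apply/subsetP => l lj.
    rewrite in_setD (subsetP (sat j jB))// andbT.
    by apply: contra ji; rewrite !cls_eq (cls_in lj).
  - move=> j; rewrite in_setD => /andP[ji jB]; apply: IH.
    apply: leq_trans upk; apply: ltn_sub2l; last first.
      rewrite proper_card// properEneq upB// andbT.
      apply: contra ji => /eqP e; apply/clsP => N Ns.
      by have := congr1 (fun A : {set V} => N \in A) e; rewrite !inE Ns.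
    rewrite ltnNge; apply/negP => h.
    have : up i = s.
      by apply/eqP; rewrite eqEcard h andbT; apply/subsetP => N; rewrite inE => /andP[].
    move=> e; case/negP: ji; apply/clsP => N Ns.
    have : N \in up i by rewrite e.
    move=> iN; have := subsetP (upB j jB) N iN.
    by move: iN; rewrite !inE => /andP[_ ->] /andP[_ ->].
have [N /andP[Ns iN]|noN] := pickP (fun N => (N \in s) && (i \in g N)).
  have [N0 [N0s iN0 hN0]] := least_above sD Ns iN.
  apply: (main (g N0)) => //; first exact: ys.
    move=> j jN; apply/subsetP => M; rewrite !inE => /andP[Ms iM].
    by rewrite Ms (subsetP (hN0 M Ms iM)).
  by move=> j jN; apply/subsetP => l /clsP <-.
apply: (main setT) => //.
- by rewrite -[RHS]yT; apply: eq_bigl => j; rewrite inE.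
- by move=> j _; apply/subsetP => N; rewrite inE noN.
Qed.

Lemma sum_link s r i (y : T -> R) : s \in Delta -> r \in link s ->
  splits r (cls s i) -> (forall j, \sum_(k in cls s j) y k = 0) ->
  \sum_(k in g r) y k = \sum_(k in cls s i :&: g r) y k.
Proof.
move=> sD rl ri y0; rewrite (big_setID (cls s i))/= setIC.
rewrite [X in _ + X](_ : _ = 0) ?addr0//.
apply: (@sum_saturated s) => // j; rewrite in_setD => /andP[ji jr].
have ij : cls s i != cls s j by rewrite -cls_eq.
apply/subsetP => k kj; rewrite in_setD (saturated sD rl ri ij kj) jr andbT.
by rewrite cls_eq (cls_in kj).
Qed.

Lemma sum_atoms s i (B : {set T}) (y : T -> R) : s \in Delta ->
  (forall j, j \in B -> j \in cls s i /\ exists a,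
     [/\ atom s (cls s i) a, j \in g a & cls s i :&: g a \subset B]) ->
  \sum_(a | atom s (cls s i) a && (cls s i :&: g a \subset B))
     \sum_(j in cls s i :&: g a) y j = \sum_(j in B) y j.
Proof.
move=> sD hB; rewrite (exchange_big_dep (mem B))/=; last first.
  by move=> a j /andP[_ /subsetP]; apply.
apply: eq_bigr => j jB; have [jC [a [ha ja aB]]] := hB j jB.
rewrite (big_pred1 a)// => b; rewrite in_setI jC/=.
apply/idP/eqP => [/andP[/andP[hb _] jb]|->]; last by rewrite ha aB ja.
exact: (atom_uniq sD hb ha jC jb ja).
Qed.

Lemma atom_exists s i r j : s \in Delta -> r \in link s ->
  splits r (cls s i) -> j \in cls s i ->
  exists2 a, atom s (cls s i) a & j \in g a.
Proof.
move=> sD rl ri jC; rewrite -(cls_in jC) in ri *; exact: (nc_atom nc sD rl ri).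
Qed.

Lemma sum_atoms_ray s i r (y : T -> R) : s \in Delta -> r \in link s ->
  splits r (cls s i) ->
  \sum_(a | atom s (cls s i) a && (cls s i :&: g a \subset g r))
     \sum_(j in cls s i :&: g a) y j = \sum_(j in cls s i :&: g r) y j.
Proof.
move=> sD rl ri; rewrite -[RHS](@sum_atoms s i)//; last first.
  move=> j; rewrite in_setI => /andP[jC jr]; split=> //.
  have [a ha ja] := atom_exists sD rl ri jC; exists a; split=> //.
  by have [h _] := atom_min ha rl ri jC ja jr; rewrite subsetI subsetIl.
by apply: eq_bigl => a; rewrite subsetI subsetIl.
Qed.

Lemma sum_atoms_class s i r (y : T -> R) : s \in Delta -> r \in link s ->
  splits r (cls s i) ->
  \sum_(a | atom s (cls s i) a) \sum_(j in cls s i :&: g a) y j =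
  \sum_(j in cls s i) y j.
Proof.
move=> sD rl ri; rewrite -[RHS](@sum_atoms s i)//; last first.
  move=> j jC; split=> //; have [a ha ja] := atom_exists sD rl ri jC.
  by exists a; rewrite subsetIl.
by apply: eq_bigl => a; rewrite subsetIl andbT.
Qed.

Lemma atom_class s i j a : s \in Delta -> atom s (cls s i) a ->
  atom s (cls s j) a -> cls s i = cls s j.
Proof.
move=> sD hi hj.
exact: (splits_uniq sD (atom_link hi) (atom_splits hi) (atom_splits hj)).
Qed.

(** The linear function is built from masses [x a], one at a chosen point of each atom. The
    hypotheses say that the masses have total zero on each class and add up to the value at each ray
    of the link. *)
Lemma linear_from_atoms s x : s \in Delta -> (forall r, r \in s -> x r = 0) ->
  (forall i, \sum_(a | atom s (cls s i) a) x a = 0) ->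
  (forall r i, r \in link s -> splits r (cls s i) ->
    x r = \sum_(a | atom s (cls s i) a && (cls s i :&: g a \subset g r)) x a) ->
  linear_at x s.
Proof.
move=> sD x0 xC xr; have [o _] := nc_free nc sD.
pose At := [set a | [exists i, atom s (cls s i) a]].
have /fin_all_exists[p hp] : forall a, exists i, a \in At ->
    atom s (cls s i) a /\ i \in g a.
  move=> a; have [|_] := boolP (a \in At); last by exists o.
  rewrite inE => /existsP[i ha].
  have [j [jC ja] _] := splitsP _ _ _ (atom_splits ha).
  by exists j => _; rewrite (cls_in jC).
have pC a i : a \in At -> atom s (cls s i) a -> cls s (p a) = cls s i.
  by move=> /hp[h _]; apply: atom_class.
have AtP i a : atom s (cls s i) a -> a \in At.
  by move=> h; rewrite inE; apply/existsP; exists i.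
pose w (B : {set T}) := \sum_(a in At | p a \in B) x a.
have w0 (B : {set T}) : (forall i, i \in B -> cls s i \subset B) -> w B = 0.
  move=> sat; rewrite /w (partition_big (fun a => cls s (p a))
    (mem [set cls s i | i in B])) => [|a /andP[_ aB]]; last exact: imset_f.
  rewrite big1// => C /imsetP[i iB ->]; rewrite -[RHS](xC i).
  apply: eq_bigl => a; apply/andP/idP => [[/andP[aA _] /eqP<-]|ha].
    by have [] := hp a aA.
  have aA := AtP _ _ ha; split; last by rewrite (pC a i).
  by rewrite aA (subsetP (sat i iB))// cls_eq (pC a i).
exists [ffun r => \sum_(a in At) x a * ((p a \in g r)%:R - (o \in g r)%:R)].
  exact: nested_lin_points.
have wE r : \sum_(a in At) x a * ((p a \in g r)%:R - (o \in g r)%:R) = w (g r).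
  have wT : \sum_(a in At) x a = 0.
    by rewrite -[RHS](w0 setT)// /w; apply: eq_bigl => a; rewrite finset.in_setT andbT.
  under eq_bigr do rewrite mulrBr.
  rewrite sumrB -mulr_suml wT mul0r subr0 /w [RHS]big_mkcondr.
  by apply: eq_bigr => a _; case: ifP; rewrite ?mulr1 ?mulr0.
move=> r; rewrite ffunE wE inE => /orP[rs|rl].
  by rewrite x0// w0// => i ir; apply/subsetP => j /clsP <-.
have [i ir ri] := splits_ex sD rl; rewrite (xr r i)//.
rewrite /w [RHS](bigID (fun a => p a \in cls s i))/= [RHS]addrC.
have wD : w (g r :\: cls s i) = 0.
  apply: w0 => j; rewrite in_setD => /andP[ji jr]; apply/subsetP => k kj.
  have ij : cls s i != cls s j by rewrite -cls_eq.
  by rewrite in_setD (saturated sD rl ri ij kj) jr andbT cls_eq (cls_in kj).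
rewrite [X in X + _](_ : _ = w (g r :\: cls s i)); last first.
  by apply: eq_bigl => a; rewrite in_setD andbA andbAC.
rewrite wD add0r.
apply: eq_bigl => a; apply/idP/idP => [/andP[ha aB]|/andP[/andP[aA ar] aC]].
  have aA := AtP _ _ ha; have [_ pa] := hp a aA.
  have pCa : p a \in cls s i by rewrite cls_eq (pC a i).
  by rewrite aA pCa (subsetP aB)// in_setI pCa.
have [ha pa] := hp a aA; rewrite (cls_in aC) in ha.
by rewrite ha; have [-> _] := atom_min ha rl ri aC pa ar.
Qed.

(** At a ridge the rays of the link are the atoms of the one class that is split, so the balancing
    condition says that their masses have total zero. *)
Lemma nested_balanced s x : s \in Delta -> (#|s| + 1)%N = n ->
  (forall r, r \in s -> x r = 0) -> \sum_(r in link s) x r = 0 ->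
  linear_at x s.
Proof.
move=> sD sn x0 xl; apply: linear_from_atoms => // [i|r i rl ri].
  have [a /= ha|noa] := pickP (atom s (cls s i)); last by rewrite big_pred0.
  rewrite -[RHS]xl; apply: eq_bigl => r; apply/idP/idP; first exact: atom_link.
  move=> rl; apply: ridge_atom => //.
  exact: (ridge_class sD sn (atom_link ha) rl (atom_splits ha)).
rewrite (big_pred1 r)// => a; apply/andP/eqP => [[ha sub]|->]; last first.
  by split; [exact: ridge_atom|exact: subsetIr].
have [j [jC ja] _] := splitsP _ _ _ (atom_splits ha).
apply: (atom_uniq sD ha (ridge_atom sD sn rl ri) jC ja).
by apply: (subsetP sub); rewrite in_setI jC.
Qed.
Lemma linear_at_sum s r x : s \in Delta -> r \in link s ->
  (forall q, q \in s -> x q = 0) -> linear_at x (r |: s) ->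
  exists2 y : T -> R, forall j, \sum_(k in cls s j) y k = 0 &
    forall q i, q \in link s -> (q == r) || (q \in link (r |: s)) ->
      splits q (cls s i) -> x q = \sum_(k in cls s i :&: g q) y k.
Proof.
move=> sD rl x0 [v [y y0 vy] xv].
have yC : forall j, \sum_(k in cls s j) y k = 0.
  apply: sum_cls => // N Ns; rewrite -vy -xv ?x0//.
  by rewrite in_setU in_setU1 Ns orbT.
exists y => // q i ql qr qi; rewrite -(sum_link sD ql qi yC) -vy; apply: xv.
by rewrite in_setU; case/orP: qr => [/eqP->|->]; rewrite ?setU11 ?orbT.
Qed.

Lemma nested_glue s x : s \in Delta -> (#|s| + 2 <= n)%N ->
  (forall r, r \in link s -> linear_at x (r |: s)) -> linear_at x s.
Proof.
move=> sD sn; have [w lw xw] := nested_extend x sD.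
wlog x0 : x w lw xw / forall r, r \in s -> x r = 0.
  move=> H loc; have lN : Lin (- w) by rewrite -scaleN1r; apply: nested_linZ.
  have [|v lv|r rs|r rl|v lv vx] := H (x - w) (- w + w).
  - by apply: nested_linD.
  - by rewrite addNr !ffunE xw ?subrr.
  - by rewrite !ffunE xw ?subrr.
  - have [v lv vx] := loc r rl; exists (v - w); first exact: nested_linD.
    by move=> q /vx xq; rewrite !ffunE xq.
  - exists (v + w); first exact: nested_linD.
    by move=> q /vx; rewrite !ffunE => <-; rewrite subrK.
move=> loc {w lw xw}.
(* The atoms inside [r] are equal or adjacent to it, so the linear function near [r] computes all
   the values involved. *)
have ray r i : r \in link s -> splits r (cls s i) ->
    x r = \sum_(a | atom s (cls s i) a && (cls s i :&: g a \subset g r)) x a.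
  move=> rl ri; have [y yC xy] := linear_at_sum sD rl x0 (loc r rl).
  rewrite (xy r i)// ?eqxx// -(sum_atoms_ray _ sD rl ri).
  apply: eq_bigr => a /andP[ha sub]; rewrite (xy a i) ?(atom_link ha)//.
    have [j [jC ja] _] := splitsP _ _ _ (atom_splits ha).
    have jr : j \in g r by rewrite (subsetP sub)// in_setI jC.
    have [_] := atom_min ha rl ri jC ja jr.
    have [->//|ra /= arD] := eqVneq r a.
    apply: adjC; first exact: atom_link ha.
    by apply: adj_link => //; [exact: atom_link ha|rewrite eq_sym].
  exact: atom_splits ha.
apply: linear_from_atoms => // i.
have [a0 /= ha0|noa] := pickP (atom s (cls s i)); last by rewrite big_pred0.
have a0l := atom_link ha0; have a0C := atom_splits ha0.
(* A ray splitting another class is adjacent to all atoms of this one, so its linear function sees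
   their total mass. Otherwise all rays split [C], and the total is computed from one atom [a0]. *)
have [all|] := boolP [forall r in link s, splits r (cls s i)]; last first.
  rewrite negb_forall_in => /exists_inP[r rl ri].
  have [j _ rj] := splits_ex sD rl.
  have ij : cls s j != cls s i by apply: contra ri => /eqP<-.
  have [y yC xy] := linear_at_sum sD rl x0 (loc r rl).
  rewrite -[RHS](yC i) -(sum_atoms_class _ sD a0l a0C).
  apply: eq_bigr => a ha; apply: xy (atom_splits ha); first exact: atom_link ha.
  apply/orP; right; apply: adj_link => //; first exact: atom_link ha.
    apply: contra_neq ij => ra; apply: (splits_uniq sD rl rj).
    by rewrite ra; apply: atom_splits ha.
  exact: (nc_indep nc sD rl (atom_link ha) rj (atom_splits ha) ij).
move/forall_inP in all.
have [y yC xy] := linear_at_sum sD a0l x0 (loc a0 a0l).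
set s' := a0 |: s; set C := cls s i; have s'D : s' \in Delta := in_link a0l.
have [j1 _ [j0 j0C j0a]] := splitsP _ _ _ a0C.
have clsD j : j \in C -> j \notin g a0 -> cls s' j = C :\: g a0.
  by move=> jC ja; rewrite clsU1 (negPf ja) (cls_in jC) setDE.
have bl b : atom s' (cls s' j0) b -> b \in link s.
  by move=> hb; apply: (link_sub sD (atom_link hb)).
have xa0 : x a0 = \sum_(k in C :&: g a0) y k by apply: xy; rewrite ?eqxx.
have resid j : j \in C -> j \notin g a0 ->
    exists2 b, atom s' (cls s' j0) b & j \in g b.
  move=> jC ja; have [b hb jb] := residual_atom sD sn all ha0 jC ja.
  by exists b => //; rewrite (clsD j0)// -(clsD j).
(* The atoms [b] of [a0 |: s] partition [C :\: g a0]. The mass of the part in [b] is that of the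
   atoms of [C] inside [b], with [a0] taken away when it is among them. *)
have yb b : atom s' (cls s' j0) b -> \sum_(k in cls s' j0 :&: g b) y k =
    \sum_(a | (atom s C a && (a != a0)) && (C :&: g a \subset g b)) x a.
  move=> hb; have bC := all b (bl b hb).
  have : x b = \sum_(k in C :&: g b) y k.
    by apply: xy bC; rewrite ?bl// (atom_link hb) orbT.
  rewrite (ray b i (bl b hb) bC) (big_setID (g a0))/= => e.
  have -> : cls s' j0 :&: g b = (C :&: g b) :\: g a0.
    by rewrite clsD// setIDAC.
  have [sub|nsub] := boolP (C :&: g a0 \subset g b).
    move: e; rewrite (bigD1 a0) ?ha0//= [C :&: g b :&: _](_ : _ = C :&: g a0).
      rewrite -xa0 => /addrI <-; apply: eq_bigl => a.
      by rewrite -!andbA (andbC (a != a0)).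
    by rewrite setIAC; apply/setIidPl.
  move: e; rewrite [C :&: g b :&: _](_ : _ = finset.set0) => [|]; last first.
    apply/setP => k; rewrite finset.in_set0; apply: contraNF nsub.
    rewrite !in_setI => /andP[/andP[kC kb] ka].
    by have [] := atom_min ha0 (bl b hb) bC kC ka kb.
  rewrite big_set0 add0r => <-; apply: eq_bigl => a.
  have [->|_] := eqVneq a a0; last by rewrite andbT.
  by rewrite (negPf nsub) !andbF.
(* Each atom of [C] other than [a0] lies in exactly one [b]. *)
have sumC' : \sum_(a | atom s C a && (a != a0)) x a = \sum_(k in cls s' j0) y k.
  rewrite -(@sum_atoms s' j0 (cls s' j0) y s'D) => [|j jC']; last first.
    split=> //; move: jC'; rewrite clsD// in_setD => /andP[ja jC].
    have [b hb jb] := resid j jC ja; exists b.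
    by rewrite -(clsD j0)// subsetIl; split.
  under [RHS]eq_bigr => b /andP[hb _] do rewrite (yb b hb).
  rewrite (exchange_big_dep (fun a => atom s C a && (a != a0)))/=; last first.
    by move=> b a _ /andP[].
  apply: eq_bigr => a /andP[ha aa0].
  have [j [jC ja] _] := splitsP _ _ _ (atom_splits ha).
  have ja0 : j \notin g a0.
    by apply: contra_neqN aa0 => ja0; apply: (atom_uniq sD ha ha0 jC).
  have [b hb jb] := resid j jC ja0; have bC := all b (bl b hb).
  have [sub _] := atom_min ha (bl b hb) bC jC ja jb.
  rewrite (big_pred1 b)// => b'; apply/idP/eqP => [/andP[/andP[hb' _]]|->].
    rewrite ha aa0/= => sub'.
    apply: (@atom_uniq s' j0 j) => //; first by rewrite clsD// in_setD ja0.
    by rewrite (subsetP sub')// in_setI jC.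
  by rewrite hb subsetIl ha aa0.
rewrite (bigD1 a0)//= sumC' xa0 -[RHS](yC i) [RHS](big_setID (g a0))/=.
by rewrite clsD.
Qed.

(** Rays splitting different classes are adjacent. If there is only one class, a ray is equal or
    adjacent to the atoms it meets, and two atoms are joined by a ray of the link of the first
    through a point of the second. *)
Lemma nested_connected s (f : V -> R) : s \in Delta -> (#|s| + 2 <= n)%N ->
  (forall r r', r \in link s -> r' \in link s -> r' |: (r |: s) \in Delta ->
     f r = f r') ->
  forall r r', r \in link s -> r' \in link s -> f r = f r'.
Proof.
move=> sD sn hf r r' rl rl'.
have [i ir ri] := splits_ex sD rl; have [i' ir' ri'] := splits_ex sD rl'.
have [ii|ii] := eqVneq (cls s i) (cls s i'); last first.
  by apply: hf => //; apply: (nc_indep nc sD rl rl' ri ri' ii).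
have [all|] := boolP [forall q in link s, splits q (cls s i)]; last first.
  rewrite negb_forall_in => /exists_inP[q ql qi].
  have [j _ qj] := splits_ex sD ql.
  have ij : cls s i != cls s j by apply: contra qi => /eqP->.
  rewrite (hf r q) ?(nc_indep nc sD rl ql ri qj ij)//; apply: esym.
  apply: hf => //; apply: (nc_indep nc sD rl' ql ri' qj).
  by rewrite -ii.
move/forall_inP in all.
have close q j : q \in link s -> j \in cls s i -> j \in g q ->
    forall a, atom s (cls s i) a -> j \in g a -> f q = f a.
  move=> ql jC jq a ha ja.
  have [_] := atom_min ha ql (all q ql) jC ja jq.
  have [->//|_ /= qaD] := eqVneq q a.
  by apply/esym/hf => //; apply: atom_link ha.
have [a ha ia] := atom_exists sD rl ri (cls_refl s i).
have i'C : i' \in cls s i by rewrite cls_eq ii.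
have [a' ha' ia'] := atom_exists sD rl ri i'C.
rewrite (close r i _ _ _ a)// ?cls_refl// (close r' i' _ _ _ a')//.
have [ia'a|ia'a] := boolP (i' \in g a).
  by rewrite (atom_uniq sD ha ha' i'C).
have [b hb ib] := residual_atom sD sn all ha i'C ia'a.
have bl := link_sub sD (atom_link hb).
rewrite -(close b i' bl i'C ib a')//; apply: hf => //; first exact: atom_link ha.
exact: in_link (atom_link hb).
Qed.

(** * Signature of the form on a two-dimensional link *)

Section Surface.
Variables (s : {set V}) (q : vec -> vec -> R).
Hypotheses (sD : s \in Delta) (sn : (#|s| + 2)%N = n) (qb : symbilinear q).
Hypotheses (q_lin : forall v x, Lin v -> q v x = 0)
  (q_out : forall r x, r \notin s :|: link s -> q (delta R r) x = 0)
  (q_link : forall r r', r \in link s -> r' \in link s -> r != r' ->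
     q (delta R r) (delta R r') = (r' |: (r |: s) \in Delta)%:R).
Local Notation d := (delta R).

Lemma form_link x z : (forall r, r \in s -> x r = 0) ->
  q x z = \sum_(r in link s) x r * q (d r) z.
Proof.
move=> x0; rewrite {1}(vec_sum x) (sb_suml qb) (bigID (mem (link s)))/=.
rewrite [X in _ + X]big1 ?addr0 => [|r rl].
  by apply: eq_bigr => r _; rewrite (sbZl qb).
rewrite (sbZl qb); have [rs|rs] := boolP (r \in s); first by rewrite x0// mul0r.
by rewrite q_out ?mulr0// in_setU negb_or rs.
Qed.

(* This sum is the product with the class usually called alpha. *)
Lemma alpha_indep i j x : cls s i = cls s j ->
  \sum_(r in link s | i \in g r) q (d r) x =
  \sum_(r in link s | j \in g r) q (d r) x.
Proof.
move=> /eqP; rewrite -cls_eq => /clsP ij.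
have : q (\sum_r (((i \in g r)%:R - (j \in g r)%:R) : R) *: d r) x = 0.
  apply: q_lin; have := nested_lin_points xpredT (fun=> 1) (fun _ : 'I_1 => i) (fun=> j).
  congr Lin; apply/ffunP => r; rewrite ffunE big_ord1 mul1r.
  rewrite sum_ffunE (bigD1 r)//= !ffunE eqxx big1 ?addr0 => [|k kr].
    by rewrite -[LHS]mulr1.
  by rewrite !ffunE eq_sym (negPf kr) scaler0.
rewrite (sb_suml qb) (bigID (mem (link s)))/= [X in _ + X]big1 ?addr0 => [|r rl].
  under eq_bigr do rewrite (sbZl qb) mulrBl.
  rewrite sumrB => /eqP; rewrite subr_eq0 => /eqP e.
  rewrite [LHS]big_mkcondr [RHS]big_mkcondr/=.
  transitivity (\sum_(r in link s) (i \in g r)%:R * q (d r) x).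
    by apply: eq_bigr => r _; case: ifP; rewrite ?mul1r ?mul0r.
  by rewrite e; apply: eq_bigr => r _; case: ifP; rewrite ?mul1r ?mul0r.
rewrite (sbZl qb); have [rs|rs] := boolP (r \in s); first by rewrite ij// subrr mul0r.
by rewrite q_out ?mulr0// in_setU negb_or rs.
Qed.

Lemma not_adj3 r r' r'' : r \in link s -> r' \in link (r |: s) ->
  r'' \in link (r |: s) -> r' != r'' -> r'' |: (r' |: (r |: s)) \notin Delta.
Proof.
move=> rl; apply: not_adj; rewrite cardsU1 notin_link//; lia.
Qed.

Section TwoClasses.
Variables (i0 i1 : T) (r1 : V).
Hypotheses (i01 : cls s i0 != cls s i1) (r1l : r1 \in link s)
  (r1i : splits r1 (cls s i1)).

Lemma split_neq r : r \in link s -> splits r (cls s i0) -> r != r1.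
Proof.
move=> rl ri; apply: contra_neq i01 => rr; apply: (splits_uniq sD rl) => //.
by rewrite rr.
Qed.

(** Together with [r1] the two rays would span a cone with three rays more than [s], against the
    dimension. The next lemma excludes a third class in the same way. *)
Lemma same_class_not_adj r r' : r \in link s -> r' \in link s ->
  splits r (cls s i0) -> splits r' (cls s i0) -> r != r' ->
  r' |: (r |: s) \notin Delta.
Proof.
move=> rl rl' ri ri' rr'; apply/negP => rD.
have r1r : r1 \in link (r |: s).
  by apply: adj_link => //; [exact: split_neq|apply: (nc_indep nc sD rl r1l ri r1i)].
have r'r : r' \in link (r |: s) by apply: adj_link.
have r'r1 : r' != r1 by apply: split_neq.
have := not_adj3 rl r'r r1r r'r1; case/negP.
have rsD := in_link rl.
have [x _ xr'] := splits_ex rsD r'r; have [z _ zr1] := splits_ex rsD r1r.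
apply: (nc_indep nc rsD r'r r1r xr' zr1).
apply: contra_neq i01 => xz.
rewrite -(splits_uniq sD rl' (splits_sub sD rsD xr') ri').
rewrite -(splits_uniq sD r1l (splits_sub sD rsD zr1) r1i).
by apply/eqP; rewrite -cls_eq (subsetP (cls_sub r s x))// xz cls_refl.
Qed.

Lemma class_cover r0 r : r0 \in link s -> splits r0 (cls s i0) ->
  r \in link s -> splits r (cls s i0) || splits r (cls s i1).
Proof.
move=> r0l r0i rl; apply/negPn/negP; rewrite negb_or => /andP[ri0 ri1].
have [j _ rj] := splits_ex sD rl.
have j0 : cls s i0 != cls s j by apply: contra ri0 => /eqP->.
have j1 : cls s i1 != cls s j by apply: contra ri1 => /eqP->.
have neq r' k : r' \in link s -> splits r' (cls s k) -> cls s k != cls s j -> r' != r.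
  move=> rl' rk kj; apply: contra_neq kj => rr; apply: (splits_uniq sD rl') => //.
  by rewrite rr.
have rr1 : r1 \in link (r |: s).
  apply: adj_link => //; first by rewrite eq_sym (neq _ i1).
  by apply: (nc_indep nc sD rl r1l rj r1i); rewrite eq_sym.
have rr0 : r0 \in link (r |: s).
  apply: adj_link => //; first by rewrite eq_sym (neq _ i0).
  by apply: (nc_indep nc sD rl r0l rj r0i); rewrite eq_sym.
have r01 : r0 != r1 by apply: split_neq.
have := not_adj3 rl rr0 rr1 r01; case/negP; have rsD := in_link rl.
have [x _ xr] := splits_ex rsD rr0; have [z _ zr] := splits_ex rsD rr1.
apply: (nc_indep nc rsD rr0 rr1 xr zr); apply: contra_neq i01 => xz.
rewrite -(splits_uniq sD r0l (splits_sub sD rsD xr) r0i).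
rewrite -(splits_uniq sD r1l (splits_sub sD rsD zr) r1i).
by apply/eqP; rewrite -cls_eq (subsetP (cls_sub r s x))// xz cls_refl.
Qed.

(** The self-intersection is read off from alpha at [i] in [g r] and [j] outside. Rays not splitting
    the class contribute equally, the only ray of the class through [i] is [r], and those through
    [j] are not adjacent to [r]. *)
Lemma same_class_form r r' : r \in link s -> r' \in link s ->
  splits r (cls s i0) -> splits r' (cls s i0) -> q (d r) (d r') = 0.
Proof.
move=> rl rl' ri ri'; have [<-|rr'] := eqVneq r r'; last first.
  by rewrite q_link// (negPf (same_class_not_adj rl rl' ri ri' rr')).
have [i [iC ir] [j jC jr]] := splitsP _ _ _ ri.
have iE := cls_in iC; have jE := cls_in jC.
have := @alpha_indep i j (d r); rewrite iE jE => /(_ erefl).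
rewrite [LHS](bigID (fun k => splits k (cls s i0)))/=.
rewrite [RHS](bigID (fun k => splits k (cls s i0)))/=.
rewrite [X in _ + X = _](_ : _ =
  \sum_(k in link s | (j \in g k) && ~~ splits k (cls s i0)) q (d k) (d r)); last first.
  apply: eq_big => [k|k _]; last by [].
  rewrite -!andbA; have [kl/=|//] := boolP (k \in link s).
  rewrite andbC [RHS]andbC; have [//|nk/=] := boolP (splits k (cls s i0)).
  have [x _ kx] := splits_ex sD kl.
  have xi : cls s x != cls s i0 by apply: contra nk => /eqP<-.
  by rewrite (saturated sD kl kx xi iC) (saturated sD kl kx xi jC).
rewrite [X in _ = _ + X](_ : _ =
  \sum_(k in link s | (j \in g k) && ~~ splits k (cls s i0)) q (d k) (d r)); last first.
  by apply: eq_bigl => k; rewrite andbA.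
move=> /addIr; rewrite (big_pred1 r) => [->|k]; last first.
  apply/andP/eqP => [[/andP[kl ik] ki]|->]; last by rewrite rl ir.
  apply/eqP/negPn/negP => kr.
  have [a ha ia] := atom_exists sD rl ri iC.
  have ar : r = a.
    have [_] := atom_min ha rl ri iC ia ir.
    have [//|ra /=] := eqVneq r a.
    by rewrite (negPf (same_class_not_adj _ _ _ _ _))// ?(atom_link ha)// ?(atom_splits ha)// eq_sym.
  have ak : k = a.
    have [_] := atom_min ha kl ki iC ia ik.
    have [//|ka /=] := eqVneq k a.
    by rewrite (negPf (same_class_not_adj _ _ _ _ _))// ?(atom_link ha)// ?(atom_splits ha)// eq_sym.
  by rewrite ar ak eqxx in kr.
apply: big1 => k /andP[/andP[kl jk] ki]; rewrite q_link//; last first.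
  by apply: contraNneq jr => <-.
rewrite (negPf (same_class_not_adj _ _ _ _ _))//.
by apply: contraNneq jr => <-.
Qed.

End TwoClasses.

(** The square of a vector vanishing on [s] is twice the product of its sums [S true] and [S false]
    over the two classes, and orthogonality to [d r0 + d r1] makes these sums opposite. *)
Lemma surface_two_classes i0 i1 r0 r1 : cls s i0 != cls s i1 ->
  r0 \in link s -> splits r0 (cls s i0) ->
  r1 \in link s -> splits r1 (cls s i1) -> exists h, hyperbolic q h.
Proof.
move=> i01 r0l r0i r1l r1i; pose c r := splits r (cls s i0).
have i10 : cls s i1 != cls s i0 by rewrite eq_sym.
have c1 r : r \in link s -> splits r (cls s i1) = ~~ c r.
  move=> rl; have := class_cover i01 r1l r1i r0l r0i rl; rewrite /c.
  case: (boolP (splits r (cls s i0))) => [r0c _|_ /= ->//].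
  by apply: contraNF i01 => r1c; apply/eqP/(splits_uniq sD rl).
have qE r r' : r \in link s -> r' \in link s ->
    q (d r) (d r') = (c r != c r')%:R.
  move=> rl rl'; have [cc|/= cc] := eqVneq (c r) (c r').
    have [cr|cr] := boolP (c r).
      by apply: (same_class_form i01 r1l) => //; rewrite -/(c r') -cc.
    by apply: (same_class_form i10 r0l) => //; rewrite c1 -?cc.
  have rr' : r != r' by apply: contra_neq cc => ->.
  rewrite q_link//; suff -> : r' |: (r |: s) \in Delta by [].
  have [cr|cr] := boolP (c r).
    apply: (nc_indep nc sD rl rl' cr _ i01); rewrite c1//.
    by apply: contra cc => cr'; rewrite cr cr'.
  apply: (nc_indep nc sD rl rl' (i := i1) _ _ i10); first by rewrite c1.
  by rewrite -/(c r'); move: cc cr; case: (c r); case: (c r').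
have cr0 : c r0 by [].
have cr1 : c r1 = false by apply/negbTE; rewrite -c1.
exists (d r0 + d r1); split.
  rewrite !(sbDl qb, sbDr qb) !qE// cr0 cr1 !eqxx/=; lra.
move=> x; have [v lv xv] := nested_extend x sD.
have lN : Lin (- v) by rewrite -scaleN1r; apply: nested_linZ.
wlog x0 : x v lv xv lN / forall r, r \in s -> x r = 0.
  have qx z : q (x + - v) z = q x z by rewrite (sbDl qb) (q_lin _ lN) addr0.
  have -> : q x x = q (x + - v) (x + - v) by rewrite qx (sbC qb) qx.
  move=> H; rewrite -qx.
  have e r : r \in s -> (x + - v) r = 0 by move=> rs; rewrite !ffunE xv ?subrr.
  apply: (H _ (0 *: v)) => //; first exact: nested_linZ.
    by move=> r /e ->; rewrite scale0r ffunE.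
  by rewrite scale0r oppr0 -(scale0r v); apply: nested_linZ.
pose S (e : bool) := \sum_(r in link s | c r == e) x r.
have qxd r' : r' \in link s -> q x (d r') = S (~~ c r').
  move=> rl'; rewrite form_link// [RHS]big_mkcondr; apply: eq_bigr => r rl.
  by rewrite qE//; case: (c r); case: (c r'); rewrite ?mulr1 ?mulr0.
rewrite (sbDr qb) !qxd// cr0 cr1 /= => S0.
have -> : q x x = S true * S false + S false * S true.
  rewrite form_link// (bigID c)/= !mulr_suml; congr (_ + _); apply: eq_big => r.
  - by rewrite eqb_id.
  - by move=> /andP[rl cr]; rewrite (sbC qb) qxd// cr.
  - by rewrite eqbF_neg.
  - by move=> /andP[rl cr]; rewrite (sbC qb) qxd// (negPf cr).
have -> : S true = - S false by lra.
have := sqr_ge0 (S false); nra.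
Qed.

Section OneClass.
Variable i0 : T.
Hypothesis all : forall r, r \in link s -> splits r (cls s i0).
Local Notation C := (cls s i0).

(** By analogy with a matroid of rank three, whose atoms are points. *)
Definition line r := (r \in link s) && ~~ atom s C r.

Lemma line_atom l j : line l -> j \in C -> j \in g l ->
  exists a, [/\ atom s C a, j \in g a, a \in link (l |: s) & C :&: g a \subset g l].
Proof.
move=> /andP[ll nl] jC jl; have [a ha ja] := atom_exists sD ll (all ll) jC.
have [sub] := atom_min ha ll (all ll) jC ja jl.
have [la|la /= lD] := eqVneq l a; first by rewrite la ha in nl.
exists a; split=> //; apply: adjC; first exact: atom_link ha.
by apply: adj_link => //; [exact: atom_link ha|rewrite eq_sym].
Qed.

Lemma ridgeU r : r \in link s -> (#|r |: s| + 1)%N = n.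
Proof. by move=> rl; rewrite cardsU1 notin_link//; lia. Qed.

(** An atom inside [l] is adjacent to it and splits the part of [C] inside [g l]; at the ridge
    [l |: s] all rays split the same class. *)
Lemma line_class l r : line l -> r \in link (l |: s) ->
  exists2 x, x \in C & x \in g l /\ splits r (cls (l |: s) x).
Proof.
move=> hl rl; have ll : l \in link s by case/andP: hl.
have [j [jC jl] _] := splitsP _ _ _ (all ll).
have [a [ha ja al sub]] := line_atom hl jC jl; have lsD := in_link ll.
have [x xa xs] := splits_ex lsD al.
have xC : x \in C.
  rewrite cls_eq; apply/eqP/esym.
  exact: (splits_uniq sD (atom_link ha) (splits_sub sD lsD xs) (atom_splits ha)).
exists x => //; split; first by rewrite (subsetP sub)// in_setI xC.
exact: (ridge_class lsD (ridgeU ll) al rl xs).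
Qed.

Lemma line_outside l r i : line l -> i \in C -> i \notin g l ->
  r \in link (l |: s) -> i \notin g r.
Proof.
move=> hl iC il rl; apply/negP => ir; have ll : l \in link s by case/andP: hl.
have [x xC [xl]] := line_class hl rl.
rewrite clsU1 xl (cls_in xC) => /andP[/set0Pn[z]].
rewrite !in_setI => /andP[/andP[zC zl] zr] /subsetPn[w].
rewrite in_setI => /andP[wC wl] wr.
have lrs : l \in r |: (l |: s) by rewrite !inE eqxx orbT.
case/or3P: (nc_laminar nc (in_link rl) (setU11 _ _) lrs) => h.
- by rewrite (subsetP h) in il.
- by rewrite (subsetP h) in wr.
- by move: h; rewrite disjoint_subset => /subsetP/(_ z zr); rewrite inE zl.
Qed.

(** If they were adjacent, [l'] and an atom of [C] inside [l] would be atoms of the ridge [l |: s]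
    with a common point, hence equal. *)
Lemma line_line l l' : line l -> line l' -> l != l' -> q (d l) (d l') = 0.
Proof.
move=> hl hl' ll'; have ll : l \in link s by case/andP: hl.
have l'l : l' \in link s by case/andP: hl'.
rewrite q_link//; have [lD|//] := boolP (_ \in Delta).
have l'r : l' \in link (l |: s) by apply: adj_link.
have [x xC [xl l'x]] := line_class hl l'r.
have [z [zx zl'] _] := splitsP _ _ _ l'x.
have zC : z \in C by rewrite -(cls_in xC) (subsetP (cls_sub l s x)).
have zl : z \in g l by move: zx; rewrite clsU1 xl in_setI => /andP[].
have [a [ha za al sub]] := line_atom hl zC zl; have lsD := in_link ll.
have ax := ridge_class lsD (ridgeU ll) l'r al l'x.
have e : l' = a.
  by apply: (atom_uniq lsD (ridge_atom lsD (ridgeU ll) l'r l'x)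
    (ridge_atom lsD (ridgeU ll) al ax) zx zl' za).
by move: hl'; rewrite /line e ha andbF.
Qed.

Lemma alpha_line l i : line l -> i \in C ->
  \sum_(r in link s | i \in g r) q (d r) (d l) = 0.
Proof.
move=> hl iC; have ll : l \in link s by case/andP: hl.
have [_ _ [j jC jl]] := splitsP _ _ _ (all ll).
rewrite (@alpha_indep i j) ?(cls_in iC) ?(cls_in jC)// big1// => r /andP[rl jr].
have lr : l != r by apply: contraNneq jl => ->.
rewrite (sbC qb) q_link//; have [rD|//] := boolP (_ \in Delta).
have := line_outside hl jC jl (adj_link ll rl lr rD); by rewrite jr.
Qed.

(** The pairing of [l] with alpha is zero; written at a point of [g l], it shows the
    self-intersection as minus a number of adjacent rays. *)
Lemma line_self l : line l -> q (d l) (d l) <= 0.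
Proof.
move=> hl; have ll : l \in link s by case/andP: hl.
have [j [jC jl] _] := splitsP _ _ _ (all ll).
have := alpha_line hl jC; rewrite (bigD1 l) ?ll//= => /eqP.
rewrite addr_eq0 => /eqP->; rewrite oppr_le0; apply: sumr_ge0 => r /andP[/andP[rl _] lr].
by rewrite q_link// ler0n.
Qed.

Lemma alpha_atom a i : atom s C a -> i \in C ->
  0 < \sum_(r in link s | i \in g r) q (d r) (d a).
Proof.
move=> ha iC; have al := atom_link ha.
have [_ _ [j jC ja]] := splitsP _ _ _ (atom_splits ha).
rewrite (@alpha_indep i j) ?(cls_in iC) ?(cls_in jC)//.
have [b hb jb] : exists2 b, atom (a |: s) (cls (a |: s) j) b & j \in g b.
  by apply: (residual_atom sD _ all ha jC ja); rewrite sn.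
have bl := link_sub sD (atom_link hb).
have ba : b != a by apply: contraNneq ja => <-.
rewrite (bigD1 b) ?bl//= (sbC qb) q_link// ?(in_link (atom_link hb)); last by rewrite eq_sym.
rewrite ltr_pwDl// sumr_ge0// => r /andP[/andP[rl jr] _].
by rewrite q_link// ?ler0n//; apply: contraNneq ja => <-.
Qed.

(** Alpha is positive on atoms and zero on lines. A linear function removes the values of [x] at all
    atoms but [a0], orthogonality to alpha removes the one at [a0], and the remaining lines are
    mutually orthogonal with nonpositive squares. *)
Lemma surface_one_class r0 : r0 \in link s -> exists h, hyperbolic q h.
Proof.
move=> r0l; have [a0 ha0 i0a] := atom_exists sD r0l (all r0l) (cls_refl s i0).
have i0C := cls_refl s i0.
pose h := \sum_(r in link s | i0 \in g r) d r.
have hE x : q h x = \sum_(r in link s | i0 \in g r) q (d r) x.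
  by rewrite (sb_suml qb).
have hl l : line l -> q h (d l) = 0 by move=> ?; rewrite hE alpha_line.
have ha a : atom s C a -> 0 < q h (d a) by move=> ?; rewrite hE alpha_atom.
exists h; split.
  rewrite {2}/h (sbC qb) (sb_suml qb) (bigD1 a0) ?(atom_link ha0)//=.
  apply: ltr_pwDl; first by rewrite (sbC qb); apply: ha.
  apply: sumr_ge0 => r /andP[/andP[rl _] _]; rewrite (sbC qb).
  have [/ha/ltW//|nr] := boolP (atom s C r).
  by rewrite hl// /line rl nr.
move=> x xh.
have [p hp] : exists p : V -> T, forall a, atom s C a -> p a \in C /\ p a \in g a.
  apply: (@fin_all_exists _ _ (fun a i => atom s C a -> i \in C /\ i \in g a)) => a.
  have [/atom_splits/splitsP[i [iC ia] _]|_] := boolP (atom s C a); last by exists i0.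
  by exists i.
have [v lv xv] := nested_extend x sD.
(* Masses at the points [p a] reproduce the values at atoms other than [a0]; the opposite total sits
   at the point of [a0]. *)
pose w : vec := [ffun r => \sum_(a | atom s C a)
  (x a - v a) * ((p a \in g r)%:R - (p a0 \in g r)%:R)].
have lw : Lin w by apply: nested_lin_points.
have lN u : Lin u -> Lin (- u) by move=> lu; rewrite -scaleN1r; apply: nested_linZ.
pose z := x + - v + - w.
have qz u : q z u = q x u by rewrite !(sbDl qb) (q_lin _ (lN _ lv)) (q_lin _ (lN _ lw)) !addr0.
have zs r : r \in s -> z r = 0.
  move=> rs; rewrite !ffunE xv// subrr big1 ?subrr// => a ha'.
  have [pa _] := hp a ha'; have [pa0 _] := hp a0 ha0.
  by move/clsP: pa => <-//; move/clsP: pa0 => <-//; rewrite subrr mulr0.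
have za a : atom s C a -> a != a0 -> z a = 0.
  move=> ha' aa0; rewrite !ffunE.
  have pin b : atom s C b -> (p b \in g a) = (b == a).
    move=> hb; have [pC pb] := hp b hb; apply/idP/eqP => [pa|<-//].
    exact: (atom_uniq sD hb ha' pC pb pa).
  under eq_bigr => b hb do rewrite pin// pin// [a0 == a]eq_sym (negPf aa0) subr0.
  rewrite (bigD1 a)//= eqxx mulr1 big1 ?addr0 ?subrr// => b /andP[_ /negPf->].
  by rewrite mulr0.
have zl u : q z u = z a0 * q (d a0) u + \sum_(l | line l) z l * q (d l) u.
  rewrite form_link// (bigD1 a0) ?(atom_link ha0)//=; congr (_ + _).
  rewrite (bigID line)/= [X in _ + X]big1 ?addr0 => [|r /andP[/andP[rl ra0]]].
    apply: eq_bigl => l; rewrite /line; have [ll/=|//] := boolP (l \in link s).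
    by apply/andb_idl; apply: contraNneq => ->.
  by rewrite /line rl/= negbK => hr; rewrite za// mul0r.
have z0 : z a0 = 0.
  have := xh; rewrite -qz zl big1 ?addr0 => [/eqP|l hl']; last by rewrite (sbC qb) hl ?mulr0.
  by rewrite mulf_eq0 (sbC qb) (gt_eqF (ha a0 ha0)) orbF => /eqP.
have -> : q x x = q z z by rewrite qz (sbC qb x) qz.
rewrite zl z0 mul0r add0r; apply: sumr_le0 => l hl'.
rewrite (sbC qb) zl z0 mul0r add0r (bigD1 l)//= big1 ?addr0 => [|k /andP[hk kl]].
  by rewrite mulrA -expr2 mulr_ge0_le0 ?sqr_ge0 ?line_self.
by rewrite line_line ?mulr0.
Qed.

End OneClass.

Lemma nested_surface : exists h, hyperbolic q h.
Proof.
have [|r0 r0l] := nc_pure nc sD; first by rewrite -sn addn2 ltnS leqnSn.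
have [i0 _ r0i] := splits_ex sD r0l.
have [all|] := boolP [forall r in link s, splits r (cls s i0)].
  by move/forall_inP in all; apply: (surface_one_class all r0l).
rewrite negb_forall_in => /exists_inP[r1 r1l r1i].
have [i1 _ r1s] := splits_ex sD r1l.
apply: (@surface_two_classes i0 i1 r0 r1) => //.
by apply: contra r1i => /eqP->.
Qed.

End Surface.

(** * An ample class from minima of coordinates *)

Definition residue s r := [set i in g r | [forall N in s, (i \in g N) ==> (g r \subset g N)]].
Definition uncovered s := [set i | [forall N in s, i \notin g N]].

Lemma residueP s r i : reflect
  (i \in g r /\ forall N, N \in s -> i \in g N -> g r \subset g N)
  (i \in residue s r).
Proof.
rewrite inE; apply: (iffP andP) => -[ir h]; split=> //.
  by move=> N Ns iN; have /forall_inP/(_ N Ns) := h; rewrite iN.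
by apply/forall_inP => N Ns; apply/implyP; apply: h.
Qed.

(* Minus the sum, over all rays and the whole set, of the functions "minimum of
   the coordinates", made invariant under translation. *)
Definition minima_class : vec :=
  [ffun r => (#|V|.+1)%:R * (#|g r|%:R / #|T|%:R) -
             \sum_a (g a \subset g r)%:R].

(** On the cone [s] the minimum over [g a] is attained on [residue s a], and averages over the
    residues are linear. The difference is nonnegative and zero on [s]. A ray of the link splits
    some class, so it meets the residue of the least member above this class without containing that
    member, or meets the uncovered points; there the difference is positive. *)
Lemma minima_ample : ample_vec Delta Lin minima_class.
Proof.
move=> s sD; pose avg (A : {set T}) (B : {set T}) : R := #|A :&: B|%:R / #|A|%:R.
have avg1 (A B : {set T}) : A != finset.set0 -> A \subset B -> avg A B = 1.
  by move=> A0 /setIidPl AB; rewrite /avg AB divff// pnatr_eq0 cards_eq0.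
have avg_ge0 A B : 0 <= avg A B by rewrite divr_ge0 ?ler0n.
have avg_gt0 (A B : {set T}) i : i \in A -> i \in B -> 0 < avg A B.
  move=> iA iB; rewrite divr_gt0// ltr0n card_gt0; apply/set0Pn; exists i => //.
  by rewrite in_setI iA.
have avgE (A B : {set T}) : \sum_(i in B) (i \in A)%:R / #|A|%:R = avg A B.
  rewrite -mulr_suml /avg; congr (_ / _); rewrite -[#|A :&: B|]sum1_card natr_sum.
  rewrite [LHS]big_mkcond [RHS]big_mkcond; apply: eq_bigr => i _.
  by rewrite in_setI; case: (i \in A); case: (i \in B).
have [o ho] := nc_free nc sD.
have T0 : [set: T] != finset.set0 by apply/set0Pn; exists o; rewrite finset.in_setT.
have free0 : uncovered s != finset.set0.
  by apply/set0Pn; exists o; rewrite inE; apply/forall_inP.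
have res0 a : residue s a != finset.set0.
  have [i ia hi] := nc_point nc a sD; apply/set0Pn; exists i; exact/residueP.
(* Each residue and the uncovered set carry total mass 1, which makes [#|V| + 1]; this is taken away
   evenly over [T]. *)
pose y i : R := \sum_a (i \in residue s a)%:R / #|residue s a|%:R +
  ((i \in uncovered s)%:R / #|uncovered s|%:R - (#|V|.+1)%:R * ((i \in [set: T])%:R / #|[set: T]|%:R)).
have yE (B : {set T}) : \sum_(i in B) y i = \sum_a avg (residue s a) B +
    (avg (uncovered s) B - (#|V|.+1)%:R * avg [set: T] B).
  rewrite big_split/= exchange_big/= sumrB -mulr_sumr !avgE.
  by congr (_ + _); apply: eq_bigr => a _; rewrite avgE.
exists [ffun r => \sum_(i in g r) y i].
have val r : minima_class r + [ffun r => \sum_(i in g r) y i] r =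
    \sum_a (avg (residue s a) (g r) - (g a \subset g r)%:R) + avg (uncovered s) (g r).
  rewrite !ffunE yE sumrB /avg setTI cardsT; ring.
have term r a : 0 <= avg (residue s a) (g r) - (g a \subset g r)%:R.
  have [ar|ar] := boolP (g a \subset g r); last by rewrite subr0.
  rewrite avg1 ?subrr//; apply: subset_trans ar.
  by apply/subsetP => i /residueP[].
split.
- exists y; last by move=> r; rewrite ffunE.
  have -> : \sum_i y i = \sum_(i in [set: T]) y i.
    by apply: eq_bigl => i; rewrite finset.in_setT.
  rewrite yE (avg1 (uncovered s)) ?subsetT// (avg1 [set: T])//.
  under eq_bigr do rewrite avg1 ?subsetT//.
  by rewrite sumr_const -[X in X + _]/(#|V|%:R) -addn1 natrD; ring.
- move=> r rs; rewrite val big1 => [|a _].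
    rewrite add0r /avg (_ : _ :&: _ = finset.set0) ?cards0 ?mul0r//.
    apply/setP => i; rewrite in_setI finset.in_set0 inE; apply/negP.
    by move=> /andP[/forall_inP/(_ r rs)/negP].
  have [ar|ar] := boolP (g a \subset g r).
    rewrite avg1 ?subrr//; apply: subset_trans ar.
    by apply/subsetP => i /residueP[].
  rewrite subr0 /avg (_ : _ :&: _ = finset.set0) ?cards0 ?mul0r//.
  apply/setP => i; rewrite in_setI finset.in_set0; apply/negP.
  by move=> /andP[/residueP[_ h] ir]; rewrite h in ar.
move=> r rl; rewrite val; have [i _ /splitsP[j [jC jr] [k kC kr]]] := splits_ex sD rl.
have [N /andP[Ns jN]|noN] := pickP (fun N => (N \in s) && (j \in g N)).
  have [N0 [N0s jN0 hN0]] := least_above sD Ns jN.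
  rewrite (bigD1 N0)//= -addrA ltr_pwDl ?addr_ge0//; last first.
    by apply: sumr_ge0 => a _; apply: term.
  have N0r : ~~ (g N0 \subset g r).
    apply/subsetPn; exists k => //.
    by rewrite -(clsP _ _ _ kC)// (clsP _ _ _ jC).
  rewrite (negPf N0r) subr0; apply: avg_gt0 jr; exact/residueP.
rewrite ltr_wpDl ?sumr_ge0//; apply: avg_gt0 jr; rewrite inE.
by apply/forall_inP => N Ns; have := noN N; rewrite Ns/= => ->.
Qed.

Theorem nested_lorentzian : lorentzian_complex Delta Lin n.
Proof.
split.
- exact: nested_linD.
- exact: nested_linZ.
- exact: (nc_empty nc).
- exact: (nc_sub nc).
- exact: (nc_vertex nc).
- exact: nested_extend.
- exact: (nc_dim nc).
- exact: (nc_pure nc).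
- exact: nested_connected.
- by move=> s q sD sn qb ql qo qlk; apply: (@nested_surface s q).
- exact: nested_balanced.
- exact: nested_glue.
- by exists minima_class; apply: minima_ample.
Qed.
End Nested.

(** * Nested sets of flats *)

Section Flats.
Variables (T : finType) (r : {set T} -> nat).
Hypotheses (rP : polymatroid r) (r1 : forall x A, r (x |: A) <= (r A).+1).
Implicit Types (A B C F : {set T}) (x y : T).

Lemma rank_mono A B : A \subset B -> r A <= r B.
Proof. by case: rP => _ h _; apply: h. Qed.

Lemma rank_incr x A B : A \subset B -> r (x |: B) + r A <= r (x |: A) + r B.
Proof.
case: rP => _ _ sub AB; apply: leq_trans (sub (x |: A) B); rewrite leq_add//.
  by rewrite -setUA (setUidPr AB).
by rewrite rank_mono// subsetI AB andbT subsetUr.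
Qed.

Lemma flatP F : reflect (forall x, x \notin F -> r F < r (x |: F)) (flat r F).
Proof.
by apply: (iffP forallP) => h x; [move/implyP: (h x)|apply/implyP/h].
Qed.

Lemma flat_incr F A x : flat r F -> A \subset F -> x \notin F -> r A < r (x |: A).
Proof. by move=> /flatP h AF /h; have := rank_incr x AF; lia. Qed.

(** For [y] in [B] outside [C] the rank grows from [C] to [y |: C], and again on adding [x], which
    is outside [B]. Since [x] adds at most one to [C], adding [y] to [x |: C] must increase the
    rank. *)
Lemma flat_coloop B C x : flat r B -> x \notin B -> flat r (x |: B) ->
  C \subset B -> flat r C -> flat r (x |: C).
Proof.
move=> fB xB fxB CB fC; apply/flatP => y; rewrite !inE negb_or => /andP[yx yC].
have [yB|yB] := boolP (y \in B); last first.
  apply: (flat_incr fxB); first exact: setUS.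
  by rewrite !inE negb_or yx.
have yCB : y |: C \subset B by rewrite subUset sub1set yB.
have := flat_incr fB yCB xB; have := flat_incr fC (subxx C) yC.
by have := r1 x C; rewrite setUCA; lia.
Qed.

Definition closure A := [set x | r (x |: A) == r A]%SET.

Lemma sub_closure A : A \subset closure A.
Proof. by apply/subsetP => x xA; rewrite inE (setUidPr _) ?sub1set. Qed.

Lemma setU_ind (P : {set T} -> Prop) :
  P set0 -> (forall x A, x \notin A -> P A -> P (x |: A)) -> forall A, P A.
Proof.
move=> P0 PU A; elim: {A}_.+1 {-2}A (ltnSn #|A|) => // n IH A An.
have [->//|[x xA]] := set_0Vmem A; rewrite -(setD1K xA).
apply: PU; first by rewrite setD11.
by apply: IH; have := cardsD1 x A; rewrite xA; lia.
Qed.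

Lemma rank_closure A B : A \subset B -> B \subset closure A -> r B = r A.
Proof.
move=> AB BcA; suff : forall C, C \subset B -> r (C :|: A) = r A.
  by move=> /(_ B (subxx _)); rewrite (setUidPl AB).
elim/setU_ind => [|x C xC IH]; first by rewrite set0U.
rewrite subUset sub1set => /andP[xB CB]; rewrite -setUA.
have := rank_incr x (subsetUr C A); rewrite IH// => h.
have := subsetP BcA x xB; rewrite inE => /eqP e.
have := rank_mono (subsetUr (x |: C) A); rewrite -setUA; lia.
Qed.

Lemma closure_flat A : flat r (closure A).
Proof.
apply/flatP => x xA; have := xA; rewrite inE => h.
rewrite (rank_closure (sub_closure A))//.
have h1 := rank_mono (setUS [set x] (sub_closure A)).
have h2 := rank_mono (subsetUr [set x] A); lia.
Qed.

Lemma closure_min A F : flat r F -> A \subset F -> closure A \subset F.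
Proof.
move=> fF AF; apply/subsetP => x; rewrite inE; apply: contraTT => xF.
by have := flat_incr fF AF xF; rewrite neq_ltn => ->; rewrite orbT.
Qed.

Lemma closure_exchange A x y : y \in closure (x |: A) -> flat r A ->
  y \notin A -> x \in closure (y |: A).
Proof.
rewrite !inE => /eqP e fA yA; apply/eqP.
have := rank_mono (subsetUr [set x] (y |: A)); rewrite setUCA e.
have := flat_incr fA (subxx A) yA; have := r1 x A; lia.
Qed.

Lemma closure_exchange_eq A x y : y \in closure (x |: A) -> flat r A ->
  x \notin A -> y \notin A -> closure (y |: A) = closure (x |: A).
Proof.
move=> yx fA xA yA; apply/eqP; rewrite eqEsubset !closure_min ?closure_flat//.
- rewrite subUset sub1set closure_exchange//=.
  exact: subset_trans (subsetUr _ _) (sub_closure _).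
- rewrite subUset sub1set yx/=.
  exact: subset_trans (subsetUr _ _) (sub_closure _).
Qed.

Section Symmetric.
Variables (E : finType) (pi : T -> E).
Hypothesis pi_sym : forall x y A, pi x = pi y -> x \notin A -> y \notin A ->
  r (x |: A) = r (y |: A).

Local Notation fiber e := (pi @^-1: [set e]).

Lemma fiberP x e : (x \in fiber e) = (pi x == e).
Proof. by rewrite !inE. Qed.

(* The transposition of [x] and [y] is a symmetry of [r]. *)
Lemma closure_fiber A x y : flat r A -> x \notin A -> pi x = pi y ->
  y \notin closure (x |: A) -> closure (x |: A) = x |: A.
Proof.
move=> fA xA xy yW; apply/eqP; rewrite eqEsubset sub_closure andbT.
apply/subsetP => z zW; rewrite !inE; apply/norP => -[zx zA].
have yA : y \notin A.
  apply: contra yW => yA; apply: (subsetP (sub_closure _)).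
  by rewrite inE yA orbT.
have yz : y != z by apply: contraNneq yW => ->.
have xy' : x != y.
  apply: contraNneq yW => <-; apply: (subsetP (sub_closure _)); exact: setU11.
(* [z] generates the same closure as [x]. Since [x] depends on [z |: A], so does [y] by symmetry,
   which puts [y] in the closure. *)
have xz := closure_exchange zW fA zA; case/negP: yW.
have e : closure (z |: A) = closure (x |: A) by apply: closure_exchange_eq.
rewrite -e inE (@pi_sym y x)// ?inE ?negb_or ?yz//; first by move: xz; rewrite inE.
by rewrite eq_sym zx.
Qed.

Implicit Type S : {set T}.

(** A removed point increases the rank as much as its mate in the fibre, which lies outside the
    large flat. *)
Lemma flat_sub S A (S' : {set T}) : flat r (A :|: S) -> S' \subset S ->
  (forall x, x \in S -> x \notin A -> exists2 y, pi x = pi y & y \notin A :|: S) ->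
  flat r (A :|: S').
Proof.
move=> fAS SS mate; apply/flatP => x xA.
have [xAS|xAS] := boolP (x \in A :|: S); last exact: flat_incr fAS (setUS _ SS) xAS.
have xA' : x \notin A by move: xA; rewrite inE negb_or => /andP[].
have xS : x \in S by move: xAS; rewrite inE (negPf xA').
have [y xy yAS] := mate x xS xA'.
have yAS' : y \notin A :|: S' by apply: contra yAS; apply: (subsetP (setUS _ SS)).
by rewrite (pi_sym xy xA yAS'); apply: flat_incr fAS (setUS _ SS) yAS.
Qed.

(** A mate outside the flat [S] raises the rank of every subset of [S], and by symmetry the point
    itself does so too. *)
Lemma independent_rank S : r set0 = 0 -> flat r S ->
  (forall x, x \in S -> exists2 y, pi x = pi y & y \notin S) -> r S = #|S|.
Proof.
move=> r0 fS mate; suff : forall C, C \subset S -> r C = #|C| by apply.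
elim/setU_ind => [|x C xC IH]; first by rewrite r0 cards0.
rewrite subUset sub1set => /andP[xS CS]; have [y xy yS] := mate x xS.
have yC : y \notin C by apply: contra yS; apply: (subsetP CS).
have := flat_incr fS CS yS; rewrite -(pi_sym xy xC yC) cardsU1 xC IH//.
by have := r1 x C; rewrite IH//; lia.
Qed.

End Symmetric.
End Flats.

(** * Cones as pairs of a point set and a chain *)

Section NestedOk.
Variables (E T : finType) (r : {set T} -> nat) (pi : T -> E).
Implicit Types (S : {set T}) (K : {set {set E}}) (F G : {set E}) (e : E).

(* The cones of the Bergman fan: [S] indexes the unit vectors, [K] the chain. *)
Definition nested_ok S K :=
  [&& [forall e, ~~ (pi @^-1: [set e] \subset S)], chain K,
      [forall F in K, (F != set0) && (F != setT)] &
      [forall F, (F == set0) || (F \in K) ==> flat r (pi @^-1: F :|: S)]].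

Record nested_ok_spec S K : Prop := NestedOk {
  ok_fiber : forall e, exists2 i, pi i = e & i \notin S;
  ok_chain : forall F G, F \in K -> G \in K -> F \subset G \/ G \subset F;
  ok_proper : forall F, F \in K -> F != set0 /\ F != setT;
  ok_flat0 : flat r S;
  ok_flat : forall F, F \in K -> flat r (pi @^-1: F :|: S) }.

Lemma nested_okP S K : reflect (nested_ok_spec S K) (nested_ok S K).
Proof.
apply: (iffP and4P) => [[/forallP fib /forall_inP ch /forall_inP pr /forallP fl]|[fib ch pr fl0 fl]].
  split.
  - by move=> e; have /subsetPn[i] := fib e; rewrite !inE => /eqP ie iS; exists i.
  - by move=> F G /ch/forall_inP h /h/orP.
  - by move=> F /pr/andP.
  - by have /implyP := fl set0; rewrite eqxx preimset0 set0U; apply.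
  - by move=> F FK; have /implyP := fl F; rewrite FK orbT; apply.
split.
- apply/forallP => e; have [i ie iS] := fib e; apply/subsetPn; exists i => //.
  by rewrite !inE ie.
- by apply/forall_inP => F FK; apply/forall_inP => G GK; apply/orP/ch.
- by apply/forall_inP => F /pr/andP.
- apply/forallP => F; apply/implyP => /predU1P[->|/fl//].
  by rewrite preimset0 set0U.
Qed.

Definition ray_set (t : T + {set E}) : {set T} :=
  match t with inl i => [set i] | inr F => pi @^-1: F end.

Variables (W : finType) (h : W -> T + {set E}).
Definition points_of (s : {set W}) := [set i | [exists w in s, h w == inl i]].
Definition chain_of (s : {set W}) := [set F | [exists w in s, h w == inr F]].

Lemma pointsP (s : {set W}) i : reflect (exists2 w, w \in s & h w = inl i) (i \in points_of s).
Proof.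
by rewrite inE; apply: (iffP exists_inP) => -[w ws /eqP e]; exists w => //; apply/eqP.
Qed.

Lemma chainP (s : {set W}) F : reflect (exists2 w, w \in s & h w = inr F) (F \in chain_of s).
Proof.
by rewrite inE; apply: (iffP exists_inP) => -[w ws /eqP e]; exists w => //; apply/eqP.
Qed.

Lemma points_inl w s i : h w = inl i -> points_of (w |: s) = i |: points_of s.
Proof.
move=> hw; apply/setP => j; rewrite in_setU1; apply/pointsP/predU1P => [[v]|[->|]].
- rewrite in_setU1 => /predU1P[->|vs hv]; first by rewrite hw => -[->]; left.
  by right; apply/pointsP; exists v.
- by exists w => //; apply: setU11.
- by case/pointsP => v vs hv; exists v => //; rewrite in_setU1 vs orbT.
Qed.

Lemma points_inr w s F : h w = inr F -> points_of (w |: s) = points_of s.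
Proof.
move=> hw; apply/setP => j; apply/pointsP/pointsP => -[v vs hv]; exists v => //.
  by move: vs; rewrite in_setU1 => /predU1P[vw|//]; rewrite vw hw in hv.
by rewrite in_setU1 vs orbT.
Qed.

Lemma chain_inl w s i : h w = inl i -> chain_of (w |: s) = chain_of s.
Proof.
move=> hw; apply/setP => j; apply/chainP/chainP => -[v vs hv]; exists v => //.
  by move: vs; rewrite in_setU1 => /predU1P[vw|//]; rewrite vw hw in hv.
by rewrite in_setU1 vs orbT.
Qed.

Lemma chain_inr w s F : h w = inr F -> chain_of (w |: s) = F |: chain_of s.
Proof.
move=> hw; apply/setP => j; rewrite in_setU1; apply/chainP/predU1P => [[v]|[->|]].
- rewrite in_setU1 => /predU1P[->|vs hv]; first by rewrite hw => -[->]; left.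
  by right; apply/chainP; exists v.
- by exists w => //; apply: setU11.
- by case/chainP => v vs hv; exists v => //; rewrite in_setU1 vs orbT.
Qed.

Lemma points_sub (s t : {set W}) : t \subset s -> points_of t \subset points_of s.
Proof.
move=> ts; apply/subsetP => i /pointsP[w wt hw]; apply/pointsP; exists w => //.
exact: (subsetP ts).
Qed.

Lemma chain_sub (s t : {set W}) : t \subset s -> chain_of t \subset chain_of s.
Proof.
move=> ts; apply/subsetP => i /chainP[w wt hw]; apply/chainP; exists w => //.
exact: (subsetP ts).
Qed.

Lemma points0 : points_of set0 = set0.
Proof. by apply/setP => i; rewrite in_set0; apply/pointsP => -[w]; rewrite in_set0. Qed.

Lemma chain0 : chain_of set0 = set0.
Proof. by apply/setP => i; rewrite in_set0; apply/chainP => -[w]; rewrite in_set0. Qed.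

Lemma card_points_chain (s : {set W}) : injective h ->
  #|s| = #|points_of s| + #|chain_of s|.
Proof.
move=> hI; rewrite -(card_imset _ hI).
rewrite -(card_imset (points_of s) (@inl_inj _ {set E})).
rewrite -(card_imset (chain_of s) (@inr_inj T _)) -cardsUI.
rewrite [X in _ = _ + #|pred_of_set X|](_ : _ = set0) ?cards0 ?addn0.
  apply: eq_card => t; rewrite in_setU; apply/imsetP/orP.
    case=> w ws ->; case e : (h w) => [i|F]; [left|right]; apply: imset_f.
      by apply/pointsP; exists w.
    by apply/chainP; exists w.
  case=> /imsetP[x]; first by case/pointsP => w ws hw ->; exists w.
  by case/chainP => w ws hw ->; exists w.
apply/setP => t; rewrite in_setI in_set0; apply/negP => /andP[/imsetP[x _ ->]].
by case/imsetP.
Qed.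

End NestedOk.

(** * Compatibility of points and chain members *)

Section NestedFlats.
Variables (E T : finType) (r : {set T} -> nat) (pi : T -> E).
Hypotheses (rP : polymatroid r) (r1 : forall x A, r (x |: A) <= (r A).+1).
Hypothesis pi_sym : forall x y (A : {set T}), pi x = pi y -> x \notin A -> y \notin A ->
  r (x |: A) = r (y |: A).
Implicit Types (S : {set T}) (K : {set {set E}}) (F G : {set E}) (e : E).
Local Notation ok := (nested_ok r pi).
Local Notation Spec := (nested_ok_spec r pi).
Local Notation fib F S := (pi @^-1: F :|: S).

Lemma in_fib F S i : (i \in fib F S) = (pi i \in F) || (i \in S).
Proof. by rewrite !inE. Qed.

Lemma fib_subset F G S S' : F \subset G -> S \subset S' -> fib F S \subset fib G S'.
Proof.
move=> FG SS; apply/subsetP => i; rewrite !in_fib => /orP[/(subsetP FG)->//|].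
by move/(subsetP SS)->; rewrite orbT.
Qed.

Lemma ok_mate S K F i : Spec S K -> i \in S -> i \notin pi @^-1: F ->
  exists2 j, pi i = pi j & j \notin fib F S.
Proof.
move=> hS iS; rewrite inE => iF; have [j ji jS] := ok_fiber hS (pi i).
by exists j => //; rewrite in_fib negb_or ji iF.
Qed.

Lemma ok_sub S K S' K' : S' \subset S -> K' \subset K -> ok S K -> ok S' K'.
Proof.
move=> SS KK /nested_okP hS; apply/nested_okP; split.
- move=> e; have [i ie iS] := ok_fiber hS e; exists i => //.
  by apply: contra iS; apply: (subsetP SS).
- by move=> F G /(subsetP KK) FK /(subsetP KK); apply: (ok_chain hS).
- by move=> F /(subsetP KK); apply: (ok_proper hS).
- rewrite -[S']set0U; apply: (flat_sub rP pi_sym (S := S)) => //.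
    by rewrite set0U; apply: ok_flat0 hS.
  move=> x xS _; rewrite set0U -[S]set0U -(preimset0 pi).
  by apply: (ok_mate hS) => //; rewrite inE in_set0.
- move=> F FK; apply: (flat_sub rP pi_sym (S := S)) => //.
    exact: (ok_flat hS (subsetP KK _ FK)).
  by move=> x xS xF; apply: (ok_mate hS).
Qed.

Lemma ok_add_chain S K F G : ok S (F |: K) -> ok S (G |: K) -> F \subset G ->
  ok S (G |: (F |: K)).
Proof.
move=> /nested_okP hF /nested_okP hG FG; apply/nested_okP; split.
- exact: (ok_fiber hF).
- move=> A B; rewrite !in_setU1.
  move=> /or3P[/eqP->|/eqP->|AK] /or3P[/eqP->|/eqP->|BK];
    first [by left | by right | by apply: (ok_chain hF); rewrite !in_setU1 ?eqxx ?AK ?BK ?orbT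
          | by apply: (ok_chain hG); rewrite !in_setU1 ?eqxx ?AK ?BK ?orbT].
- move=> A; rewrite !in_setU1 => /or3P[/eqP->|/eqP->|AK].
  + by apply: (ok_proper hG); apply: setU11.
  + by apply: (ok_proper hF); apply: setU11.
  + by apply: (ok_proper hG); rewrite in_setU1 AK orbT.
- exact: (ok_flat0 hF).
- move=> A; rewrite !in_setU1 => /or3P[/eqP->|/eqP->|AK].
  + by apply: (ok_flat hG); apply: setU11.
  + by apply: (ok_flat hF); apply: setU11.
  + by apply: (ok_flat hG); rewrite in_setU1 AK orbT.
Qed.

Lemma fib_point F S i : pi i \in F -> fib F (i |: S) = fib F S.
Proof.
by move=> iF; apply/setP => j; rewrite !in_fib in_setU1; case: eqVneq => [->|//]; rewrite iF.
Qed.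

Lemma fib_pointC F S i : fib F (i |: S) = i |: fib F S.
Proof. by rewrite setUCA. Qed.

(** The only new flat belongs to [F]. If [pi i] is in [F], the point is absorbed; otherwise the flat
    of [G] admits [i], and [flat_coloop] carries this down to [F]. *)
Lemma ok_add_mixed S K F i : ok (i |: S) K -> ok S (F |: K) -> i \notin S ->
  (pi i \in F) || [exists G in K, (F \subset G) && (pi i \notin G)] ->
  ok (i |: S) (F |: K).
Proof.
move=> /nested_okP hi /nested_okP hF iS sep; apply/nested_okP; split.
- exact: (ok_fiber hi).
- exact: (ok_chain hF).
- exact: (ok_proper hF).
- exact: (ok_flat0 hi).
have fF : flat r (fib F S) by apply: (ok_flat hF); apply: setU11.
move=> A; rewrite in_setU1 => /predU1P[->|]; last exact: (ok_flat hi).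
have [iF|iF] := boolP (pi i \in F); first by rewrite fib_point.
move: sep; rewrite (negPf iF)/= => /exists_inP[G GK /andP[FG iG]].
rewrite fib_pointC; apply: (flat_coloop rP r1 (B := fib G S)) => //.
- by apply: (ok_flat hF); rewrite in_setU1 GK orbT.
- by rewrite in_fib negb_or iG.
- by rewrite -fib_pointC; apply: (ok_flat hi).
- exact: fib_subset.
Qed.

(** Members containing [pi i] absorb [i]. The others lie inside [G], whose flat admits [j], and
    [flat_coloop] carries this down. *)
Lemma ok_add_points S K i j G : ok (i |: S) K -> ok (j |: S) K -> i \notin S ->
  j \notin S -> G \in K -> pi i \in G -> pi j \notin G -> ok (j |: (i |: S)) K.
Proof.
move=> /nested_okP hi /nested_okP hj iS jS GK iG jG; apply/nested_okP.
have piN : pi i != pi j by apply: contraNneq jG => <-.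
have fl F : flat r (fib F (i |: S)) -> flat r (fib F (j |: S)) ->
    (pi i \in F) || (F \subset G) -> flat r (fib F (j |: (i |: S))).
  move=> fi fj; have [iF _|iF /= FG] := boolP (pi i \in F).
    by rewrite [j |: _]setUCA fib_point.
  rewrite fib_pointC; apply: (flat_coloop rP r1 (B := fib G (i |: S))) => //.
  - exact: (ok_flat hi).
  - rewrite in_fib negb_or jG in_setU1 negb_or jS andbT/=.
    by apply: contraNneq piN => ->.
  - by rewrite -fib_pointC [j |: _]setUCA fib_point//; apply: (ok_flat hj).
  - exact: fib_subset.
split.
- move=> e; have [|ej] := eqVneq e (pi j).
    have [k ke kS] := ok_fiber hj e; move=> ej; exists k => //.
    rewrite !in_setU1 orbCA negb_or; move: kS; rewrite in_setU1 => ->.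
    by rewrite andbT; apply: contraNneq piN => <-; rewrite ke ej.
  have [k ke kS] := ok_fiber hi e; exists k => //.
  rewrite in_setU1 negb_or kS andbT; apply: contraNneq ej => <-.
  by rewrite ke.
- exact: (ok_chain hi).
- exact: (ok_proper hi).
- rewrite -[X in flat r X]set0U -(preimset0 pi); apply: fl; rewrite ?sub0set ?orbT//.
    by rewrite preimset0 set0U; apply: (ok_flat0 hi).
  by rewrite preimset0 set0U; apply: (ok_flat0 hj).
- move=> F FK; apply: fl; [exact: (ok_flat hi)|exact: (ok_flat hj)|].
  have [iF//|iF /=] := boolP (pi i \in F).
  have [//|GF] := ok_chain hi FK GK.
  by rewrite (subsetP GF) in iF.
Qed.

(* [K] is a chain, so this union is its largest member avoiding [i], or [set0]. *)
Definition floor K i := \bigcup_(F in K | pi i \notin F) F.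

Lemma chain_bigcup S K (Q : pred {set E}) : Spec S K ->
  let B := \bigcup_(F in K | Q F) F in (B \in K /\ Q B) \/ B = set0.
Proof.
move=> hK B; have [F0 /andP[F0K F0Q]|no] := pickP (fun F => (F \in K) && Q F); last first.
  by right; rewrite /B big1// => F FQ; have := no F; rewrite FQ.
left; case: (@arg_maxnP _ F0 (fun F => (F \in K) && Q F) (fun F => #|F|)).
  by rewrite F0K.
move=> F /andP[FK FQ] Fmax; suff -> : B = F by [].
apply/eqP; rewrite eqEsubset bigcup_sup ?FK// andbT; apply/bigcupsP => G /andP[GK GQ].
have [//|FG] := ok_chain hK GK FK; suff -> : G = F by [].
by apply/esym/eqP; rewrite eqEcard FG; apply: Fmax; rewrite GK.
Qed.

(** * The flat generated by a new point *)

Section Floor.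
Variables (S : {set T}) (K : {set {set E}}) (i : T).
Hypotheses (okS : Spec S K) (iS : i \notin S).
Local Notation A := (fib (floor K i) S).
Local Notation C := (closure r (i |: A)).

Lemma floor_notin : pi i \notin floor K i.
Proof. by apply/bigcupP => -[F /andP[_ /negP]]. Qed.

Lemma floor_max F : F \in K -> pi i \notin F -> F \subset floor K i.
Proof. by move=> FK iF; apply: bigcup_sup; rewrite FK. Qed.

Lemma floor_min F j : pi j \in F ->
  (forall G, G \in K -> pi i \notin G -> pi j \notin G) ->
  (forall G, G \in K -> F \subset G \/ G \subset F) -> floor K i \subset F.
Proof.
move=> jF ij ch; apply/bigcupsP => G /andP[GK iG].
by have [FG|//] := ch G GK; have := ij G GK iG; rewrite (subsetP FG).
Qed.

Lemma floor_sub F : F \in K -> pi i \in F -> floor K i \subset F.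
Proof.
move=> FK iF; apply: (floor_min (j := i)) => //.
by move=> G; apply: (ok_chain okS).
Qed.

Lemma floor_flat : flat r A.
Proof.
have := chain_bigcup (fun F => pi i \notin F) okS; rewrite -/(floor K i).
case=> [[FK _]|->]; first exact: (ok_flat okS).
by rewrite preimset0 set0U; apply: ok_flat0 okS.
Qed.

Lemma floor_base : i \notin A.
Proof. by rewrite in_fib negb_or floor_notin. Qed.

(** [A] is the largest flat of the cone that does not absorb [i]; what can be added to it can be
    added to the smaller ones by [flat_coloop]. *)
Lemma ok_point : flat r (i |: A) -> ~~ (pi @^-1: [set pi i] \subset i |: S) ->
  nested_ok r pi (i |: S) K.
Proof.
move=> fiA nfib.
have fl F : flat r (fib F S) -> F \subset floor K i -> flat r (fib F (i |: S)).
  move=> fF FA; rewrite fib_pointC; apply: (flat_coloop rP r1 floor_flat) => //.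
    exact: floor_base.
  exact: fib_subset.
apply/nested_okP; split.
- move=> e; have [->|ei] := eqVneq e (pi i).
    by have /subsetPn[j] := nfib; rewrite !inE => /eqP; exists j => //; rewrite !inE.
  have [j je jS] := ok_fiber okS e; exists j => //; rewrite in_setU1 negb_or jS andbT.
  by apply: contraNneq ei => <-; rewrite je.
- exact: (ok_chain okS).
- exact: (ok_proper okS).
- rewrite -[X in flat r X]set0U -(preimset0 pi); apply: fl; rewrite ?sub0set//.
  by rewrite preimset0 set0U; apply: ok_flat0 okS.
- move=> F FK; have [iF|iF] := boolP (pi i \in F).
    by rewrite fib_point//; apply: (ok_flat okS).
  by apply: fl; [exact: (ok_flat okS)|exact: floor_max].
Qed.

Hypothesis nok : ~~ nested_ok r pi (i |: S) K.

Definition cover := [set e | pi @^-1: [set e] \subset C].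

Lemma base_closure : i \in C.
Proof. by apply: (subsetP (sub_closure _ _)); apply: setU11. Qed.

Lemma floor_closure : A \subset C.
Proof. exact: subset_trans (subsetUr _ _) (sub_closure _ _). Qed.

Lemma closure_point j : j \in C -> j \notin A -> flat r (j |: A) -> j = i.
Proof.
move=> jC jA fjA; have := closure_min rP fjA (subxx _).
rewrite (closure_exchange_eq rP r1 jC floor_flat floor_base jA).
move=> /subsetP/(_ i base_closure); rewrite in_setU1 (negPf floor_base) orbF.
by move/eqP.
Qed.

(** If the fibre of a new point [j] stuck out of the closure, the closure would be [j |: A] by
    [closure_fiber]. Then [j] would be [i], and [i] could be added as a point, against [nok]. *)
Lemma closure_cover : C = fib cover S.
Proof.
have full j : j \in C -> j \notin A -> pi @^-1: [set pi j] \subset C.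
  move=> jC jA; apply/negPn/negP => /subsetPn[k]; rewrite fiberP => /eqP kj kC.
  have e := closure_exchange_eq rP r1 jC floor_flat floor_base jA.
  have kC' : k \notin closure r (j |: A) by rewrite e.
  have jE := closure_fiber rP r1 pi_sym floor_flat jA (esym kj) kC'.
  have ji : j = i.
    by apply: closure_point => //; rewrite -jE; apply: closure_flat.
  rewrite ji in jE kj; case/negP: nok; apply: ok_point.
    by rewrite -jE; apply: closure_flat.
  apply/subsetPn; exists k; first by rewrite !inE kj.
  apply: contra kC' => kiS; apply: (subsetP (sub_closure _ _)).
  rewrite ji; move: kiS; rewrite !in_setU1 in_fib => /orP[->//|->].
  by rewrite !orbT.
apply/eqP; rewrite eqEsubset; apply/andP; split.
  apply/subsetP => j jC; rewrite in_fib; have [jA|jA] := boolP (j \in A).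
    move: jA; rewrite in_fib => /orP[jF|->]; last by rewrite orbT.
    apply/orP; left; rewrite inE; apply/subsetP => k; rewrite fiberP => /eqP kj.
    by apply: (subsetP floor_closure); rewrite in_fib kj jF.
  by rewrite inE full.
apply/subsetP => j; rewrite in_fib => /orP[|jS].
  by rewrite inE => /subsetP; apply; rewrite !inE.
by apply: (subsetP floor_closure); rewrite in_fib jS orbT.
Qed.

Lemma cover_base : pi i \in cover.
Proof. by have := base_closure; rewrite closure_cover in_fib (negPf iS) orbF. Qed.

Lemma floor_cover : floor K i \subset cover.
Proof.
apply/subsetP => e eF; rewrite inE; apply/subsetP => k; rewrite fiberP => /eqP ke.
by apply: (subsetP floor_closure); rewrite in_fib ke eF.
Qed.

Lemma cover_min F : flat r (fib F S) -> pi i \in F -> floor K i \subset F ->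
  cover \subset F.
Proof.
move=> fF iF flF; have CF : C \subset fib F S.
  by apply: closure_min => //; rewrite subUset sub1set in_fib iF fib_subset.
apply/subsetP => e; rewrite inE => /subsetP eC.
have [j je jS] := ok_fiber okS e.
have := subsetP CF j (eC j _); rewrite in_fib (negPf jS) orbF je; apply.
by rewrite !inE je.
Qed.

(** [j] has the class of [i] but lies outside the closure, so [cover] is proper and new. It fits in
    the chain between the floor and the members containing [pi i]. *)
Lemma cover_ok : (exists2 j, j \notin C &
    j \notin S /\ forall F, F \in K -> (pi i \in F) = (pi j \in F)) ->
  nested_ok r pi S (cover |: K) /\ cover \notin K.
Proof.
move=> [j jC [jS ij]]; have jF : pi j \notin cover.
  apply: contra jC; rewrite inE => /subsetP; apply; by rewrite !inE.
split; last first.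
  by apply/negP => /ij; rewrite cover_base (negPf jF).
apply/nested_okP; split.
- exact: (ok_fiber okS).
- have ch F : F \in K -> F \subset cover \/ cover \subset F.
    move=> FK; have [iF|iF] := boolP (pi i \in F).
      by right; apply: cover_min => //; [exact: (ok_flat okS)|exact: floor_sub].
    by left; apply: subset_trans floor_cover; apply: floor_max.
  move=> F G; rewrite !in_setU1 => /predU1P[->|FK] /predU1P[->|GK].
  + by left.
  + by have [] := ch G GK; [right|left].
  + exact: ch.
  + exact: (ok_chain okS).
- move=> F; rewrite in_setU1 => /predU1P[->|]; last exact: (ok_proper okS).
  split; first by apply/set0Pn; exists (pi i); apply: cover_base.
  by apply: contraNneq jF => ->; rewrite in_setT.
- exact: (ok_flat0 okS).
- move=> F; rewrite in_setU1 => /predU1P[->|]; last exact: (ok_flat okS).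
  by rewrite -closure_cover; apply: closure_flat.
Qed.

End Floor.

(** * The nested complex of a rank function symmetric along fibres *)

Section Nested.
Variables (W : finType) (h : W -> T + {set E}) (Delta : {set {set W}}).
Hypotheses (pi_surj : forall e, exists i, pi i = e) (x0 : T)
  (loopless0 : flat r set0) (h_inj : injective h)
  (h_vertex : forall w, [set w] \in Delta)
  (h_inl : forall i, ok [set i] set0 -> exists w, h w = inl i)
  (h_inr : forall F, ok set0 [set F] -> exists w, h w = inr F)
  (DeltaE : forall s, (s \in Delta) = ok (points_of h s) (chain_of h s)).
Implicit Types (s : {set W}) (w a : W) (i j : T).

Local Notation g w := (ray_set pi (h w)).
Local Notation gf := (fun w => ray_set pi (h w)).
Local Notation pts s := (points_of h s).
Local Notation chn s := (chain_of h s).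
Local Notation link := (link Delta).

Lemma spec s : s \in Delta -> Spec (pts s) (chn s).
Proof. by rewrite DeltaE => /nested_okP. Qed.

Lemma in_ray_inr i w F : h w = inr F -> (i \in g w) = (pi i \in F).
Proof. by move=> ->; rewrite inE. Qed.

Lemma in_ray_inl i w j : h w = inl j -> (i \in g w) = (i == j).
Proof. by move=> ->; rewrite in_set1. Qed.

Lemma clsFP s i j : i \notin pts s -> reflect
  (j \notin pts s /\ forall F, F \in chn s -> (pi i \in F) = (pi j \in F))
  (j \in cls gf s i).
Proof.
move=> iS; apply: (iffP (clsP _ _ _ _)) => [ij|[jS ij] w ws].
  split=> [|F /chainP[w ws hw]]; last by have := ij w ws; rewrite !(in_ray_inr _ hw).
  apply/pointsP => -[w ws hw]; have := ij w ws; rewrite !(in_ray_inl _ hw) eqxx.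
  move=> /eqP ji; case/pointsP: iS; by exists w; rewrite ?ji.
case hw : (h w) => [k|F]; last first.
  by rewrite -hw !(in_ray_inr _ hw) ij//; apply/chainP; exists w.
rewrite -hw !(in_ray_inl _ hw); apply/eqP/eqP => kE.
  by case/pointsP: iS; exists w; rewrite ?kE.
by case/pointsP: jS; exists w; rewrite ?kE.
Qed.

Lemma splits_notin s w i : splits gf w (cls gf s i) -> i \notin pts s.
Proof.
move=> /splitsP[j [jC jw] [k kC kw]]; apply/pointsP => -[v vs hv].
have all l : l \in cls gf s i -> l = i.
  by move=> /clsP/(_ v vs); rewrite !(in_ray_inl _ hv) eqxx => /esym/eqP.
by case/negP: kw; rewrite (all k)// -(all j).
Qed.

Lemma cls_notin s i j : i \notin pts s -> j \in cls gf s i -> j \notin pts s.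
Proof. by move=> iS /(clsFP _ iS)[]. Qed.

Lemma add_inl s w i : h w = inl i -> (w |: s \in Delta) = ok (i |: pts s) (chn s).
Proof. by move=> hw; rewrite DeltaE (points_inl _ hw) (chain_inl _ hw). Qed.

Lemma add_inr s w F : h w = inr F -> (w |: s \in Delta) = ok (pts s) (F |: chn s).
Proof. by move=> hw; rewrite DeltaE (points_inr _ hw) (chain_inr _ hw). Qed.

Lemma link_point s i : i \notin pts s -> ok (i |: pts s) (chn s) ->
  exists2 w, w \in link s & h w = inl i.
Proof.
move=> iS hi; have [|w hw] := h_inl (i := i).
  by apply: ok_sub hi; rewrite ?sub0set ?sub1set ?setU11.
exists w => //; rewrite linkE (add_inl _ hw) hi andbT.
by apply: contra iS => ws; apply/pointsP; exists w.
Qed.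

Lemma link_chain s F : F \notin chn s -> ok (pts s) (F |: chn s) ->
  exists2 w, w \in link s & h w = inr F.
Proof.
move=> FK hF; have [|w hw] := h_inr (F := F).
  by apply: ok_sub hF; rewrite ?sub0set ?sub1set ?setU11.
exists w => //; rewrite linkE (add_inr _ hw) hF andbT.
by apply: contra FK => ws; apply/chainP; exists w.
Qed.

Local Notation lo s i := (fib (floor (chn s) i) (pts s)).

Lemma mate s i : s \in Delta -> exists2 j, pi j = pi i & j \notin pts s.
Proof. by move=> /spec/ok_fiber/(_ (pi i)). Qed.

Lemma ok_mate_neq s i : ok (i |: pts s) (chn s) ->
  exists2 j, pi i = pi j & j \notin i |: pts s.
Proof. by move=> /nested_okP/ok_fiber/(_ (pi i))[j ji jS]; exists j. Qed.

Lemma floor_ray s i w F y : s \in Delta -> i \notin pts s -> w \in link s ->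
  h w = inr F -> y \in cls gf s i -> pi y \in F -> floor (chn s) i \subset F.
Proof.
move=> sD iS /in_link + hw yC yF; rewrite (add_inr _ hw) => /nested_okP okF.
have [yS iy] := clsFP _ iS yC; apply: (floor_min yF) => [G GK|G GK].
  by rewrite iy.
by apply: (ok_chain okF); rewrite in_setU1 ?eqxx ?GK ?orbT.
Qed.

Lemma flat_link s w F : w \in link s -> h w = inr F -> flat r (fib F (pts s)).
Proof.
move=> /in_link + hw; rewrite (add_inr _ hw) => /nested_okP okF.
by apply: (ok_flat okF); apply: setU11.
Qed.

Lemma flat_link_point s w i j : s \in Delta -> w \in link s -> h w = inl j ->
  i \notin pts s -> j \in cls gf s i -> flat r (j |: lo s i).
Proof.
move=> sD wl hw iS jC; move/in_link: wl; rewrite (add_inl _ hw) => /nested_okP okj.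
have := chain_bigcup (fun F => pi i \notin F) (spec sD); rewrite -/(floor _ i).
rewrite -fib_pointC; case=> [[FK _]|->]; first exact: (ok_flat okj).
by rewrite preimset0 set0U; apply: ok_flat0 okj.
Qed.

(** The atom is the point [i] if it can be added, and otherwise the chain member [cover]. In the
    second case a ray through a point [y] of the cover contains the closure generated by [y], which
    is the one generated by [i]. *)
Lemma atom_build s i : s \in Delta -> i \notin pts s ->
  ok (i |: pts s) (chn s) \/
  (exists2 j, j \in cls gf s i & j \notin closure r (i |: lo s i)) ->
  exists2 a, atom gf Delta s (cls gf s i) a & i \in g a.
Proof.
move=> sD iS; have okS := spec sD.
have [oki _|nok [|[j jC jW]]] := boolP (ok (i |: pts s) (chn s)); last 1 first.
- have [jS ij] := clsFP _ iS jC.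
  have [okc cK] : ok (pts s) (cover (pts s) (chn s) i |: chn s) /\
      cover (pts s) (chn s) i \notin chn s.
    by apply: cover_ok => //; exists j.
  have [a al ha] := link_chain cK okc; have ic := cover_base okS iS nok.
  have CE := closure_cover okS iS nok.
  exists a; last by rewrite (in_ray_inr _ ha).
  rewrite /atom al /=; apply/andP; split.
    apply/splitsP; exists i; first by rewrite (in_ray_inr _ ha) ic cls_refl.
    exists j => //; rewrite (in_ray_inr _ ha).
    by apply: contra jW; rewrite CE in_fib => ->.
  apply/forall_inP => w wl; apply/implyP => wi; apply/implyP => /set0Pn[y].
  rewrite !in_setI (in_ray_inr _ ha) => /andP[/andP[yC yc] yw].
  have [yS iy] := clsFP _ iS yC.
  have yW : y \in closure r (i |: lo s i) by rewrite CE in_fib yc.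
  have ylo : y \notin lo s i.
    rewrite in_fib negb_or yS andbT; apply/bigcupP => -[F /andP[FK]].
    by rewrite iy// => /negP.
  case hw : (h w) => [k|F].
    move: yw; rewrite (in_ray_inl _ hw) => /eqP yk; rewrite -yk in hw.
    have yi : y = i.
      by apply: (closure_point okS iS) => //; apply: flat_link_point hw iS yC.
    by move/in_link: wl nok; rewrite (add_inl _ hw) yi => ->.
  rewrite (in_ray_inr _ hw) in yw.
  have flF := floor_ray sD iS wl hw yC yw; have fF := flat_link wl hw.
  have iF : pi i \in F.
    have : closure r (i |: lo s i) \subset fib F (pts s).
      rewrite -(closure_exchange_eq rP r1 yW (floor_flat _ okS) (floor_base _ iS) ylo).
      by apply: closure_min => //; rewrite subUset sub1set in_fib yw fib_subset.
    by move/subsetP/(_ i (base_closure _ _ _)); rewrite in_fib (negPf iS) orbF.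
  have cF : cover (pts s) (chn s) i \subset F by apply: cover_min.
  apply/andP; split.
    apply/subsetP => l; rewrite in_setI /= (in_ray_inr _ ha) => /andP[_ lc].
    by rewrite inE (subsetP cF).
  apply/orP; right; rewrite (add_inr _ hw) (points_inr _ ha) (chain_inr _ ha).
  by apply: ok_add_chain => //; rewrite -(add_inr _ hw); apply: in_link.
- have [a al ha] := link_point iS oki; have [j ij jS] := ok_mate_neq oki.
  have jC : j \in cls gf s i.
    apply/clsFP => //; split=> [|F _]; last by rewrite ij.
    by move: jS; rewrite in_setU1 negb_or => /andP[].
  exists a; last by rewrite (in_ray_inl _ ha).
  rewrite /atom al/=; apply/andP; split.
    apply/splitsP; exists i; first by rewrite (in_ray_inl _ ha) eqxx cls_refl.
    exists j => //; rewrite (in_ray_inl _ ha).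
    by move: jS; rewrite in_setU1 negb_or => /andP[].
  apply/forall_inP => w wl; apply/implyP => wi; apply/implyP => /set0Pn[y].
  rewrite !in_setI (in_ray_inl _ ha) => /andP[/andP[_ /eqP->] iw]; apply/andP; split.
    by apply/subsetP => l; rewrite in_setI /= (in_ray_inl _ ha) => /andP[_ /eqP->].
  case hw : (h w) => [k|F].
    move: iw; rewrite (in_ray_inl _ hw) => /eqP ik.
    by apply/orP; left; apply/eqP/h_inj; rewrite hw ha ik.
  apply/orP; right; rewrite (add_inr _ hw) (points_inl _ ha) (chain_inl _ ha).
  apply: ok_add_mixed => //; first by rewrite -(add_inr _ hw); apply: in_link.
  by rewrite -(in_ray_inr _ hw) iw.
- by [].
Qed.

(** A single point allowed as a cone never fills its fibre, so it is not a union of fibres. *)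
Lemma ray_inj : injective gf.
Proof.
move=> w w' /= e; apply: h_inj; move: e (h_vertex w) (h_vertex w').
have mixed v v' i F : h v = inl i -> h v' = inr F -> g v = g v' -> False.
  move=> hv hv' e; have [j ji jS] := mate i (h_vertex v).
  have : i \in g v' by rewrite -e hv in_set1.
  rewrite (in_ray_inr _ hv') -ji -(in_ray_inr _ hv') -e hv in_set1 => /eqP jE.
  by case/pointsP: jS; exists v; rewrite ?in_set1 ?jE.
case hw : (h w) => [i|F]; case hw' : (h w') => [i'|F'] //= e _ _.
- by move/set1_inj: e => ->.
- by case: (mixed _ _ _ _ hw hw'); rewrite hw hw'.
- by case: (mixed _ _ _ _ hw' hw); rewrite hw hw'.
- congr inr; apply/setP => a; have [i <-] := pi_surj a.
  by move/setP/(_ i): e; rewrite !inE.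
Qed.

Lemma nested_point s w : s \in Delta ->
  exists2 i, i \in g w & forall v, v \in s -> i \in g v -> g w \subset g v.
Proof.
move=> sD; case hw : (h w) => [i|F].
  by exists i => [|v _ iv]; rewrite ?in_set1//= sub1set.
have [F0 _] : F != set0 /\ F != setT.
  by apply: (ok_proper (spec (h_vertex w))); apply/chainP; exists w; rewrite ?in_set1.
have okS := spec sD.
(* The union of the members not containing [F] is such a member itself or empty, so one element of
   [F] escapes all of them. *)
have := chain_bigcup (fun G => ~~ (F \subset G)) okS.
set B := (\bigcup_(_ in _ | _) _) => hB.
have [e eF eB] : exists2 e, e \in F & e \notin B.
  case: hB => [[_ /subsetPn]|->]//; have [e eF] := set0Pn _ F0.
  by exists e; rewrite ?in_set0.
have [i ie iS] := ok_fiber okS e; exists i => [|v vs]; first by rewrite inE ie.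
case hv : (h v) => [k|G] /=.
  by rewrite in_set1 => /eqP ik; case/pointsP: iS; exists v; rewrite ?ik.
rewrite inE ie => eG; apply: preimsetS; apply: contraNT eB => FG.
by apply/bigcupP; exists G; rewrite ?FG// andbT; apply/chainP; exists v.
Qed.

Lemma nested_free s : s \in Delta -> exists i, forall v, v \in s -> i \notin g v.
Proof.
move=> sD; have okS := spec sD; have := chain_bigcup predT okS.
set B := (\bigcup_(_ in _ | _) _) => hB.
have [e eB] : exists e, e \notin B.
  case: hB => [[BK _]|->]; last by exists (pi x0); rewrite in_set0.
  have [_ BT] := ok_proper okS BK.
  by move: BT; rewrite -subTset => /subsetPn[e _ eB]; exists e.
have [i ie iS] := ok_fiber okS e; exists i => v vs; case hv : (h v) => [k|G] /=.
  by rewrite in_set1; apply: contra iS => /eqP->; apply/pointsP; exists v.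
rewrite inE ie; apply: contra eB => eG; apply/bigcupP; exists G => //.
by rewrite andbT; apply/chainP; exists v.
Qed.

Lemma nested_laminar s v w : s \in Delta -> v \in s -> w \in s ->
  [|| g v \subset g w, g w \subset g v | [disjoint g v & g w]].
Proof.
have pt i (A : {set T}) : (i \in A) || [disjoint [set i] & A].
  by case: (boolP (i \in A)) => // iA; rewrite disjoints1.
move=> sD vs ws; case hv : (h v) => [i|F] /=.
  by have /orP[iw|->] := pt i (g w); rewrite ?sub1set ?iw ?orbT.
case hw : (h w) => [i|G] /=.
  have /orP[iw|] := pt i (pi @^-1: F); first by rewrite sub1set iw orbT.
  by rewrite disjoint_sym => ->; rewrite !orbT.
have [||FG|GF] := ok_chain (spec sD) (F := F) (G := G).
- by apply/chainP; exists v.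
- by apply/chainP; exists w.
- by rewrite preimsetS.
- by rewrite [X in _ || (X || _)]preimsetS ?orbT.
Qed.

(** If [i] cannot be added as a point, [w] yields a point of the class outside the closure. If [w]
    contains [i], it contains the whole closure, and a point outside [w] will do; otherwise a point
    inside [w] will, as it would else generate the closure of [i]. *)
Lemma nested_atom s i w : s \in Delta -> w \in link s ->
  splits gf w (cls gf s i) -> exists2 a, atom gf Delta s (cls gf s i) a & i \in g a.
Proof.
move=> sD wl wi; have iS := splits_notin wi; have okS := spec sD.
apply: atom_build => //; have [oki|nok] := boolP (ok (i |: pts s) (chn s)); first by left.
right; have [y [yC yw] [z zC zw]] := splitsP _ _ _ _ wi.
have ylo j : j \in cls gf s i -> j \notin lo s i.
  move=> jC; have [jS ij] := clsFP _ iS jC.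
  rewrite in_fib negb_or jS andbT; apply/bigcupP => -[F /andP[FK]].
  by rewrite ij// => /negP.
case hw : (h w) => [k|F].
  move: yw; rewrite (in_ray_inl _ hw) => /eqP yk; rewrite -yk in hw.
  have fy := flat_link_point sD wl hw iS yC.
  exists y => //; apply/negP => yW.
  have yi : y = i by apply: (closure_point okS iS); rewrite ?ylo.
  by move/in_link: wl nok; rewrite (add_inl _ hw) yi => ->.
rewrite (in_ray_inr _ hw) in yw.
have flF := floor_ray sD iS wl hw yC yw; have fF := flat_link wl hw.
have [iF|iF] := boolP (pi i \in F).
  exists z => //; apply: contra zw => zW.
  have : closure r (i |: lo s i) \subset fib F (pts s).
    by apply: closure_min => //; rewrite subUset sub1set in_fib iF fib_subset.
  by rewrite (in_ray_inr _ hw); move/subsetP/(_ z zW); rewrite in_fib (negPf (cls_notin iS zC)) orbF.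
exists y => //; apply: contra iF => yW.
have : closure r (i |: lo s i) \subset fib F (pts s).
  rewrite -(closure_exchange_eq rP r1 yW (floor_flat _ okS) (floor_base _ iS) (ylo y yC)).
  by apply: closure_min => //; rewrite subUset sub1set in_fib yw fib_subset.
by move/subsetP/(_ i (base_closure _ _ _)); rewrite in_fib (negPf iS) orbF.
Qed.

Lemma splits_point s w i j : h w = inl j -> splits gf w (cls gf s i) ->
  j \in cls gf s i.
Proof. by move=> hw /splitsP[k [kC]]; rewrite (in_ray_inl _ hw) => /eqP<-. Qed.

Lemma separated s i j : s \in Delta -> i \notin pts s -> j \notin pts s ->
  cls gf s i != cls gf s j ->
  exists2 F, F \in chn s & (pi i \in F) != (pi j \in F).
Proof.
move=> sD iS jS ij; apply/exists_inP; apply: contraNT ij => h'; rewrite -cls_eq.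
apply/clsFP => //; split=> // F FK; apply/eqP; apply: contraNT h' => FN.
by apply/exists_inP; exists F.
Qed.

(** A member [G] that separates the classes, with [pi i] outside [F], lies above [F]: inside [F] it
    would contain the whole class that [F] splits. *)
Lemma separated_above s i j w F : s \in Delta -> w \in link s -> h w = inr F ->
  splits gf w (cls gf s j) -> i \notin pts s -> cls gf s i != cls gf s j ->
  (pi i \in F) || [exists G in chn s, (F \subset G) && (pi i \notin G)].
Proof.
move=> sD wl hw wj iS ij; have [//|iF/=] := boolP (pi i \in F).
have jS := splits_notin wj; have [y [yC yw] _] := splitsP _ _ _ _ wj.
have yS := cls_notin jS yC; rewrite -(cls_in yC) in ij.
rewrite (in_ray_inr _ hw) in yw.
have [G GK Gij] := separated sD iS yS ij; apply/exists_inP; exists G => //.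
have := in_link wl; rewrite (add_inr _ hw) => /nested_okP okF.
have [||FG|GF] := ok_chain okF (F := F) (G := G); rewrite ?in_setU1 ?eqxx ?GK ?orbT//.
  by rewrite FG; move: Gij; rewrite (subsetP FG _ yw); case: (_ \in G).
have iG : pi i \notin G by apply: contra iF; apply: (subsetP GF).
have [_ _ [z]] := splitsP _ _ _ _ wj.
rewrite -(cls_in yC) => /(clsFP _ yS)[_ yz]; case/negP.
rewrite (in_ray_inr _ hw); apply: (subsetP GF); rewrite -yz//.
by move: Gij; rewrite (negPf iG); case: (_ \in G).
Qed.

Lemma nested_indep s i j w v : s \in Delta -> w \in link s -> v \in link s ->
  splits gf w (cls gf s i) -> splits gf v (cls gf s j) ->
  cls gf s i != cls gf s j -> v |: (w |: s) \in Delta.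
Proof.
move=> sD wl vl wi vj ij.
have mixed a b k F k0 j0 : h a = inl k -> h b = inr F -> a \in link s ->
    b \in link s -> splits gf a (cls gf s k0) -> splits gf b (cls gf s j0) ->
    cls gf s k0 != cls gf s j0 -> b |: (a |: s) \in Delta.
  move=> ha hb al bl ak bj kj; have kC := splits_point ha ak.
  have kS := cls_notin (splits_notin ak) kC.
  rewrite (add_inr _ hb) (points_inl _ ha) (chain_inl _ ha).
  apply: ok_add_mixed => //; rewrite -?(add_inl _ ha) -?(add_inr _ hb) ?in_link//.
  by apply: separated_above hb bj kS _ => //; rewrite (cls_in kC).
case hw : (h w) => [k|F]; case hv : (h v) => [l|G].
- have kC := splits_point hw wi; have lC := splits_point hv vj.
  have kS := cls_notin (splits_notin wi) kC; have lS := cls_notin (splits_notin vj) lC.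
  have [|G GK] := separated sD kS lS; first by rewrite (cls_in kC) (cls_in lC).
  rewrite (add_inl _ hv) (points_inl _ hw) (chain_inl _ hw).
  have okw : ok (k |: pts s) (chn s) by rewrite -(add_inl _ hw) in_link.
  have okv : ok (l |: pts s) (chn s) by rewrite -(add_inl _ hv) in_link.
  have [kG|kG] := boolP (pi k \in G) => lG.
    by apply: (ok_add_points okw okv kS lS GK kG); case: (_ \in G) lG.
  rewrite setUCA; apply: (ok_add_points okv okw lS kS GK _ kG).
  by case: (_ \in G) lG.
- exact: (mixed _ _ _ _ _ _ hw hv wl vl wi vj ij).
- by rewrite setUCA; apply: (mixed _ _ _ _ _ _ hv hw vl wl vj wi); rewrite eq_sym.
- have okw : ok (pts s) (F |: chn s) by rewrite -(add_inr _ hw) in_link.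
  have okv : ok (pts s) (G |: chn s) by rewrite -(add_inr _ hv) in_link.
  have [y [yC yw] _] := splitsP _ _ _ _ wi.
  have [z [zC zv] _] := splitsP _ _ _ _ vj.
  have yS := cls_notin (splits_notin wi) yC; have zS := cls_notin (splits_notin vj) zC.
  (* Unless an existing member settles the order, each set contains the chosen point of the other.
     But a member [H] separating these points contains whichever of [F] and [G] splits the class
     inside [H], hence both points. *)
  have FG : F \subset G \/ G \subset F.
    have := separated_above sD wl hw wi zS _; rewrite (cls_in zC) eq_sym => /(_ ij).
    have := separated_above sD vl hv vj yS _; rewrite (cls_in yC) => /(_ ij).
    case/orP=> [yG|/exists_inP[G1 G1K /andP[GG1 yG1]]]; last first.
      case/nested_okP: (okw) => _ ch _ _ _.
      have [||h1|h1] := ch F G1; rewrite ?in_setU1 ?eqxx ?G1K ?orbT//.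
        by case/negP: yG1; apply: (subsetP h1); rewrite -(in_ray_inr _ hw).
      by right; apply: subset_trans GG1 h1.
    case/orP=> [zF|/exists_inP[F1 F1K /andP[FF1 zF1]]]; last first.
      case/nested_okP: (okv) => _ ch _ _ _.
      have [||h1|h1] := ch G F1; rewrite ?in_setU1 ?eqxx ?F1K ?orbT//.
        by case/negP: zF1; apply: (subsetP h1); rewrite -(in_ray_inr _ hv).
      by left; apply: subset_trans FF1 h1.
    have [|H HK yzH] := separated sD yS zS; first by rewrite (cls_in yC) (cls_in zC).
    have sub F' w' i' y' : w' \in link s -> h w' = inr F' -> splits gf w' (cls gf s i') ->
        y' \in cls gf s i' -> pi y' \in F' -> pi y' \in H -> F' \subset H.
      move=> wl' hw' wi' yC' yF' yH'; have := in_link wl'.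
      rewrite (add_inr _ hw') => /nested_okP[_ ch _ _ _].
      have [||//|HF] := ch F' H; rewrite ?in_setU1 ?eqxx ?HK ?orbT//.
      have [_ _ [x xC]] := splitsP _ _ _ _ wi'.
      have yS' := cls_notin (splits_notin wi') yC'.
      move: xC; rewrite -(cls_in yC') => /(clsFP _ yS')[_ e].
      by rewrite (in_ray_inr _ hw') (subsetP HF)// -e.
    rewrite (in_ray_inr _ hw) in yw; rewrite (in_ray_inr _ hv) in zv.
    have [yH|yH] := boolP (pi y \in H).
      have FH := sub F w i y wl hw wi yC yw yH.
      by move: yzH; rewrite yH (subsetP FH _ zF).
    have [zH|zH] := boolP (pi z \in H); last by rewrite (negPf yH) (negPf zH) in yzH.
    have GH := sub G v j z vl hv vj zC zv zH.
    by rewrite (subsetP GH _ yG) in yH.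
  case: FG => FG.
    by rewrite (add_inr _ hv) (points_inr _ hw) (chain_inr _ hw); apply: ok_add_chain.
  rewrite setUCA (add_inr _ hw) (points_inr _ hv) (chain_inr _ hv).
  exact: ok_add_chain.
Qed.

(** * Dimension and purity by counting ranks *)

Local Notation chnT s := (setT |: chn s).
Definition below s F := \bigcup_(G in chn s | G \proper F) G.
Definition height s F := #|[set G in chnT s | G \subset F]|.

Lemma in_height s F G :
  (G \in [set G in chnT s | G \subset F]) = (G \in chnT s) && (G \subset F).
Proof. by rewrite inE. Qed.

Lemma below_proper s F : s \in Delta -> F != set0 ->
  (below s F \in chn s \/ below s F = set0) /\ below s F \proper F.
Proof.
move=> sD F0; have := chain_bigcup (fun G => G \proper F) (spec sD).
rewrite -/(below s F) => -[[BK BF]|->]; first by split; [left|].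
by split; [right|rewrite proper0].
Qed.

Lemma chnT_sub s F G : s \in Delta -> F \in chnT s -> G \in chn s ->
  F \subset G \/ G \subset F.
Proof.
move=> sD; rewrite in_setU1 => /predU1P[-> _|FK GK]; first by right; apply: subsetT.
exact: (ok_chain (spec sD)).
Qed.

Lemma height_below s F : s \in Delta -> F \in chnT s -> F != set0 ->
  height s F = (height s (below s F)).+1.
Proof.
move=> sD FK F0; have [_ BF] := below_proper sD F0.
rewrite /height (cardsD1 F) in_height FK subxx add1n; congr _.+1.
apply: eq_card => G; rewrite in_setD1 !in_height; apply/and3P/andP => [[GF GK GsF]|[GK GB]].
  have GK' : G \in chn s.
    move: GK; rewrite in_setU1 => /predU1P[GT|//]; move: GF GsF.
    by rewrite GT subTset eq_sym => /negbTE->.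
  by split=> //; apply: bigcup_sup; rewrite GK' properEneq GF GsF.
have GF := sub_proper_trans GB BF.
by split=> //; [exact: proper_neq|exact: proper_sub].
Qed.

Lemma new_point s F : s \in Delta -> F \in chnT s -> F != set0 ->
  exists j, [/\ j \notin pts s, pi j \in F, pi j \notin below s F &
    floor (chn s) j = below s F].
Proof.
move=> sD FK F0; have [_ /properP[BF [e eF eB]]] := below_proper sD F0.
have [j je jS] := ok_fiber (spec sD) e; exists j; rewrite je; split=> //.
apply: eq_bigl => G; rewrite je; apply/andb_id2l => GK.
have [FG|GF] := chnT_sub sD FK GK.
  by rewrite (subsetP FG)// properE FG andbF.
apply/idP/idP => [eG|GpF]; last by apply: contra eB => eG; apply/bigcupP; exists G; rewrite ?GK.
by rewrite properE GF; apply: contra eG => FG; apply: (subsetP FG).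
Qed.

Lemma flat_base s F : s \in Delta -> F \in chn s \/ F = set0 -> flat r (fib F (pts s)).
Proof.
move=> sD [FK|->]; first exact: (ok_flat (spec sD)).
by rewrite preimset0 set0U; apply: (ok_flat0 (spec sD)).
Qed.

(** The points are independent, and every step up the chain raises the rank. If a step raised it by
    more than one, the closure of one new point would miss another point of its class, and an atom
    could be added to the cone. *)
Lemma rank_height s F : s \in Delta -> F \in chnT s \/ F = set0 ->
  #|pts s| + height s F <= r (fib F (pts s)) /\
  ((forall w, w \notin link s) -> r (fib F (pts s)) = #|pts s| + height s F).
Proof.
move=> sD; have okS := spec sD; move: {2}#|F|.+1 (ltnSn #|F|) => m.
elim: m F => // m IH F Fm hF; have [F0|F0] := eqVneq F set0.
  have -> : height s F = 0.
    apply: eq_card0 => G; rewrite in_height in_setU1; apply/negbTE; rewrite negb_and negb_or.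
    rewrite F0 subset0; have [->|] := eqVneq G set0; last by rewrite orbT.
    rewrite orbF; apply/andP; split.
      by apply/negP => /eqP/setP/(_ (pi x0)); rewrite in_set0 in_setT.
    apply/negP => /chainP[w ws hw]; have [|] := ok_proper okS (F := set0).
      by apply/chainP; exists w.
    by rewrite eqxx.
  have e : r (pts s) = #|pts s|.
    have [r0 _ _] := rP; apply: (independent_rank rP r1 pi_sym) => //.
      exact: ok_flat0 okS.
    by move=> x _; have [y yx yS] := mate x sD; exists y.
  by rewrite F0 preimset0 set0U e addn0.
have FK : F \in chnT s by case: hF F0 => // ->; rewrite eqxx.
have [hB BF] := below_proper sD F0.
have [||IH1 IH2] := IH (below s F).
- by apply: leq_trans (proper_card BF) _.
- by case: hB => [BK|->]; [left; rewrite in_setU1 BK orbT|right].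
have [j [jS jF jB jfl]] := new_point sD FK F0.
have fB := flat_base sD hB.
have jA : j \notin fib (below s F) (pts s) by rewrite in_fib negb_or jB.
have h1 := flat_incr rP fB (subxx _) jA.
have h2 : r (j |: fib (below s F) (pts s)) <= r (fib F (pts s)).
  apply: rank_mono => //; rewrite subUset sub1set in_fib jF.
  by rewrite fib_subset// proper_sub.
rewrite height_below// addnS; split.
  by rewrite (leq_ltn_trans IH1)// (leq_trans h1).
move=> nolink; rewrite -IH2//; apply/eqP; rewrite eqn_leq (leq_trans h1 h2) andbT.
apply: leq_trans (r1 j _); set C := j |: _; rewrite -(rank_closure rP (sub_closure r C) (subxx _)).
apply: rank_mono => //; apply/subsetP => k kF; apply/negPn/negP => kC.
have kA : k \notin fib (below s F) (pts s).
  apply: contra kC => kA; apply: (subsetP (sub_closure _ _)).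
  by rewrite /C in_setU1 kA orbT.
have [kB kS] : pi k \notin below s F /\ k \notin pts s.
  by apply/andP; move: kA; rewrite in_fib negb_or.
have kF' : pi k \in F by move: kF; rewrite in_fib (negPf kS) orbF.
have [|a ha _] := @atom_build s j sD jS; last first.
  by have := nolink a; rewrite (atom_link ha).
right; exists k; last by rewrite jfl.
apply/clsFP => //; split=> // G GK; have [FG|GF] := chnT_sub sD FK GK.
  by rewrite !(subsetP FG).
have [GE|GN] := eqVneq G F; first by rewrite GE jF kF'.
have GB : G \subset below s F by apply: bigcup_sup; rewrite GK properEneq GN.
by apply/idP/idP => /(subsetP GB) h'; [rewrite h' in jB|rewrite h' in kB].
Qed.

Lemma height_setT s : s \in Delta -> height s setT = #|chn s|.+1.
Proof.
move=> sD; rewrite /height -[RHS]add1n -[1](_ : (setT \notin chn s : nat) = 1).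
  by rewrite -cardsU1; apply: eq_card => G; rewrite in_height subsetT andbT.
suff -> : setT \notin chn s by [].
by apply/negP => /(ok_proper (spec sD))[_]; rewrite eqxx.
Qed.

(** The whole set is the top step above the chain, whence the shift by one. *)
Lemma rank_setT s : s \in Delta -> #|s| < r setT /\
  ((forall w, w \notin link s) -> r setT = #|s|.+1).
Proof.
move=> sD; have [|h1 h2] := @rank_height s setT sD.
  by left; apply: setU11.
have e : fib setT (pts s) = setT by rewrite preimsetT setTU.
by move: h1 h2; rewrite e height_setT// (card_points_chain s h_inj) addnS.
Qed.

Theorem flats_nested : nested_complex gf Delta (r setT).-1.
Proof.
split.
- rewrite DeltaE points0 chain0; apply/nested_okP; split.
  + by move=> e; have [i ie] := pi_surj e; exists i; rewrite ?in_set0.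
  + by move=> F G; rewrite in_set0.
  + by move=> F; rewrite in_set0.
  + exact: loopless0.
  + by move=> F; rewrite in_set0.
- move=> s t ts; rewrite !DeltaE; apply: ok_sub.
    exact: points_sub.
  exact: chain_sub.
- exact: h_vertex.
- exact: ray_inj.
- by move=> s w; apply: nested_point.
- exact: nested_free.
- exact: nested_laminar.
- exact: nested_atom.
- exact: nested_indep.
- by move=> s /rank_setT[]; lia.
- move=> s sD sn; have [_ h2] := rank_setT sD.
  have [w wl|no] := pickP (mem (link s)); first by exists w.
  by move: sn; rewrite h2 ?ltnn// => w; rewrite [_ \in _]no.
Qed.
End Nested.

End NestedFlats.

(** * The multisymmetric lift of a polymatroid *)

Section LiftRank.
Variables (E T : finType) (rk : {set E} -> nat) (pi : T -> E).
Hypotheses (rkP : polymatroid rk) (rk1 : forall e, 1 <= rk [set e]).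
Implicit Types (A : {set T}) (B : {set E}) (x y : T).
Local Notation r := (lift_rank rk pi).
Local Notation bound A B := (rk B + #|A :\: pi @^-1: B|).

Lemma lift_rank_le A B : r A <= bound A B.
Proof.
suff h (s : seq {set E}) : B \in s ->
    \big[minn/#|A|]_(B' <- s) bound A B' <= bound A B.
  exact/h/mem_index_enum.
elim: s => // B' s IH; rewrite inE big_cons => /predU1P[<-|/IH]; first exact: geq_minl.
exact/leq_trans/geq_minr.
Qed.

Lemma lift_rank_ex A : exists B, r A = bound A B.
Proof.
rewrite /lift_rank; apply: (big_ind (fun v => exists B, v = bound A B)).
- by exists set0; have [-> _ _] := rkP; rewrite preimset0 setD0.
- by move=> a b [B aE] [B' bE]; rewrite /minn; case: ifP => _; [exists B|exists B'].
- by move=> B _; exists B.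
Qed.

(** Submodularity by uncrossing: the minimizers of two sets are replaced by their union and
    intersection, and the cardinalities are compared point by point. *)
Lemma lift_rank_polymatroid : polymatroid r.
Proof.
have [rk0 rkm rks] := rkP; split.
- by apply/eqP; rewrite -leqn0; apply: leq_trans (lift_rank_le _ set0) _; rewrite rk0 set0D cards0.
- move=> A A' AA'; have [B ->] := lift_rank_ex A'.
  apply: leq_trans (lift_rank_le _ B) _; rewrite leq_add2l subset_leq_card//.
  exact: setSD.
move=> A A'; have [B ->] := lift_rank_ex A; have [B' ->] := lift_rank_ex A'.
apply: leq_trans (leq_add (lift_rank_le _ (B :|: B')) (lift_rank_le _ (B :&: B'))) _.
rewrite addnACA [X in _ <= X]addnACA leq_add//.
rewrite -!sum1_card ![\sum_(_ in _) 1]big_mkcond -!big_split/=; apply: leq_sum => x _.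
rewrite !inE; case: (x \in A); case: (x \in A'); case: (pi x \in B); by case: (pi x \in B').
Qed.

Lemma card_point_diff x A B : x \notin A ->
  #|(x |: A) :\: pi @^-1: B| = (pi x \notin B) + #|A :\: pi @^-1: B|.
Proof.
move=> xA; have [xB|xB] := boolP (pi x \in B).
  rewrite add0n; apply: eq_card => y; rewrite !inE; have [->|//] := eqVneq y x.
  by rewrite xB.
have -> : (x |: A) :\: pi @^-1: B = x |: (A :\: pi @^-1: B).
  by apply/setP => y; rewrite !inE; have [->|//] := eqVneq y x; rewrite xB.
by rewrite cardsU1 !inE (negPf xA) andbF.
Qed.

Lemma lift_rank_point x A : r (x |: A) <= (r A).+1.
Proof.
have [xA|xA] := boolP (x \in A).
  by rewrite (setUidPr _) ?leqnSn ?sub1set.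
have [B ->] := lift_rank_ex A; apply: leq_trans (lift_rank_le _ B) _.
by rewrite card_point_diff// -addnS leq_add2l -add1n leq_add2r leq_b1.
Qed.

Lemma lift_rank_sym x y A : pi x = pi y -> x \notin A -> y \notin A ->
  r (x |: A) = r (y |: A).
Proof.
suff h z w : pi z = pi w -> z \notin A -> w \notin A -> r (z |: A) <= r (w |: A).
  by move=> xy xA yA; apply/anti_leq; rewrite !h.
move=> zw zA wA; have [B ->] := lift_rank_ex (w |: A).
by apply: leq_trans (lift_rank_le _ B) _; rewrite !card_point_diff// zw.
Qed.

Lemma lift_rank_flat0 : flat r set0.
Proof.
apply/flatP => x _; have [-> _ _] := lift_rank_polymatroid.
have [B ->] := lift_rank_ex (x |: set0); rewrite card_point_diff ?in_set0// addn_gt0.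
have [xB|_] := boolP (pi x \in B); last by rewrite orbT.
have [_ rkm _] := rkP; apply/orP; left; apply: leq_trans (rk1 (pi x)) _.
by rewrite rkm// sub1set.
Qed.

Lemma cage_surjective : cage rk pi -> forall e, exists i, pi i = e.
Proof.
move=> cg e; have : 0 < #|pi @^-1: [set e]| := leq_trans (rk1 e) (cg e).
by rewrite card_gt0 => /set0Pn[i]; rewrite !inE => /eqP; exists i.
Qed.

End LiftRank.

From mathcomp Require Import all_classical all_reals topology normedtype.
Require Import Defs.
Import numFieldNormedType.Exports.

(** * Divisor classes and degree maps *)

Section Classes.
Local Open Scope classical_set_scope.
Local Open Scope quotient_scope.
Local Open Scope ring_scope.
Variables (R : realType) (U : vectType R) (Sigma : fan U).
Local Notation u := (@ray_vec _ _ Sigma).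
Local Notation D := (D Sigma).

Lemma pi_DD (phi psi : PL Sigma) : \pi_D (phi + psi) = \pi_D phi + \pi_D psi.
Proof. exact: pi_addr. Qed.

Lemma pi_DZ (a : R) (phi : PL Sigma) : \pi_D (a *: phi) = a *: \pi_D phi.
Proof. by rewrite -[RHS]/(quot_scale a _) pi_quot_scale. Qed.

Lemma PL_Z (a : R) (phi : PL Sigma) x : (a *: phi) x = a * phi x.
Proof. by []. Qed.

Lemma PL_sum (I : Type) (r : seq I) (Q : pred I) (f : I -> PL Sigma) x :
  (\sum_(i <- r | Q i) f i) x = \sum_(i <- r | Q i) (f i x).
Proof. by apply: (big_morph (fun phi : PL Sigma => phi x)). Qed.

Lemma pi_D_sum (I : Type) (r : seq I) (Q : pred I) (f : I -> PL Sigma) :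
  \pi_D (\sum_(i <- r | Q i) f i) = \sum_(i <- r | Q i) \pi_D (f i).
Proof.
apply: (big_morph (fun phi => \pi_D phi)) => [phi psi|]; first exact: pi_DD.
by rewrite -(scale0r 0) pi_DZ scale0r.
Qed.

Lemma pi_D_eq (phi psi : PL Sigma) : \pi_D phi = \pi_D psi <->
  exists v : 'Hom(U, R^o), forall x, support Sigma x -> phi x - psi x = v x.
Proof.
split=> [e|[v hv]].
  have /asboolP[v hv] : phi - psi \in @linear_on_support R U Sigma.
    rewrite -[_ \in _]/(_ \in quot_by (@linear_on_support R U Sigma)).
    by rewrite Quotient.idealrBE e.
  by exists v => x /hv <-.
apply/eqP; rewrite -Quotient.idealrBE -[_ \in _]/(_ \in @linear_on_support R U Sigma).
by apply/asboolP; exists v => x /hv <-.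
Qed.

(** The values depend on the representative chosen by [repr], so they matter only modulo
    [fan_linear]. *)
Definition coords (d : D) : {ffun ray Sigma -> R^o} :=
  [ffun w => (repr d : PL Sigma) (u w)].

Definition fan_linear (x : {ffun ray Sigma -> R^o}) : Prop :=
  exists v : 'Hom(U, R^o), forall w, x w = v (u w).

Lemma ray_cone (s : {set ray Sigma}) w : w \in s -> cone u s (u w).
Proof.
move=> ws; exists (fun i => (i == w)%:R) => [i|]; first exact: ler0n.
rewrite (bigD1 w)//= eqxx scale1r big1 ?addr0// => i /andP[_ /negPf->].
by rewrite scale0r.
Qed.

Lemma PL_cone (phi : PL Sigma) (s : {set ray Sigma}) (c : ray Sigma -> R) :
  s \in fan_cones Sigma -> (forall i, 0 <= c i) ->
  phi (\sum_(i in s) c i *: u i) = \sum_(i in s) c i * phi (u i).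
Proof.
case: phi => f /= fP sC c0; have /asboolP/(_ s sC)[v hv] := fP.
rewrite hv; last by exists c.
rewrite linear_sum; apply: eq_bigr => i si; rewrite linearZ/= hv//.
exact: ray_cone.
Qed.

Lemma pi_D_rays (phi psi : PL Sigma) :
  (exists v : 'Hom(U, R^o), forall w, phi (u w) - psi (u w) = v (u w)) ->
  \pi_D phi = \pi_D psi.
Proof.
case=> v hv; apply/pi_D_eq; exists v => _ [s sC [c c0 ->]].
rewrite !PL_cone// -sumrB linear_sum; apply: eq_bigr => i _.
by rewrite -mulrBr hv [RHS]linearZ.
Qed.

Hypothesis vertex : forall w, [set w]%SET \in fan_cones Sigma.

Lemma support_ray w : support Sigma (u w).
Proof. by exists [set w]%SET => //; apply: ray_cone; rewrite finset.inE. Qed.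

Lemma coords_pi (phi : PL Sigma) :
  exists v : 'Hom(U, R^o), forall w, coords (\pi_D phi) w = phi (u w) + v (u w).
Proof.
have /pi_D_eq[v hv] : \pi_D (repr (\pi_D phi : D)) = \pi_D phi :> D by rewrite reprK.
exists v => w; rewrite ffunE -(hv _ (support_ray w)).
by rewrite addrCA subrr addr0.
Qed.

Hypothesis courant : forall x : ray Sigma -> R,
  exists phi : PL Sigma, forall w, phi (u w) = x w.

Definition courant_fun i := xget 0 [set phi : PL Sigma |
  forall j, phi (u j) = (j == i)%:R].

Lemma courant_funE i j : courant_fun i (u j) = (j == i)%:R.
Proof.
have : exists phi : PL Sigma, forall j, phi (u j) = (j == i)%:R by exact: courant.
by move=> /(@xgetPex _ 0)/(_ j).
Qed.

Lemma courant_sum (c : ray Sigma -> R) w :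
  (\sum_i c i *: courant_fun i) (u w) = c w.
Proof.
rewrite PL_sum; under eq_bigr do rewrite PL_Z courant_funE.
rewrite (bigD1 w)//= eqxx mulr1 big1 ?addr0// => i iw.
by rewrite eq_sym (negPf iw) mulr0.
Qed.

Lemma D_sum_eq (d : D) (c : ray Sigma -> R) :
  (exists v : 'Hom(U, R^o), forall w, coords d w = c w + v (u w)) ->
  d = \sum_i c i *: D_ i.
Proof.
case=> v hv; rewrite -[LHS]reprK.
transitivity (\pi_D (\sum_i c i *: courant_fun i) : D); last first.
  by rewrite pi_D_sum; apply: eq_bigr => i _; rewrite pi_DZ.
apply: pi_D_rays; exists v => w; have := hv w; rewrite ffunE => ->.
by rewrite courant_sum addrAC subrr add0r.
Qed.

Lemma D_sum_coords (c : ray Sigma -> R) :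
  exists v : 'Hom(U, R^o), forall w, coords (\sum_i c i *: D_ i) w = c w + v (u w).
Proof.
have -> : \sum_i c i *: D_ i = \pi_D (\sum_i c i *: courant_fun i) :> D.
  by rewrite pi_D_sum; apply: eq_bigr => i _; rewrite pi_DZ.
have [v hv] := coords_pi (\sum_i c i *: courant_fun i).
by exists v => w; rewrite hv courant_sum.
Qed.

Lemma coords_D_ i : exists2 v, fan_linear v & coords (D_ i) = delta R i + v.
Proof.
have [v hv] := coords_pi (courant_fun i).
exists [ffun w => v (u w)]; first by exists v => w; rewrite ffunE.
by apply/ffunP => w; rewrite hv courant_funE !ffunE.
Qed.

Lemma nef_coords d : nef d -> nef_vec (fan_cones Sigma) fan_linear (coords d).
Proof.
move=> dn s sC; have [phi [<- phi0 phi_ge0]] := dn s sC.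
have [v hv] := coords_pi phi; exists [ffun w => - v (u w)]; split.
- by exists (- v) => w; rewrite ffunE opp_lfunE.
- by move=> w ws; rewrite hv ffunE addrK phi0//; apply: ray_cone.
- move=> w /linkP[_ wsC]; rewrite hv ffunE addrK.
  by apply: (phi_ge0 (w |: s)%SET) => //; [exact: finset.subsetUr|apply: ray_cone; exact: finset.setU11].
Qed.

(** An interior point of the cone stays in it when all its coordinates are lowered by [e / 2], so it
    has coefficients at least [e / 2]. *)
Lemma big_coords d : big d -> big_vec fan_linear (coords d).
Proof.
rewrite /big /interior nbhsE => -[B [Bo Bd] BD].
have [c _ dE] := BD _ Bd.
pose a : 'rV[R]_#|ray Sigma| := \row_i c (enum_val i).
have aE : D_of_coord a = d.
  by rewrite dE /D_of_coord; apply: eq_bigr => i _; rewrite mxE enum_rankK.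
have : nbhs a (@D_of_coord R U Sigma @^-1` B).
  by apply: open_nbhs_nbhs; split; [exact: Bo|rewrite /= aE].
move=> /nbhs_ballP[e /= e0 he].
pose b : 'rV[R]_#|ray Sigma| := \row_i (c (enum_val i) - e / 2).
have /he/BD[c' c'0 bE] : ball a e b.
  split=> // i j; rewrite !mxE /ball/= opprB addrCA subrr addr0.
  by rewrite gtr0_norm ?divr_gt0//; lra.
have dE' : d = \sum_i (c' i + e / 2) *: D_ i.
  under eq_bigr do rewrite scalerDl.
  rewrite big_split/= -bE /D_of_coord -big_split dE; apply: eq_bigr => i _ /=.
  by rewrite mxE enum_rankK -scalerDl subrK.
have [v hv] := D_sum_coords (fun i => c' i + e / 2).
exists [ffun w => - v (u w)]; first by exists (- v) => w; rewrite ffunE opp_lfunE.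
by move=> w; rewrite dE' hv ffunE addrK ltr_wpDl ?divr_gt0.
Qed.

(** * The degree functional on the Chow ring *)

Local Notation A := (A Sigma).
Local Notation poly := (poly_ring Sigma).

Lemma pi_AD (p p' : poly) : \pi_A (p + p') = \pi_A p + \pi_A p'.
Proof. exact: pi_addr. Qed.

Lemma pi_AZ (a : R) (p : poly) : \pi_A (a *: p) = a *: \pi_A p.
Proof. by rewrite -[RHS]/(quot_scale a _) pi_quot_scale. Qed.

Lemma pi_AM (p p' : poly) : \pi_A (p * p') = \pi_A p * \pi_A p'.
Proof. by rewrite -[RHS]/(A_mul _ _) pi_A_mul. Qed.

Lemma pi_A_sum (I : Type) (r : seq I) (Q : pred I) (f : I -> poly) :
  \pi_A (\sum_(i <- r | Q i) f i) = \sum_(i <- r | Q i) \pi_A (f i).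
Proof.
apply: (big_morph (fun p => \pi_A p)) => [p p'|]; first exact: pi_AD.
by rewrite -(scale0r 0) pi_AZ scale0r.
Qed.

Lemma pi_A_prod (I : Type) (r : seq I) (Q : pred I) (f : I -> poly) :
  \pi_A (\prod_(i <- r | Q i) f i) = \prod_(i <- r | Q i) \pi_A (f i).
Proof. by apply: (big_morph (fun p => \pi_A p)) => [p p'|//]; exact: pi_AM. Qed.

Lemma D_to_A_coords (d : D) : D_to_A d = \pi_A (cl (@X R U Sigma) (coords d)).
Proof.
rewrite /cl pi_A_sum; apply: eq_bigr => i _; rewrite pi_AZ.
by rewrite ffunE.
Qed.

Lemma pi_A0 : \pi_A 0 = 0 :> A.
Proof. by rewrite -(scale0r 0) pi_AZ scale0r. Qed.

Lemma pi_A_eq0 (p : poly) : p \in @chow_ideal R U Sigma -> \pi_A p = 0 :> A.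
Proof.
move=> hp; rewrite -[RHS]pi_A0.
apply/eqP; rewrite -Quotient.idealrBE -[_ \in _]/(_ \in @chow_ideal R U Sigma).
by rewrite subr0.
Qed.

Lemma chow_gen (p q : poly) :
  (@nonface_relations R U Sigma `|` @linear_relations R U Sigma) q -> p * q \in @chow_ideal R U Sigma.
Proof. by move=> hq; apply: chow_idealM; apply/asboolP => I [_]; apply. Qed.

Hypothesis extend : forall (s : {set ray Sigma}) (x : {ffun ray Sigma -> R^o}), s \in fan_cones Sigma ->
  exists2 v, fan_linear v & forall w, w \in s -> x w = v w.

(** The coordinate functions of the rays of [s] extend to linear functionals, which makes the ray
    vectors independent. *)
Lemma cone_dim_card s : s \in fan_cones Sigma -> cone_dim s = #|s|.
Proof.
move=> sC; pose t := [tuple u (enum_val i) | i < #|s|].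
have -> : cone_dim s = \dim <<t>>.
  congr (\dim _); rewrite span_def big_tuple big_enum_val.
  by apply: eq_bigr => i _; rewrite tnth_mktuple.
suff /eqP-> : free t by rewrite size_tuple.
have tE (i : 'I_#|s|) : t`_i = u (enum_val i) by rewrite -tnth_nth tnth_mktuple.
apply/freeP => k kt i; have [v [l vl] v1] := @extend s (delta R (enum_val i)) sC.
have lE j : l (u (enum_val j)) = (j == i)%:R.
  by rewrite -vl -v1 ?enum_valP// ffunE (inj_eq enum_val_inj).
have := congr1 l kt; rewrite linear0 linear_sum (bigD1 i)//= big1 ?addr0 => [|j ji].
  by rewrite tE linearZ/= lE eqxx [_ *: _]mulr1.
by rewrite tE linearZ/= lE (negPf ji) scaler0.
Qed.

Lemma fan_dim_card n' : lorentzian_complex (fan_cones Sigma) fan_linear n' ->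
  fan_dim Sigma = n'.
Proof.
move=> cx'; apply/anti_leq/andP; split.
  by apply/bigmax_leqP => t tC; rewrite cone_dim_card// (cx_dim cx').
case: (@arg_maxnP _ finset.set0 (fun s => s \in fan_cones Sigma) (fun s => #|s|)).
  exact: cx_empty cx'.
move=> s sC smax; rewrite leqNgt; apply/negP => sn.
have [|w wl] := cx_pure cx' sC.
  apply: leq_ltn_trans sn; rewrite -cone_dim_card//.
  exact: (leq_bigmax_cond (F := @cone_dim R U Sigma)).
have [ws wsC] := linkP wl; have := smax _ wsC.
by rewrite cardsU1 ws /= add1n ltnn.
Qed.

Variable n : nat.
Hypothesis cx : lorentzian_complex (fan_cones Sigma) fan_linear n.
Hypothesis dim_n : fan_dim Sigma = n.
Hypothesis weight1 : forall s : {set ray Sigma}, weight s = 1.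

Section DegreeMap.
Hypothesis degP : is_degree_map (@deg R U Sigma).

Definition degF (p : poly) : R := deg (\pi_A p).

Lemma degFD p p' : degF (p + p') = degF p + degF p'.
Proof.
have [lf _ _] := degP; rewrite /degF pi_AD.
by have := lf 1 (\pi_A p) (\pi_A p'); rewrite !scale1r.
Qed.

Lemma degFZ (a : R) p : degF (a *: p) = a * degF p.
Proof.
have [lf _ _] := degP; rewrite /degF pi_AZ.
have d0 : deg (0 : A) = 0.
  by have := lf (-1) 0 0; rewrite scaleN1r oppr0 addr0 scaleN1r addNr.
by have := lf a (\pi_A p) 0; rewrite addr0 d0 addr0.
Qed.

Lemma degF_ideal p : p \in @chow_ideal R U Sigma -> degF p = 0.
Proof.
move=> pI; rewrite /degF pi_A_eq0// -pi_A0.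
by have := degFZ 0 0; rewrite scale0r mul0r.
Qed.

Lemma degF_nonface s p : s \notin fan_cones Sigma ->
  degF (xs (@X R U Sigma) s * p) = 0.
Proof. by move=> sC; rewrite degF_ideal// mulrC; apply: chow_gen; left; exists s. Qed.

Lemma degF_lin v p : fan_linear v -> degF (p * cl (@X R U Sigma) v) = 0.
Proof.
move=> [l vl]; rewrite degF_ideal//; apply: chow_gen; right; exists l.
by rewrite /cl; apply: eq_bigr => i _; rewrite vl.
Qed.

Lemma degF_facet s : s \in fan_cones Sigma -> #|s| = n ->
  degF (xs (@X R U Sigma) s) = 1.
Proof.
move=> sC sn; have [_ h _] := degP; rewrite /degF /xs pi_A_prod h ?weight1//.
by rewrite cone_dim_card// dim_n.
Qed.

(** Modulo linear functions every vector of ray values comes from a divisor class, so testing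
    against classes or against vectors is the same. *)
Lemma ker_mixed_killed m (L : 'I_m -> D) d :
  ker_mixed L d <->
  killed (@X R U Sigma) degF [seq coords (L k) | k <- enum 'I_m] (coords d).
Proof.
have lsE x y : form (@X R U Sigma) degF finset.set0 [seq coords (L k) | k <- enum 'I_m] x y =
    deg ((\prod_(k < m) D_to_A (L k)) * \pi_A (cl (@X R U Sigma) x) * \pi_A (cl (@X R U Sigma) y)).
  rewrite /form /degF /xs big_set0 mul1r !pi_AM /pr big_map big_enum pi_A_prod.
  congr (deg (_ * _ * _)).
  by apply: eq_bigr => k _; rewrite D_to_A_coords.
split=> [h|/(killedP (@X R U Sigma) degFD degFZ _ _) h xi]; last by rewrite !D_to_A_coords -lsE.
apply/(killedP (@X R U Sigma) degFD degFZ _ _) => y; have [v hv] := D_sum_coords (fun w => y w).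
have := h (\sum_i (y i : R) *: D_ i); rewrite !D_to_A_coords -lsE => e.
pose v' : {ffun ray Sigma -> R^o} := [ffun w => v (u w)].
have lv : fan_linear v' by exists v => w; rewrite ffunE.
have : coords (\sum_i (y i : R) *: D_ i) = y + v'.
  by apply/ffunP => w; rewrite hv !ffunE.
have fb := form_bilinear (@X R U Sigma) degFD degFZ.
move: e => /[swap] ->; rewrite (sbDr (fb _ _)) (sbC (fb _ _) _ v').
by rewrite (form_lin degFD degFZ degF_lin _ _ _ lv) addr0.
Qed.

Lemma killed_addlin ls x v : fan_linear v ->
  killed (@X R U Sigma) degF ls (x + v) = killed (@X R U Sigma) degF ls x.
Proof.
move=> lv; apply: eq_forallb => w.
rewrite (sbDl (form_bilinear (@X R U Sigma) degFD degFZ _ _)).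
by rewrite (form_lin degFD degFZ degF_lin _ _ _ lv) addr0.
Qed.

Lemma ker_mixed_delta m (L : 'I_m -> D) i :
  `[< ker_mixed L (D_ i) >] =
  killed (@X R U Sigma) degF [seq coords (L k) | k <- enum 'I_m] (delta R i).
Proof.
have [v lv e] := coords_D_ i; rewrite -(killed_addlin _ _ lv) -e.
by apply/asboolP/idP => /ker_mixed_killed.
Qed.

Lemma ker_mixed_V_eff m (L : 'I_m -> D) : (m + 2)%N = n ->
  (forall k, big (L k) /\ nef (L k)) -> ker_mixed L = V_eff L.
Proof.
move=> mn hL; apply/seteqP; split=> d.
  move=> /ker_mixed_killed dk.
  have [||v [c [[l vl] dE]]] := good_kernel cx degFD degFZ degF_nonface degF_lin
    degF_facet _ _ dk.
  - by rewrite size_map size_enum_ord.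
  - move=> _ /mapP[k _ ->]; have [kb kn] := hL k.
    by split; [exact: nef_coords|exact: big_coords].
  exists c; rewrite big_mkcond/=; under eq_bigr => i _ do rewrite ker_mixed_delta.
  rewrite (@D_sum_eq d (fun i => if killed (@X R U Sigma) degF
      [seq coords (L k) | k <- enum 'I_m] (delta R i) then c i else 0)).
    by apply: eq_bigr => i _; case: ifP => // _; rewrite scale0r.
  exists l => w; rewrite dE ffunE vl addrC; congr (_ + _).
  rewrite sum_ffunE big_mkcond (bigD1 w)//= !ffunE eqxx big1 ?addr0 => [|i iw].
    by case: ifP => // _; rewrite [_ *: _]mulr1.
  by case: ifP => // _; rewrite !ffunE eq_sym (negPf iw) scaler0.
move=> [c dE]; apply/ker_mixed_killed; rewrite dE.
pose c' i := if `[< ker_mixed L (D_ i) >] then c i else 0.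
have -> : \sum_(i | `[< ker_mixed L (D_ i) >]) c i *: D_ i = \sum_i c' i *: D_ i.
  rewrite big_mkcond; apply: eq_bigr => i _; rewrite /c'.
  by case: ifP => // _; rewrite scale0r.
have [v hv] := D_sum_coords c'.
pose v' : {ffun ray Sigma -> R^o} := [ffun w => v (u w)].
have lv : fan_linear v' by exists v => w; rewrite ffunE.
have -> : coords (\sum_i c' i *: D_ i) = \sum_i c' i *: delta R i + v'.
  apply/ffunP => w; rewrite hv ffunE [v' w]ffunE; congr (_ + _).
  rewrite sum_ffunE (bigD1 w)//= !ffunE eqxx big1 ?addr0 => [|i iw].
    by rewrite [_ *: _]mulr1.
  by rewrite !ffunE eq_sym (negPf iw) scaler0.
rewrite killed_addlin//; apply/(killedP (@X R U Sigma) degFD degFZ _ _) => y.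
have fb := form_bilinear (@X R U Sigma) degFD degFZ.
rewrite (sb_suml (fb _ _)) big1// => i _; rewrite (sbZl (fb _ _)) /c'.
case: ifP => [|_]; last by rewrite mul0r.
by rewrite ker_mixed_delta => /(killedP (@X R U Sigma) degFD degFZ _ _)->; rewrite mulr0.
Qed.
End DegreeMap.

(** [deg] is a chosen degree map or the default 0. For the default every class is in the kernel, and
    every class is a combination of the [D_], so both sides are the whole space. *)
Lemma ker_mixed_eq m (L : 'I_m -> D) : (m + 2)%N = n ->
  (forall k, big (L k) /\ nef (L k)) -> ker_mixed L = V_eff L.
Proof.
have [[f fP]|nodeg] := pselect (exists f, is_degree_map (f : A -> R^o)).
  by apply: ker_mixed_V_eff; apply: xgetPex; exists f.
have deg0 a : deg (a : A) = 0.
  by rewrite /deg xgetPN// => f fP; apply: nodeg; exists f.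
move=> _ _; apply/seteqP; split=> d _; last by move=> xi; rewrite deg0.
exists (coords d); rewrite [in RHS](eq_bigl xpredT) => [|i].
  by apply: D_sum_eq; exists 0 => w; rewrite lfunE/= addr0.
by apply/asboolP => xi; rewrite deg0.
Qed.

End Classes.

(** * Fans whose rays are indicator vectors of a nested complex *)

Section SetFan.
Local Open Scope quotient_scope.
Local Open Scope ring_scope.
Variables (R : realType) (T : finType) (U : vectType R).
Variables (q : 'Hom({ffun T -> R^o}, U)) (qP : quotient_by_eE q).
Local Notation tvec := {ffun T -> R^o}.

Lemma quotient_kernel (z z' : tvec) : q z = q z' ->
  exists c : R, forall i, z i = z' i + c.
Proof.
move=> e; have [_ kq] := qP.
have : z - z' \in lker q by rewrite memv_ker linearB/= e subrr.
rewrite kq => /vlineP[c zE]; exists c => i.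
have := congr1 (fun f : tvec => f i) zE; rewrite !ffunE finset.in_setT => h.
have -> : c = z i - z' i :> R by rewrite h [_ *: _]mulr1.
by rewrite addrC subrK.
Qed.

Lemma quotient_section x : q ((q^-1)%VF x) = x.
Proof. by have [lq _] := qP; rewrite limg_lfunVK// lq memvf. Qed.

Lemma quotient_functional (y : T -> R) : \sum_i y i = 0 ->
  exists v : 'Hom(U, R^o), forall z : tvec, v (q z) = \sum_i z i * y i.
Proof.
move=> y0; pose f (z : tvec) : R^o := \sum_i z i * y i.
have fl : linear f.
  move=> a z z'; rewrite /f scaler_sumr -big_split; apply: eq_bigr => i _.
  by rewrite !ffunE mulrDl scalerAl.
pose fL : {linear tvec -> R^o} := HB.pack f (GRing.isLinear.Build _ _ _ _ f fl).
exists (linfun fL \o q^-1)%VF => z; rewrite comp_lfunE lfunE.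
have [c zc] := quotient_kernel (quotient_section (q z)).
transitivity (\sum_i (z i + c) * y i).
  by apply: eq_bigr => i _; congr (_ * _); apply: zc.
under eq_bigr do rewrite mulrDl.
by rewrite big_split/= -mulr_sumr y0 mulr0 addr0.
Qed.

Lemma e_sum (S : {set T}) : e_ R S = \sum_(i in S) e_ R [set i]%SET.
Proof.
apply/ffunP => j; rewrite sum_ffunE ffunE big_mkcond (bigD1 j)//= ffunE finset.in_set1 eqxx.
rewrite big1 ?addr0 => [|i ij]; first by case: (j \in S).
by rewrite ffunE finset.in_set1 eq_sym (negPf ij); case: ifP.
Qed.

Variables (Sigma : fan U) (g : ray Sigma -> {set T}) (n : nat).
Hypotheses (ray_vecE : forall w, ray_vec w = q (e_ R (g w)))
  (nc : nested_complex g (fan_cones Sigma) n).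
Local Notation Delta := (fan_cones Sigma).

Lemma functional_ray (y : T -> R) (v : 'Hom(U, R^o)) w :
  (forall z : tvec, v (q z) = \sum_i z i * y i) ->
  v (ray_vec w) = \sum_(i in g w) y i.
Proof.
move=> vE; rewrite ray_vecE vE [RHS]big_mkcond; apply: eq_bigr => i _.
by rewrite ffunE; case: ifP; rewrite ?mul1r ?mul0r.
Qed.

Lemma fan_linearE : @fan_linear R U Sigma = nested_linear g.
Proof.
apply/funext => x; apply/propext; split=> [[v xv]|[y y0 xy]]; last first.
  have [v vE] := quotient_functional y0; exists v => w.
  by rewrite xy (functional_ray _ vE).
exists (fun i => v (q (e_ R [set i]%SET))) => [|w]; last first.
  by rewrite xv ray_vecE e_sum !linear_sum.
have : e_ R [set: T]%SET \in lker q by have [_ ->] := qP; apply: memv_line.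
rewrite memv_ker => /eqP /(congr1 v); rewrite linear0 e_sum !linear_sum => h.
by rewrite -[RHS]h; apply: eq_bigl => i; rewrite finset.in_setT.
Qed.

Lemma fan_lorentzian : lorentzian_complex Delta (@fan_linear R U Sigma) n.
Proof. by rewrite fan_linearE; apply: nested_lorentzian. Qed.

Definition min_on (S : {set T}) (i0 : T) (z : tvec) : R :=
  \big[Num.min/(z i0 : R)]_(i in S) (z i : R).

Lemma min_onE (S : {set T}) i0 i (z : tvec) : i0 \in S -> i \in S ->
  (forall j, j \in S -> (z i : R) <= z j) -> min_on S i0 z = z i.
Proof.
move=> i0S iS zi; apply/le_anti/andP; split; first exact: bigmin_le_cond.
by apply: le_bigmin => //; apply: zi.
Qed.

(* "Minimum over [S]" descends to the quotient by [e_E] once the minimum over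
   all coordinates is subtracted. *)
Lemma min_conewise w : exists phi : PL Sigma, forall v,
  phi (ray_vec v) = ((g w \subset g v)%:R : R).
Proof.
have [i0 i0w _] := nc_point nc w (nc_empty nc); have [o0 _] := nc_free nc (nc_empty nc).
pose m (x : U) : R^o := min_on (g w) i0 ((q^-1)%VF x) - min_on [set: T]%SET o0 ((q^-1)%VF x).
(* On the cone [s] the minimum over [g w] is attained at a point [i] lying only in members that
   contain [g w]. The overall minimum is attained at a point [o] in no member, where only the
   translation constant [l] is left. *)
have mE s (c : ray Sigma -> R) : s \in Delta -> (forall v, 0 <= c v) -> forall i o,
    i \in g w -> (forall v, v \in s -> i \in g v -> g w \subset g v) ->
    (forall v, v \in s -> o \notin g v) ->
    m (\sum_(v in s) c v *: ray_vec v) = \sum_(v in s) c v * (i \in g v)%:R.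
  move=> sC c0 i o iw hi ho; set x := \sum_(v in s) _.
  have xE : x = q (\sum_(v in s) c v *: e_ R (g v)).
    by rewrite linear_sum; apply: eq_bigr => v _; rewrite linearZ/= ray_vecE.
  have [l zl] := quotient_kernel (etrans (quotient_section x) xE).
  have zE j : (q^-1)%VF x j = \sum_(v in s) c v * (j \in g v)%:R + l :> R.
    rewrite zl sum_ffunE; congr (_ + _); apply: eq_bigr => v _.
    by rewrite !ffunE.
  rewrite /m (@min_onE _ _ i)// => [|j jw].
    rewrite (@min_onE _ _ o) ?finset.in_setT// => [|j _].
      rewrite !zE [X in _ - (X + _)]big1 => [|v vs]; first by rewrite add0r addrK.
      by rewrite (negPf (ho v vs)) mulr0.
    rewrite !zE lerD2r; apply: ler_sum => v vs.
    by rewrite (negPf (ho v vs)) mulr0 mulr_ge0.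
  rewrite !zE lerD2r; apply: ler_sum => v vs; rewrite ler_wpM2l// ler_nat.
  by case: (boolP (i \in g v)) => // /(hi v vs)/fintype.subsetP/(_ j jw)->.
have mP : m \in @conewise_linear R U Sigma.
  apply/asboolP => s sC; have [i iw hi] := nc_point nc w sC.
  have [o ho] := nc_free nc sC.
  have y0 : \sum_k ((k == i)%:R - (k == o)%:R) = 0 :> R.
    have e j : \sum_k (k == j)%:R = 1 :> R.
      by rewrite (bigD1 j)//= eqxx big1 ?addr0// => k /negPf->.
    by rewrite sumrB !e subrr.
  have [v vE] := quotient_functional y0; exists v => _ [c c0 ->].
  rewrite (mE s c sC c0 i o)// linear_sum; apply: eq_bigr => k ks.
  rewrite linearZ/= (functional_ray _ vE) sumrB.
  have e (j : T) : \sum_(l in g k) (l == j)%:R = (j \in g k)%:R :> R.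
    rewrite big_mkcond (bigD1 j)//= eqxx big1 ?addr0 => [|l /negPf->]; first by case: ifP.
    by case: ifP.
  by rewrite !e (negPf (ho k ks)) subr0.
exists (MkPL mP) => v /=; have vC := nc_vertex nc v.
have [i iw hi] := nc_point nc w vC; have [o ho] := nc_free nc vC.
have := mE _ (fun=> 1) vC (fun=> ler01) i o iw hi ho.
rewrite !big_set1 scale1r mul1r => ->; congr (nat_of_bool _)%:R.
apply/idP/idP => [|wv]; first by apply: hi; rewrite finset.in_set1.
exact: (fintype.subsetP wv).
Qed.

(** The minimum functions take the values of the containment matrix on the rays. It is unitriangular
    for the cardinality, so all ray values can be reached. *)
Lemma set_fan_courant (x : ray Sigma -> R) :
  exists phi : PL Sigma, forall w, phi (ray_vec w) = x w.
Proof.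
have [|i j _ _ ji ij|c hc] := @unitriangular_solve R (ray Sigma) [set: ray Sigma]%SET
  (fun w => #|g w|) (fun w v => (g w \subset g v)%:R) x.
- by move=> i _; rewrite subxx.
- case: (boolP (g i \subset g j)) => // gij; case/negP: ij.
  by apply/eqP/(nc_inj nc)/esym/eqP; rewrite finset.eqEcard gij.
have /choice[f hf] := min_conewise; exists (\sum_i c i *: f i) => w.
rewrite PL_sum -(hc w) ?finset.in_setT//; apply: eq_big => [i|i _].
  by rewrite finset.in_setT.
by rewrite PL_Z hf.
Qed.

Theorem set_fan_ker_mixed (weight1 : forall s : {set ray Sigma}, weight s = 1)
    (m : nat) (L : 'I_m -> D Sigma) : (m + 2)%N = fan_dim Sigma ->
  (forall k, big (L k) /\ nef (L k)) -> ker_mixed L = V_eff L.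
Proof.
have cx := fan_lorentzian; have ext := cx_extend cx.
have dimE := fan_dim_card (fun s x => ext s x) cx.
move=> md; apply: (ker_mixed_eq (nc_vertex nc) set_fan_courant (fun s x => ext s x) cx dimE weight1).
by rewrite -dimE.
Qed.

End SetFan.

(** * Bergman fans *)

Section Support.
Local Open Scope ring_scope.
Variables (R : realType) (T : finType) (r : {set T} -> nat) (U : vectType R).
Variable q : 'Hom({ffun T -> R^o}, U).
Hypotheses (rP : polymatroid r) (qP : quotient_by_eE q).
Local Notation tvec := {ffun T -> R^o}.

Lemma flagsP (C : {set {set T}}) : reflect
  ((forall F G, F \in C -> G \in C -> F \subset G \/ G \subset F) /\
   (forall F, F \in C -> [/\ flat r F, F != finset.set0 & F != finset.setT]))
  (C \in flags r).
Proof.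
rewrite finset.inE; apply: (iffP andP) => -[h1 h2]; split.
- by move=> F G FC GC; apply/orP; move: h1 => /forall_inP/(_ F FC)/forall_inP/(_ G GC).
- by move=> F FC; apply/and3P; move: h2 => /forall_inP/(_ F FC).
- by apply/forall_inP => F FC; apply/forall_inP => G GC; apply/orP/h1.
- by apply/forall_inP => F FC; apply/and3P/h2.
Qed.

Lemma support_flags x : support (matroid_fan r q) x <->
  exists C : {set {set T}}, C \in flags r /\ exists2 d : {set T} -> R,
    (forall F, 0 <= d F) & x = q (\sum_(F in C) d F *: e_ R F).
Proof.
have sub1 (C : {set {set T}}) F : C \in flags r -> F \in C -> [set F]%SET \in flags r.
  move=> /flagsP[_ pr] FC; apply/flagsP; split=> [A B|A].
    by rewrite !finset.in_set1 => /eqP-> /eqP->; left; exact: subxx.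
  by rewrite finset.in_set1 => /eqP->; apply: pr.
split=> [[s sC [c c0 ->]]|[C [CF [d d0 ->]]]].
  move: sC; rewrite finset.inE => sC.
  exists [set val t | t in s]%SET; split=> //.
  exists (fun F => if insub F is Some t then c t else 0) => [F|].
    by case: insubP.
  rewrite linear_sum big_imset/=; last by move=> a b _ _; apply: val_inj.
  by apply: eq_bigr => t _; rewrite linearZ/= valK.
pose s : {set ray (matroid_fan r q)} := [set t | val t \in C]%SET.
have sE : [set val t | t in s]%SET = C.
  apply/setP => F; apply/imsetP/idP => [[t]|FC]; first by rewrite finset.inE => + ->.
  by exists (exist _ F (sub1 _ _ CF FC)); rewrite ?finset.inE.
exists s; first by rewrite finset.inE sE.
exists (fun t => d (val t)) => //; rewrite linear_sum -{1}sE big_imset/=; last first.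
  by move=> a b _ _; apply: val_inj.
by apply: eq_bigr => t _; rewrite linearZ.
Qed.

Lemma e_in (S : {set T}) i : e_ R S i = (i \in S)%:R :> R.
Proof. by rewrite ffunE. Qed.

Lemma sum_e_in (C : {set {set T}}) (d : {set T} -> R) i :
  (\sum_(F in C) d F *: e_ R F) i = \sum_(F in C) d F * (i \in F)%:R :> R.
Proof. by rewrite sum_ffunE; apply: eq_bigr => F _; rewrite !ffunE. Qed.

(** Modulo constants the indicator of [A] is a sum over a flag. For [e] outside [A], a flat [G] with
    positive coefficient contains a point of [A] but not [e]. The sum is constant on [A], so [G]
    contains [A], and [e] raises the rank of [A]. *)
Lemma support_flat (A : {set T}) : flat r finset.set0 ->
  support (matroid_fan r q) (q (e_ R A)) -> flat r A.
Proof.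
move=> fl0 /support_flags[C [/flagsP[ch pr] [d d0 /(quotient_kernel qP)[l AE]]]].
have [->//|[i0 i0A]] := set_0Vmem A.
have val i j : \sum_(F in C) d F * ((i \in F)%:R - (j \in F)%:R) =
    (i \in A)%:R - (j \in A)%:R :> R.
  have := AE i; have := AE j; rewrite !e_in !sum_e_in => -> ->.
  by under eq_bigr do rewrite mulrBr; rewrite sumrB; ring.
apply/flatP => e eA.
have [G GC /and3P[dG iG eG]] : exists2 G, G \in C &
    [&& 0 < d G, i0 \in G & e \notin G].
  apply/exists_inP; apply: contraT => /exists_inPn no.
  have : \sum_(F in C) d F * ((i0 \in F)%:R - (e \in F)%:R) <= 0.
    apply: sumr_le0 => F FC; have := no F FC; rewrite lt_neqAle d0 andbT.
    case: eqVneq => [<-|_] /=; first by rewrite mul0r.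
    case: (i0 \in F) => /=; case: (e \in F) => //= _; rewrite ?subrr ?mulr0 ?sub0r //.
    by rewrite mulrN1 oppr_le0.
  by rewrite val i0A (negPf eA) subr0 ler10.
have [fG _ _] := pr G GC; apply: (flat_incr rP fG) => //.
apply/fintype.subsetP => i iA; apply: contraT => iNG.
have : 0 < \sum_(F in C) d F * ((i0 \in F)%:R - (i \in F)%:R).
  rewrite (bigD1 G)//= iG (negPf iNG) subr0 mulr1 ltr_pwDl// sumr_ge0// => F /andP[FC _].
  rewrite mulr_ge0// subr_ge0 ler_nat; case: (boolP (i \in F)) => // iF.
  have [FG|/fintype.subsetP->//] := ch F G FC GC.
  by rewrite (fintype.subsetP FG) in iNG.
by rewrite val i0A iA subrr ltxx.
Qed.

(** Layer-cake decomposition: the least positive value is taken off along the set [P] of positive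
    coordinates, which is a superlevel set and hence a flat; what remains has fewer positive
    coordinates. *)
Lemma superlevel_support (y : tvec) : (forall i, 0 <= (y i : R)) ->
  (forall t : R, 0 < t -> flat r [set i | t <= y i]%SET /\
     [set i | t <= y i]%SET != finset.setT) ->
  support (matroid_fan r q) (q y).
Proof.
move=> y0 lev; apply/support_flags.
(* The flats are also kept inside the positive set, so that [P] lies strictly above those found for
   the remainder. *)
suff [C [CF [d [d0 _ yE]]]] : exists C : {set {set T}}, C \in flags r /\
    exists d : {set T} -> R, [/\ forall F, 0 <= d F,
      forall F, F \in C -> F \subset [set i | 0 < (y i : R)]%SET &
      y = \sum_(F in C) d F *: e_ R F].
  by exists C; split=> //; exists d; rewrite -?yE.
move: {2}_.+1 (ltnSn #|[set i | 0 < (y i : R)]%SET|) => m.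
elim: m y y0 lev => // m IH y y0 lev ym; set P := [set i | _]%SET in ym *.
have inP k : (k \in P) = (0 < (y k : R)) by rewrite finset.inE.
have [P0|[j jP]] := set_0Vmem P.
  exists finset.set0; split.
    by apply/flagsP; split=> [F G|F]; rewrite finset.in_set0.
  exists (fun=> 0); split=> // [F|]; first by rewrite finset.in_set0.
  rewrite big_set0; apply/ffunP => i; rewrite ffunE; apply/eqP; rewrite eq_le y0 andbT.
  by have := finset.in_set0 i; rewrite -P0 inP ltNge => /negbFE.
case: (@arg_minP _ _ _ j (mem P) (fun i => y i : R) jP) => i iP imin.
have {}iP : i \in P by [].
have {}imin k : k \in P -> (y i : R) <= y k by exact: imin.
have yi : 0 < (y i : R) by rewrite -inP.
have levE (t : R) : 0 < t -> (t <= y i) -> [set k | t <= y k]%SET = P.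
  move=> t0 ti; apply/setP => k; rewrite finset.inE inP; apply/idP/idP => h.
    exact: lt_le_trans h.
  by apply: le_trans ti (imin k _); rewrite inP.
have [fP PT] := lev _ yi; rewrite (levE _ yi (lexx _)) in fP PT.
pose y' : tvec := [ffun k => if k \in P then y k - y i else 0].
have y'0 k : 0 <= (y' k : R).
  by rewrite ffunE; case: ifP => // kP; rewrite subr_ge0 imin.
have y'P k : 0 < (y' k : R) -> k \in P.
  by rewrite ffunE; case: ifP => //; rewrite ltxx.
have [t t0||C [CF [d [d0 CP yE]]]] := IH y' y'0.
- have -> : [set k | t <= y' k]%SET = [set k | t + y i <= y k]%SET.
    apply/setP => k; rewrite !finset.inE ffunE; case: ifP => [_|kP].
      by rewrite lerBrDr.
    have : (y k : R) <= 0 by move: kP; rewrite inP ltNge => /negbFE.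
    by move=> yk; rewrite !leNgt t0 (le_lt_trans yk)//; lra.
  by apply: lev; rewrite addr_gt0.
- rewrite ltnS in ym; apply: leq_trans ym; apply: proper_card; apply/properP; split.
    by apply/fintype.subsetP => k; rewrite [_ \in _]finset.inE => /y'P.
  by exists i => //; rewrite finset.inE ffunE iP subrr ltxx.
have CP' F : F \in C -> F \subset P :\ i.
  move=> /CP/fintype.subsetP FP; apply/fintype.subsetP => k /FP.
  rewrite [_ \in _]finset.inE => y'k; rewrite finset.in_setD1 (y'P _ y'k) andbT.
  by apply: contraTneq y'k => ->; rewrite ffunE iP subrr ltxx.
have PC : P \notin C.
  by apply/negP => /CP'/fintype.subsetP/(_ i iP); rewrite finset.setD11.
have FP F : F \in C -> F \subset P by move=> /CP'/fintype.subset_trans; apply; apply: finset.subsetDl.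
have [ch pr] := flagsP _ CF.
exists (P |: C)%SET; split.
  apply/flagsP; split=> [F G|F]; rewrite !finset.in_setU1.
    move=> /predU1P[->|FC] /predU1P[->|GC].
    - by left.
    - by right; apply: FP.
    - by left; apply: FP.
    - exact: ch.
  move=> /predU1P[->|/pr//]; split=> //; by apply/set0Pn; exists i.
exists (fun F => if F == P then y i else d F); split.
- by move=> F; case: ifP => _; rewrite ?(ltW yi).
- by move=> F; rewrite finset.in_setU1 => /predU1P[->//|/FP].
- apply/ffunP => k; rewrite big_setU1//= eqxx.
  have -> : \sum_(F in C) (if F == P then y i else d F : R) *: e_ R F = y'.
    rewrite yE; apply: eq_bigr => F FC; case: eqVneq => // FE.
    by rewrite FE (negPf PC) in FC.
  rewrite !ffunE; case: ifP => kP; first by rewrite [_ *: _]mulr1 addrC subrK.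
  rewrite scaler0 addr0; apply/eqP; rewrite eq_le y0 andbT.
  by move: kP; rewrite inP ltNge => /negbFE.
Qed.

End Support.

(** * From nested pairs to fans *)

Section NestedFan.
Local Open Scope ring_scope.
Variables (R : realType) (E T T0 : finType) (r : {set T} -> nat) (pi : T -> E).
Variables (U : vectType R) (q : 'Hom({ffun T -> R^o}, U)).
Variables (lab : T0 -> T + {set E}) (vec : T0 -> U) (CC : {set {set T0}}).
Hypotheses (rP : polymatroid r) (r1 : forall x (A : {set T}), (r (x |: A)%SET <= (r A).+1)%N)
  (pi_sym : forall x y (A : {set T}), pi x = pi y -> x \notin A -> y \notin A ->
     r (x |: A)%SET = r (y |: A)%SET)
  (pi_surj : forall e, exists i, pi i = e) (flat0 : flat r finset.set0)
  (qP : quotient_by_eE q) (lab_inj : injective lab)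
  (vecE : forall t, vec t = q (e_ R (ray_set pi (lab t))))
  (CCE : T -> forall C, (C \in CC) = nested_ok r pi (points_of lab C) (chain_of lab C))
  (lab_inl : forall i, nested_ok r pi [set i]%SET finset.set0 -> exists t, lab t = inl i)
  (lab_inr : forall F, nested_ok r pi finset.set0 [set F]%SET -> exists t, lab t = inr F).
Local Notation Sigma := (fan_of vec CC).

Lemma fan_ofE (s : {set ray Sigma}) :
  (s \in fan_cones Sigma) = ([set val w | w in s]%SET \in CC).
Proof. by rewrite finset.inE. Qed.

Local Notation labr := (fun w : ray Sigma => lab (val w)).

Lemma points_val (s : {set ray Sigma}) :
  points_of lab [set val w | w in s]%SET = points_of labr s.
Proof.
apply/setP => i; apply/pointsP/pointsP => [[t /imsetP[w ws ->] hw]|[w ws hw]].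
  by exists w.
by exists (val w) => //; apply: imset_f.
Qed.

Lemma chain_val (s : {set ray Sigma}) :
  chain_of lab [set val w | w in s]%SET = chain_of labr s.
Proof.
apply/setP => i; apply/chainP/chainP => [[t /imsetP[w ws ->] hw]|[w ws hw]].
  by exists w.
by exists (val w) => //; apply: imset_f.
Qed.

Lemma points_single t i : lab t = inl i -> points_of lab [set t]%SET = [set i]%SET.
Proof.
by move=> ti; rewrite -[[set t]%SET]finset.setU0 (points_inl _ ti) points0 finset.setU0.
Qed.

Lemma chain_single t F : lab t = inr F -> chain_of lab [set t]%SET = [set F]%SET.
Proof.
by move=> ti; rewrite -[[set t]%SET]finset.setU0 (chain_inr _ ti) chain0 finset.setU0.
Qed.

Lemma points_single_inr t F : lab t = inr F -> points_of lab [set t]%SET = finset.set0.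
Proof.
by move=> ti; rewrite -[[set t]%SET]finset.setU0 (points_inr _ ti) points0.
Qed.

Lemma chain_single_inl t i : lab t = inl i -> chain_of lab [set t]%SET = finset.set0.
Proof.
by move=> ti; rewrite -[[set t]%SET]finset.setU0 (chain_inl _ ti) chain0.
Qed.

Lemma fan_of_nested (x0 : T) :
  nested_complex (fun w : ray Sigma => ray_set pi (labr w)) (fan_cones Sigma)
    (r finset.setT).-1.
Proof.
apply: (flats_nested rP r1 pi_sym) => //.
- by move=> w w' /lab_inj/val_inj.
- by move=> w; rewrite fan_ofE imset_set1; apply: (valP w).
- move=> i iok; have [t ti] := lab_inl iok.
  have tC : [set t]%SET \in CC.
    by rewrite (CCE x0) (points_single ti) (chain_single_inl ti).
  by exists (exist _ t tC).
- move=> F Fok; have [t tF] := lab_inr Fok.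
  have tC : [set t]%SET \in CC.
    by rewrite (CCE x0) (points_single_inr tF) (chain_single tF).
  by exists (exist _ t tC).
- by move=> s; rewrite fan_ofE (CCE x0) points_val chain_val.
Qed.

Lemma fan_of_ker_mixed m (L : 'I_m -> D Sigma) : (m + 2)%N = fan_dim Sigma ->
  (forall k, big (L k) /\ nef (L k)) -> ker_mixed L = V_eff L.
Proof.
(* On an empty ground set all ray vectors are zero and the fan has dimension 0, which [m + 2]
   excludes. *)
move=> md; have [x0 _|noT] := pickP (fun _ : T => true); last first.
  suff d0 : fan_dim Sigma = 0%N by move: md; rewrite d0 addn2.
  apply/eqP; rewrite -leqn0; apply/bigmax_leqP => s _.
  have v0 : <[0 : U]>%VS = 0%VS by apply/eqP; rewrite -subv0 -memvE mem0v.
  rewrite /cone_dim big1 ?dimv0// => w _; rewrite /= vecE -[RHS]v0 -(linear0 q).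
  by congr (<[q _]>)%VS; apply/ffunP => i; have := noT i.
apply: (set_fan_ker_mixed qP _ (fan_of_nested x0)) => // w.
exact: vecE.
Qed.

End NestedFan.

(** * Bergman fans of matroids *)

Section Matroid.
Local Open Scope ring_scope.
Variables (R : realType) (E : finType) (r : {set E} -> nat) (U : vectType R).
Variable q : 'Hom({ffun E -> R^o}, U).
Hypotheses (rM : matroid r) (rl : loopless r) (qP : quotient_by_eE q).

Lemma preimset_id (F : {set E}) : id @^-1: F = F.
Proof. by apply/setP => i; rewrite finset.inE. Qed.

Lemma matroid_point x (A : {set E}) : (r (x |: A)%SET <= (r A).+1)%N.
Proof.
have [[r0 rm rs] rc] := rM; have := rs [set x]%SET A; have := rc [set x]%SET.
by rewrite cards1; lia.
Qed.

Lemma loopless_flat0 : flat r finset.set0.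
Proof.
have [[r0 _ _] _] := rM; apply/flatP => x _.
by rewrite r0 finset.setU0; apply: rl.
Qed.

(** Flags are the nested pairs without points. Over the identity map a fibre is a single point, so
    pairs with points do not occur. *)
Lemma flags_nested_ok (C : {set {set E}}) :
  (C \in flags r) = nested_ok r id (points_of (@inr E {set E}) C) (chain_of (@inr E {set E}) C).
Proof.
have -> : points_of (@inr E {set E}) C = finset.set0.
  by apply/setP => i; rewrite finset.in_set0; apply/negP => /pointsP[].
have -> : chain_of (@inr E {set E}) C = C.
  apply/setP => F; apply/chainP/idP => [[G GC [<-]]//|FC]; by exists F.
apply/flagsP/nested_okP => [[ch pr]|[_ ch pr _ fl]].
  split=> //.
  - by move=> e; exists e; rewrite ?finset.in_set0.
  - by move=> F /pr[].
  - exact: loopless_flat0.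
  - by move=> F /pr[]; rewrite preimset_id finset.setU0.
split=> // F FC; have [F0 FT] := pr F FC; split=> //.
by have := fl F FC; rewrite preimset_id finset.setU0.
Qed.

Lemma matroid_ker_mixed m (L : 'I_m -> D (matroid_fan r q)) :
  (m + 2)%N = fan_dim (matroid_fan r q) ->
  (forall k, big (L k) /\ nef (L k)) -> ker_mixed L = V_eff L.
Proof.
have [rP _] := rM.
apply: (@fan_of_ker_mixed R E E _ r id U q (@inr E {set E}) _ _ rP matroid_point) => //.
- by move=> x y A ->.
- by move=> e; exists e.
- exact: loopless_flat0.
- by move=> F G [].
- by move=> F /=; rewrite preimset_id.
- by move=> _; exact: flags_nested_ok.
- move=> i /nested_okP[/(_ i)[j ->]]; by rewrite finset.in_set1 eqxx.
- by move=> F _; exists F.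
Qed.

End Matroid.

(** * Bergman fans of polymatroids *)

Section Polymatroid.
Local Open Scope ring_scope.
Variables (R : realType) (E T : finType) (rk : {set E} -> nat) (pi : T -> E).
Variables (U : vectType R) (q : 'Hom({ffun T -> R^o}, U)).
Hypotheses (rkP : polymatroid rk) (rk1 : forall e, (1 <= rk [set e]%SET)%N)
  (cg : cage rk pi) (qP : quotient_by_eE q).
Local Notation r := (lift_rank rk pi).
Local Notation pvec := (poly_vec pi q).
Local Notation rP := (lift_rank_polymatroid pi rkP).

Lemma poly_vecE t : pvec t = q (e_ R (ray_set pi t)).
Proof. by case: t. Qed.

Lemma cone_point (C : {set T + {set E}}) (c : T + {set E} -> R) :
  \sum_(t in C) c t *: pvec t =
  q [ffun i => (\sum_(t in C) c t * (i \in ray_set pi t)%:R : R^o)].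
Proof.
under eq_bigr do rewrite poly_vecE -linearZ; rewrite -linear_sum; congr (q _).
by apply/ffunP => i; rewrite sum_ffunE ffunE; apply: eq_bigr => t _; rewrite !ffunE.
Qed.

Lemma sum_ray_set (C : {set T + {set E}}) (c : T + {set E} -> R) i :
  \sum_(t in C) c t * (i \in ray_set pi t)%:R =
  (inl i \in C)%:R * c (inl i) +
  \sum_(F | inr F \in C) c (inr F) * (pi i \in F)%:R.
Proof.
rewrite big_sumType/=; congr (_ + _).
  rewrite big_mkcond (bigD1 i)//= finset.in_set1 eqxx mulr1 big1 ?addr0 => [|k ki].
    by case: ifP; rewrite ?mul1r ?mul0r.
  by rewrite finset.in_set1 eq_sym (negPf ki) mulr0; case: ifP.
by apply: eq_bigr => F _; rewrite finset.inE.
Qed.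

(** A cone inside the support contains the indicators of the sets [pi @^-1: F :|: S], and an
    indicator in the support belongs to a flat. Conversely, superlevel sets of points of the cone
    have this form with fewer points, so they are flats. *)
Lemma polymatroid_cone (x0 : T) (C : {set T + {set E}}) :
  (C \in [set C in polypermutohedral_cones pi |
     `[< (cone pvec C `<=` support (matroid_fan r q))%classic >] ])%SET =
  nested_ok r pi (points_of id C) (chain_of id C).
Proof.
have inS i : (i \in points_of id C) = (inl i \in C).
  by apply/pointsP/idP => [[t tC <-]//|iC]; exists (inl i).
have inK F : (F \in chain_of id C) = (inr F \in C).
  by apply/chainP/idP => [[t tC <-]//|FC]; exists (inr F).
have SE : [set i | inl i \in C]%SET = points_of id C.
  by apply/setP => i; rewrite inS finset.inE.
have KE : [set F | inr F \in C]%SET = chain_of id C.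
  by apply/setP => F; rewrite inK finset.inE.
have flat0 := lift_rank_flat0 pi rkP rk1.
rewrite finset.inE [C \in _]finset.inE SE; apply/andP/nested_okP.
  move=> [/and3P[/forallP fib ch /forallP pr] /asboolP sub]; rewrite KE in ch.
  have fl F : inr F \in C \/ F = finset.set0 ->
      flat r (pi @^-1: F :|: points_of id C)%SET.
    move=> hF; set A := (_ :|: _)%SET; apply: (support_flat rP qP flat0); apply: sub.
    (* Points over [F] get coefficient 0, since the vector of [F] already covers them. *)
    exists (fun t => match t with inl i => (pi i \notin F)%:R | inr G => (G == F)%:R end).
      by case=> x; rewrite ler0n.
    rewrite cone_point; congr (q _); apply/ffunP => i; rewrite !ffunE sum_ray_set.
    have -> : \sum_(G | inr G \in C) (G == F)%:R * (pi i \in G)%:R = (pi i \in F)%:R :> R.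
      case: hF => [FC|F0].
        rewrite (bigD1 F)//= eqxx mul1r big1 ?addr0// => G /andP[_ /negPf->].
        by rewrite mul0r.
      rewrite F0 finset.in_set0 big1// => G _; case: eqVneq => [->|_].
        by rewrite finset.in_set0 mulr0.
      by rewrite mul0r.
    rewrite finset.in_setU finset.inE inS.
    by case: (pi i \in F); case: (inl i \in C); rewrite /= ?mul0r ?mulr0 ?mulr1 ?add0r ?addr0.
  split.
  - move=> e; have /subsetPn[i] := fib e; rewrite finset.inE finset.in_set1 => /eqP ie iS.
    by exists i.
  - by move=> F G FK GK; apply/orP; move: ch => /forall_inP/(_ F FK)/forall_inP/(_ G GK).
  - by move=> F; rewrite inK => FC; have /implyP/(_ FC)/andP := pr F.
  - by have := fl finset.set0 (or_intror erefl); rewrite preimset0 finset.set0U.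
  - by move=> F; rewrite inK => FC; apply: fl; left.
move=> okC; split.
  apply/and3P; split.
  - apply/forallP => e; have [i ie iS] := ok_fiber okC e; apply/subsetPn; exists i => //.
    by rewrite finset.inE finset.in_set1 ie.
  - rewrite KE; apply/forall_inP => F FK; apply/forall_inP => G GK; apply/orP.
    exact: (ok_chain okC).
  - by apply/forallP => F; apply/implyP; rewrite -inK => /(ok_proper okC)[-> ->].
apply/asboolP => _ [c c0 ->]; rewrite cone_point.
pose b e := \sum_(F in chain_of id C) c (inr F) * (e \in F)%:R.
set y := [ffun i => _]; have yE i : y i = (inl i \in C)%:R * c (inl i) + b (pi i) :> R.
  rewrite ffunE sum_ray_set; congr (_ + _); apply: eq_bigl => F; by rewrite inK.
have b0 e : 0 <= b e by apply: sumr_ge0 => F _; rewrite mulr_ge0.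
apply: superlevel_support => [i|t t0]; first by rewrite yE addr_ge0// mulr_ge0.
pose F := [set e | t <= b e]%SET.
(* On the least chain member containing [e] the function [b] is at least [b e], so its superlevel
   sets are unions of chain members, hence chain members or empty. *)
have FE : F = (\bigcup_(G in chain_of id C | G \subset F) G)%SET.
  apply/eqP; rewrite finset.eqEsubset; apply/andP; split; last by apply/bigcupsP => G /andP[].
  apply/fintype.subsetP => e eF.
  have [G0 /andP[G0K eG0]|noG] := pickP (fun G => (G \in chain_of id C) && (e \in G)); last first.
    move: eF; rewrite finset.inE /b big1 => [|G GK]; first by rewrite leNgt t0.
    by have := noG G; rewrite GK/= => ->; rewrite mulr0.
  case: (@arg_minnP _ G0 (fun G => (G \in chain_of id C) && (e \in G)) (fun G => #|G|)).
    by rewrite G0K.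
  move=> G /andP[GK eG] Gmin; apply/bigcupP; exists G => //; rewrite GK/=.
  apply/fintype.subsetP => e' e'G; move: eF; rewrite !finset.inE => /le_trans; apply.
  apply: ler_sum => H HK; rewrite ler_wpM2l// ler_nat.
  case: (boolP (e \in H)) => // eH; have [GH|HG] := ok_chain okC GK HK.
    by rewrite (fintype.subsetP GH).
  suff -> : H = G by rewrite e'G.
  by apply/eqP; rewrite finset.eqEcard HG; apply: Gmin; rewrite HK.
have hF : F \in chain_of id C \/ F = finset.set0.
  by have := chain_bigcup (fun G => G \subset F) okC; rewrite /= -FE => -[[]|]; [left|right].
pose S := [set i | (inl i \in C) && (t <= y i)]%SET.
have SC : S \subset points_of id C.
  by apply/fintype.subsetP => i; rewrite finset.inE inS => /andP[].
have levE : [set i | t <= y i]%SET = (pi @^-1: F :|: S)%SET.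
  apply/setP => i; rewrite finset.in_setU !finset.inE.
  have [bi|bi] := lerP t (b (pi i)) => /=.
    by rewrite yE (le_trans bi)// lerDr mulr_ge0.
  case: (boolP (inl i \in C)) => //= iC; apply/negbTE.
  by rewrite -ltNge yE (negPf iC) mul0r add0r.
have okS : nested_ok_spec r pi S (chain_of id C).
  apply/nested_okP; apply: (ok_sub rP (@lift_rank_sym _ _ _ pi rkP) SC (subxx _)).
  exact/nested_okP.
rewrite levE; split.
  by case: hF => [FK|->]; [exact: (ok_flat okS)|rewrite preimset0 finset.set0U; exact: (ok_flat0 okS)].
have [e eF] : exists e, e \notin F.
  case: hF => [/(ok_proper okC)[_]|->].
    by rewrite -finset.subTset => /subsetPn[e _ eF]; exists e.
  by exists (pi x0); rewrite finset.in_set0.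
have [i ie iS] := ok_fiber okS e.
rewrite -finset.subTset; apply/subsetPn; exists i; first by rewrite finset.in_setT.
by rewrite finset.in_setU finset.inE ie (negPf eF).
Qed.

Lemma polymatroid_ker_mixed m (L : 'I_m -> D (polymatroid_fan rk pi q)) :
  (m + 2)%N = fan_dim (polymatroid_fan rk pi q) ->
  (forall k, big (L k) /\ nef (L k)) -> ker_mixed L = V_eff L.
Proof.
apply: (@fan_of_ker_mixed R E T _ r pi U q id _ _ rP (lift_rank_point pi rkP)) => //.
- exact: (lift_rank_sym rkP).
- exact: cage_surjective cg.
- exact: lift_rank_flat0.
- exact: poly_vecE.
- exact: polymatroid_cone.
- by move=> i _; exists (inl i).
- by move=> F _; exists (inr F).
Qed.

End Polymatroid.

Theorem theorem6p12 (R : realType) (U : vectType R) (Sigma : fan U)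
    (hSigma : bergman_fan Sigma)
    (n : nat) (hn : fan_dim Sigma = n) (hn2 : (2 <= n)%N)
    (L : 'I_(n - 2) -> D Sigma) (hL : forall i, big (L i) /\ nef (L i)) :
  ker_mixed L = V_eff L.
Proof.
subst n; have md := subnK hn2.
case: hSigma hn2 L hL md => [E r q rM rl qP|E Et rk pi q rkP rk1 cg qP] hn2 L hL md.
  exact: matroid_ker_mixed.
exact: polymatroid_ker_mixed.
Qed.
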